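(* There is a universal constant $C$ such that the following holds. Let $l,m$ be positive integers, let $M=(\mu_{ij})$ be a real $l\times m$ matrix, and let $\sigma>0$. Let $Y=(y_{ij})$ be an $l\times m$ random matrix with independent entries, $y_{ij}$ being normally distributed with mean $\mu_{ij}$ and variance $\sigma^2$. Let $Z$ be an $l\times m$ random matrix with i.i.d. $N(0,1)$ entries, defined on the same probability space as $Y$, and define \[ \hat\sigma:=\frac{\|Y\|_*}{\|Z\|_*},\qquad \hat M:=\operatorname{argmin}\{\|A\|_*: A\in\mathbb{R}^{l\times m},\ \|Y-A\|_{\mathrm{HS}}^2\le lm\hat\sigma^2\}. \] Let \[ s:=\frac{\|M\|_*(\sqrt{l}+\sqrt{m})}{lm\sigma}. \] Then \[ \frac{\mathbb{E}\|\hat M-M\|_{\mathrm{HS}}^2}{lm\sigma^2}\le Cs+Cs^2+C\sqrt{\frac{1}{lm}} \] and \[ \mathbb{E}\biggl(\frac{\hat\sigma}{\sigma}-1\biggr)^2\le Cs^2+\frac{C}{lm}. \]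
   Context: $\mathbb{R}^{l\times m}$ is the set of real $l\times m$ matrices. For $A=(a_{ij})\in\mathbb{R}^{l\times m}$ with singular values $s_1,\dots,s_k$, $k=\min\{l,m\}$, the Hilbert--Schmidt norm is $\|A\|_{\mathrm{HS}}=\bigl(\sum_{i,j}a_{ij}^2\bigr)^{1/2}=\bigl(\sum_{i=1}^k s_i^2\bigr)^{1/2}$ and the nuclear norm is $\|A\|_*=\sum_{i=1}^k s_i$.
   Formalization: The second bound is stated only for lm ≥ 3: if lm ≤ 2 and Z is independent of Y, then E‖Z‖_*^{-2} is infinite, so the left side is infinite and the bound as printed fails. *)

(* Defs.v *)
From HB Require Import structures.
From mathcomp Require Import all_boot all_order all_algebra.
From mathcomp Require Import all_classical all_reals all_analysis.
From mathcomp Require polyrcf.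

Set Implicit Arguments.
Unset Strict Implicit.
Unset Printing Implicit Defensive.

Import Order.TTheory GRing.Theory Num.Theory.
Import numFieldNormedType.Exports.

Local Open Scope classical_set_scope.
Local Open Scope ring_scope.

(* The real roots of the characteristic polynomial, each one repeated according
   to its multiplicity; for a symmetric B these are all n eigenvalues. *)
Definition eigenvalues (R : realType) (n : nat) (B : 'M[R]_n) : seq R :=
  flatten [seq nseq (mup x (char_poly B)) x
          | x <- polyrcf.rootsR (char_poly B)].

(* Taking the smaller of the two Gram matrices yields exactly minn l m
   singular values, zeros included. *)
Definition singular_values (R : realType) (l m : nat) (A : 'M[R]_(l, m)) :
    seq R :=
  [seq Num.sqrt x | x <- if (l <= m)%N then eigenvalues (A *m A^T)
                         else eigenvalues (A^T *m A)].

Definition nuclear_norm (R : realType) (l m : nat) (A : 'M[R]_(l, m)) : R :=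
  \sum_(x <- singular_values A) x.

Definition hs_norm (R : realType) (l m : nat) (A : 'M[R]_(l, m)) : R :=
  Num.sqrt (\sum_(i < l) \sum_(j < m) A i j ^+ 2).

Definition argmin (R : realType) (X : Type) (f : X -> R) (D : set X) : set X :=
  [set x | D x /\ forall y, D y -> f x <= f y].

Definition mutually_independent (d : measure_display) (T : measurableType d)
    (R : realType) (P : probability T R) (I : finType)
    (X : I -> {RV P >-> R}) : Prop :=
  forall (J : {set I}) (B : I -> set R),
    (forall i, measurable (B i)) ->
    P (\bigcap_(i in [set` J]) (X i @^-1` B i)) =
      (\prod_(i in J) P (X i @^-1` B i))%E.

(* sigma is the standard deviation, as in the library's normal_prob. *)
Definition normally_distributed (d : measure_display) (T : measurableType d)
    (R : realType) (P : probability T R) (X : {RV P >-> R}) (mu sigma : R) :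
    Prop :=
  forall B : set R, measurable B -> distribution P X B = normal_prob mu sigma B.

(* A random matrix is a family of real random variables, its entries. *)
Definition rmx (d : measure_display) (T : measurableType d) (R : realType)
    (P : probability T R) (l m : nat) (Y : 'I_l -> 'I_m -> {RV P >-> R})
    (w : T) : 'M[R]_(l, m) :=
  \matrix_(i < l, j < m) Y i j w.

Definition independent_entries (d : measure_display) (T : measurableType d)
    (R : realType) (P : probability T R) (l m : nat)
    (Y : 'I_l -> 'I_m -> {RV P >-> R}) : Prop :=
  mutually_independent (fun ij : 'I_l * 'I_m => Y ij.1 ij.2).

Definition sigma_hat (d : measure_display) (T : measurableType d)
    (R : realType) (P : probability T R) (l m : nat)
    (Y Z : 'I_l -> 'I_m -> {RV P >-> R}) (w : T) : R :=
  nuclear_norm (rmx Y w) / nuclear_norm (rmx Z w).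

(* M_hat is any function choosing, at every outcome, a minimizer.  Where
   rmx Z w = 0 (a null event) sigma_hat is 0, so that the feasible set is
   the singleton of rmx Y w. *)
Definition is_M_hat (d : measure_display) (T : measurableType d)
    (R : realType) (P : probability T R) (l m : nat)
    (Y Z : 'I_l -> 'I_m -> {RV P >-> R}) (Mhat : T -> 'M[R]_(l, m)) : Prop :=
  forall w, argmin (@nuclear_norm R l m)
    [set A | hs_norm (rmx Y w - A) ^+ 2 <= (l * m)%:R * sigma_hat Y Z w ^+ 2]
    (Mhat w).

(* Main.v *)
(* Write Y = M + sigma W with W a standard Gaussian matrix, N = l m,
   n = max(l, m), k = min(l, m), and let nu be the nuclear norm.

   Comparing the minimizer with the candidates M + t (Y - M) and using the
   duality |<W, D>| <= K nu(D), K a bound for the operator norm of W, one gets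
   |Mhat - M|^2 / (N sigma^2)
     <= x^2 - |W|^2 / N + 4 kappa s + 2 kappa max(0, |W| / sqrt N - x)
   with x = sigmahat / sigma and kappa = K / sqrt n.  A sum of
   exp (g^T W h / sqrt n) over integer vectors g, h of squared norm at most 4 n
   gives such a K with bounded second moment of kappa.  The same K, for Z, gives
   nu(Z) >= |Z|^2 / K >= c N / sqrt n off an event of probability O(N^-15),
   whence |x - 1| <= C (s + |nu(W) - nu(Z)| sqrt n / N) off that event.

   No joint law of Y and Z is given, so nu(W) and nu(Z) are compared through a
   common constant a with E (nu(Z) - a)^2 = O(k).  This concentration comes from
   rotation invariance: for independent copies X, X', the mean square of
   f(X) - f(cos t X + sin t X') is at most multiplied by 4 when t is doubled,
   and a subgradient of f bounds it by O(k t^2) for small t.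

   On the exceptional event, crude bounds and Young's inequality suffice, with
   the inverse moment E |Z|^(-5/2) = O(N^(-5/4)), which is where 3 <= l m is
   needed. *)
Require Import Defs.
From HB Require Import structures.
From mathcomp Require Import all_boot all_order all_algebra.
From mathcomp Require Import complex.
From mathcomp Require Import all_classical all_reals all_analysis.
From mathcomp Require polyrcf.
From mathcomp Require Import spectral measurable_realfun.
From mathcomp Require Import ring lra zify.
Import Order.TTheory GRing.Theory Num.Theory.
Import numFieldNormedType.Exports.
Local Open Scope classical_set_scope.
Local Open Scope ring_scope.

Set Implicit Arguments.
Unset Strict Implicit.
Unset Printing Implicit Defensive.

(** * Spectral theorem and singular values *)

Section spectral_real.
Variable R : rcfType.

(** [Mhat] is an arbitrary choice of minimizers and need not be measurable. Its loss is dominated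
    outcome by outcome by an explicit measurable majorant, and only the majorant is estimated.

    Since Y and Z may be dependent, products mixing them are split by Young's inequality. With
    weight sqrt N, a factor of mean square O(1/N) times one of mean square O(1) costs O(N^(-1/2)),
    the last term of the first bound. In the second bound, |W|^2 / |Z|^2 calls for an inverse moment
    of |Z| of order above 2, to leave room for Young, and below 3, to be finite for N = 3. The order
    5/2 brings in tenth powers, and these fix the exponent 15 in the probability of the exceptional
    event. The first bound has no such restriction because |Mhat| <= 2 |Y| whatever the value of Z.

    The nuclear norm is used only through its duality with the operator norm: a certificate U with
    <A, U> = nu(A) gives the triangle inequality, the comparison with |A|, and a subgradient whose
    squared norm is at most k. *)

Lemma dot_ge0 n (x : 'rV[R]_n) : 0 <= (x *m x^T) 0 0.
Proof. by rewrite mxE sumr_ge0// => i _; rewrite mxE -expr2 sqr_ge0. Qed.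

Lemma dot_eq0 n (x : 'rV[R]_n) : ((x *m x^T) 0 0 == 0) = (x == 0).
Proof.
apply/idP/eqP => [|->]; last by rewrite mul0mx mxE.
rewrite mxE psumr_eq0 => [/allP x0|i _]; last by rewrite mxE -expr2 sqr_ge0.
apply/rowP => i; rewrite [RHS]mxE; apply/eqP; rewrite -sqrf_eq0 expr2.
by have := x0 i (mem_index_enum _); rewrite /= mxE.
Qed.

Lemma dotC n (x y : 'rV[R]_n) : (x *m y^T) 0 0 = (y *m x^T) 0 0.
Proof. by rewrite !mxE; apply: eq_bigr => i _; rewrite !mxE mulrC. Qed.

(** Over the algebraically closed extension there is an eigenvector x + iy with eigenvalue a + ib.
    Symmetry of B equates <xB, y> with <yB, x>, that is b (|x|^2 + |y|^2) = 0; so b = 0, and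
    whichever of x and y is nonzero is a real eigenvector. *)
Lemma symmetric_eigenvector n (B : 'M[R]_n.+1) : B^T = B ->
  exists v a, v != 0 :> 'rV[R]_n.+1 /\ v *m B = a *: v.
Proof.
move=> Bsym.
pose BC : 'M[complex.complex R]_n.+1 := map_mx (complex.real_complex R) B.
have [z /eigenvalueP[w wB w0]] := eigenvalue_closed BC isT.
pose x : 'rV[R]_n.+1 := \row_j complex.Re (w 0 j).
pose y : 'rV[R]_n.+1 := \row_j complex.Im (w 0 j).
pose a := complex.Re z; pose b := complex.Im z.
have xB : x *m B = a *: x - b *: y.
  apply/rowP => j; have /rowP/(_ j) := wB.
  rewrite !mxE => /(congr1 (@complex.Re R)).
  have -> : complex.Re (z * w 0 j) = a * complex.Re (w 0 j) - b * complex.Im (w 0 j).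
    by rewrite /a /b; case: (z) (w 0 j) => [? ?] [? ?].
  move=> <-; rewrite (big_morph (@complex.Re R) (id1 := 0) (op1 := +%R)) //.
    apply: eq_bigr => i _; rewrite !mxE /=; case: (w 0 i) => p q /=.
    by rewrite mulr0 subr0.
  by case=> [? ?] [? ?].
have yB : y *m B = a *: y + b *: x.
  apply/rowP => j; have /rowP/(_ j) := wB.
  rewrite !mxE => /(congr1 (@complex.Im R)).
  have -> : complex.Im (z * w 0 j) = a * complex.Im (w 0 j) + b * complex.Re (w 0 j).
    by rewrite /a /b; case: (z) (w 0 j) => [? ?] [? ?] /=; rewrite addrC.
  move=> <-; rewrite (big_morph (@complex.Im R) (id1 := 0) (op1 := +%R)) //.
    apply: eq_bigr => i _; rewrite !mxE /=; case: (w 0 i) => p q /=.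
    by rewrite mulr0 add0r.
  by case=> [? ?] [? ?].
have xy0 : x != 0 \/ y != 0.
  have [x0|] := eqVneq x 0; last by left.
  right; apply: contra_neq w0 => y0; apply/rowP => j; rewrite mxE.
  move/rowP/(_ j): x0; move/rowP/(_ j): y0; rewrite !mxE.
  by case: (w 0 j) => /= ? ? -> ->.
have addE (p q : 'M[R]_1) : (p + q) 0 0 = p 0 0 + q 0 0 by rewrite mxE.
have oppE (p : 'M[R]_1) : (- p) 0 0 = - p 0 0 by rewrite mxE.
have scaleE c (p : 'M[R]_1) : (c *: p) 0 0 = c * p 0 0 by rewrite mxE.
have b0 : b = 0.
  have e : ((x *m B) *m y^T) 0 0 = ((y *m B) *m x^T) 0 0.
    by rewrite dotC trmx_mul Bsym mulmxA.
  move: e; rewrite xB yB mulmxDl mulNmx mulmxDl -!scalemxAl !(addE, oppE, scaleE) => e.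
  have : b * ((x *m x^T) 0 0 + (y *m y^T) 0 0) = 0.
    move: e; rewrite (dotC y x); lra.
  move/eqP; rewrite mulf_eq0 paddr_eq0 ?dot_ge0// !dot_eq0.
  by case: xy0 => /negbTE ->; rewrite ?andbF ?orbF => /eqP.
case: xy0 => ?; [exists x|exists y]; exists a; split => //.
  by rewrite xB b0 scale0r subr0.
by rewrite yB b0 scale0r addr0.
Qed.

(** The Householder reflection along v - e exchanges the unit vectors e and v, so its first row is
    v. *)
Lemma orthogonal_completion n (v : 'rV[R]_n.+1) : (v *m v^T) 0 0 = 1 ->
  exists2 H : 'M[R]_n.+1, H *m H^T = 1%:M & row 0 H = v.
Proof.
move=> v1; pose e : 'rV[R]_n.+1 := delta_mx 0 0.
have [->|ve] := eqVneq v e.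
  by exists 1%:M; rewrite ?trmx1 ?mulmx1// row1.
have [w wE] : {w | w = v - e} by exists (v - e).
pose q := (w *m w^T) 0 0.
have ev : (e *m v^T) 0 0 = v 0 0 by rewrite -rowE !mxE.
have ee : (e *m e^T) 0 0 = 1 by rewrite -rowE !mxE eqxx.
have qE : q = 2 - 2 * v 0 0.
  rewrite /q wE linearB /= mulmxBl !mulmxBr !mxE -!/(mulmx _ _).
  have := dotC v e; move: ev ee v1; rewrite !mxE; lra.
have q0 : q != 0 by rewrite dot_eq0 wE subr_eq0.
pose H := 1%:M - (2 / q) *: (w^T *m w).
have wwE : w *m w^T = q%:M by apply/matrixP => i j; rewrite !ord1 [RHS]mxE eqxx.
have HT : H^T = H.
  by rewrite /H linearB /= trmx1 linearZ /= trmx_mul trmxK.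
exists H.
  rewrite HT /H mulmxBl mul1mx mulmxBr mulmx1 -!scalemxAl -!scalemxAr.
  rewrite -mulmxA (mulmxA w) wwE mul_scalar_mx -scalemxAr !scalerA.
  rewrite -[in RHS](addr0 1%:M) -!addrA; congr (_ + _).
  rewrite -scalerBl -scaleNr -scalerBl (_ : _ - _ = 0) ?scale0r//; field.
  exact: q0.
rewrite rowE -/e /H mulmxBr mulmx1 -scalemxAr mulmxA.
have -> : e *m w^T = (v 0 0 - 1)%:M.
  apply/matrixP => i j; rewrite !ord1 [RHS]mxE eqxx mulr1n.
  by rewrite wE linearB /= mulmxBr mxE ev mxE ee.
rewrite mul_scalar_mx scalerA.
rewrite (_ : 2 / q * _ = -1) ?scaleN1r ?opprK.
  by rewrite wE addrC subrK.
move: q0; rewrite qE => q0; apply: (mulIf q0); rewrite mulrAC mulrVK ?unitfE//.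
by ring.
Qed.

(** Deflation: in an orthonormal basis that starts with an eigenvector, the first row of B is a
    multiple of e, symmetry does the same for the first column, and the induction applies to the
    remaining block. *)
Theorem symmetric_diagonalization n (B : 'M[R]_n) : B^T = B ->
  exists Q (d : 'rV[R]_n), Q *m Q^T = 1%:M /\ B = Q^T *m diag_mx d *m Q.
Proof.
elim: n B => [|n IHn] B Bsym.
  by exists 1%:M, 0; split; apply/matrixP => -[].
have [v' [a [v'0 v'B]]] := symmetric_eigenvector Bsym.
pose c := Num.sqrt ((v' *m v'^T) 0 0).
have c2 : c ^+ 2 = (v' *m v'^T) 0 0 by rewrite sqr_sqrtr// dot_ge0.
have c0 : c != 0 by rewrite -sqrf_eq0 c2 dot_eq0.
pose v := c^-1 *: v'.
have vB : v *m B = a *: v by rewrite /v -scalemxAl v'B !scalerA mulrC.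
have v1 : (v *m v^T) 0 0 = 1.
  rewrite /v linearZ /= -scalemxAl -scalemxAr scalerA mxE -c2.
  by rewrite -expr2 -exprMn mulVf// expr1n.
have [H HH Hv] := orthogonal_completion v1.
have HH' : H^T *m H = 1%:M by apply: mulmx1C.
pose B1 := H *m B *m H^T.
have B1sym : B1^T = B1 by rewrite /B1 !trmx_mul trmxK Bsym mulmxA.
have B10 j : B1 0 j = a * (j == 0)%:R.
  have -> : B1 0 j = row 0 B1 0 j by rewrite [RHS]mxE.
  rewrite /B1 !row_mul Hv vB -scalemxAl -Hv -row_mul HH mxE row1 mxE eqxx.
  by rewrite eq_sym.
have BE : B = H^T *m B1 *m H.
  by rewrite /B1 !mulmxA HH' mul1mx -mulmxA HH' mulmx1.
clearbody B1.
pose B2 : 'M[R]_n := @drsubmx R 1 n 1 n B1.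
have B2sym : B2^T = B2.
  apply/matrixP => i j; rewrite !mxE.
  by move/matrixP: B1sym => /(_ (rshift 1 i) (rshift 1 j)); rewrite [LHS]mxE.
have B1E : B1 = block_mx a%:M 0 0 B2 :> 'M[R]_(1 + n).
  rewrite -[LHS](@submxK _ 1 n 1 n); congr block_mx.
  - apply/matrixP => i j; rewrite !ord1 !mxE /= (_ : lshift n 0 = 0) ?B10 ?eqxx ?mulr1//.
    exact/val_inj.
  - apply/matrixP => i j; rewrite !ord1 !mxE (_ : lshift n 0 = 0) ?B10 ?mulr0//.
    exact/val_inj.
  - apply/matrixP => i j; rewrite !ord1 !mxE.
    have -> : B1 (rshift 1 i) (lshift n (0 : 'I_1)) = B1 0 (rshift 1 i).
      by rewrite -[in LHS]B1sym mxE; congr (B1 _ _); exact/val_inj.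
    by rewrite B10 mulr0.
have [Q2 [d2 [QQ2 B2E]]] := IHn B2 B2sym.
pose Q1 : 'M[R]_(1 + n) := block_mx 1%:M 0 0 Q2.
pose d : 'rV[R]_(1 + n) := row_mx a%:M d2.
have dE : diag_mx d = block_mx a%:M 0 0 (diag_mx d2).
  rewrite /d diag_mx_row; congr block_mx.
  by apply/matrixP => i j; rewrite !ord1 !mxE eqxx.
exists (Q1 *m H), d; split.
  rewrite (_ : Q1 *m H *m _ = Q1 *m Q1^T); last first.
    by rewrite [X in _ *m X]trmx_mul mulmxA -(mulmxA Q1) HH mulmx1.
  rewrite /Q1 tr_block_mx mulmx_block.
  by rewrite !trmx0 !trmx1 !mulmx0 !mul0mx !mulmx1 !addr0 !add0r QQ2 -scalar_mx_block.
rewrite {1}BE trmx_mul !mulmxA; congr (_ *m H); rewrite -!mulmxA; congr (_ *m _).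
suff : B1 = Q1^T *m (diag_mx d *m Q1) :> 'M[R]_(1 + n) by [].
rewrite B1E dE /Q1 tr_block_mx !mulmx_block.
by rewrite !trmx0 !trmx1 !mulmx0 !mul0mx !mulmx1 !mul1mx !addr0 !add0r B2E mulmx0 mulmxA.
Qed.


Lemma char_poly_orthogonal_conj n (Q : 'M[R]_n) (d : 'rV[R]_n) :
  Q *m Q^T = 1%:M ->
  char_poly (Q^T *m diag_mx d *m Q) = \prod_i ('X - (d 0 i)%:P).
Proof.
move=> QQ.
have QQ' : map_mx polyC Q^T *m map_mx polyC Q = 1%:M :> 'M[{poly R}]_n.
  by rewrite -map_mxM (mulmx1C QQ) map_mx1.
have -> : char_poly (Q^T *m diag_mx d *m Q) = char_poly (diag_mx d).
  rewrite /char_poly /char_poly_mx !map_mxM.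
  have -> : 'X%:M = map_mx polyC Q^T *m 'X%:M *m map_mx polyC Q :> 'M[{poly R}]_n.
    by rewrite scalar_mxC -mulmxA QQ' mulmx1.
  rewrite -mulmxBl -mulmxBr !det_mulmx mulrAC -det_mulmx QQ' det1 mul1r.
  by rewrite scalar_mxC -mulmxA QQ' mulmx1.
rewrite char_poly_trig; last by apply/is_trig_mxP => i j ij; rewrite mxE lt_eqF.
by apply: eq_bigr => i _; rewrite mxE eqxx.
Qed.

Lemma mup_prod_XsubC (x : R) (s : seq R) :
  mup x (\prod_(a <- s) ('X - a%:P)) = count_mem x s.
Proof.
elim: s => [|a s IH] /=; first by rewrite big_nil mupNroot// root1.
rewrite big_cons mupM ?polyXsubC_eq0// ?monic_neq0 ?monic_prod_XsubC// IH.
by have := mup_XsubCX 1 x a; rewrite expr1 => ->; case: eqP.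
Qed.

Lemma count_flatten_nseq (T : eqType) (f : T -> nat) (r : seq T) x : uniq r ->
  count_mem x (flatten [seq nseq (f y) y | y <- r]) = ((x \in r) * f x)%N.
Proof.
elim: r => [|y r IH] //= /andP[yr ur]; rewrite count_cat IH// count_nseq inE.
case: (eqVneq x y) => [->|xy] /=.
  by rewrite (negbTE yr) eqxx !mul1n mul0n addn0.
by rewrite eq_sym (negbTE xy).
Qed.
End spectral_real.

(** Both lists are compared by number of occurrences: the multiplicity of x as a root of the
    characteristic polynomial is the number of diagonal entries equal to x. From here on, any
    orthogonal diagonalization computes singular values. *)
Lemma perm_eigenvalues (R : realType) n (Q : 'M[R]_n) (d : 'rV[R]_n) :
  Q *m Q^T = 1%:M ->
  perm_eq (eigenvalues (Q^T *m diag_mx d *m Q)) [seq d 0 i | i : 'I_n].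
Proof.
move=> QQ; apply/allP => x _ /=; apply/eqP.
rewrite /eigenvalues char_poly_orthogonal_conj//.
have -> : \prod_i ('X - (d 0 i)%:P) = \prod_(a <- [seq d 0 i | i : 'I_n]) ('X - a%:P).
  by rewrite big_map big_enum.
set p := \prod_(a <- _) _.
have p0 : p != 0 by rewrite monic_neq0// monic_prod_XsubC.
rewrite count_flatten_nseq; last exact/lt_sorted_uniq/polyrcf.sorted_roots.
rewrite mup_prod_XsubC.
have -> : (x \in polyrcf.rootsR p) = root p x.
  have := polyrcf.roots_on_rootsR p0 => /(_ x) /=.
  by move=> <-.
rewrite root_prod_XsubC; case: (boolP (x \in _)) => [_|xs]; first by rewrite mul1n.
by rewrite mul0n; apply/esym/count_memPn.
Qed.

(** * Duality between the nuclear and operator norms *)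

Section nuclear.
Variable R : realType.

Definition hsdot l m (A B : 'M[R]_(l, m)) : R := \tr (A *m B^T).

(** Only upper bounds on the operator norm are ever needed, so it is encoded by its inequalities
    instead of as a supremum. *)
Definition opbnd l m (E : 'M[R]_(l, m)) (K : R) :=
  forall (u : 'rV[R]_l) (v : 'rV[R]_m), (u *m u^T) 0 0 = 1 -> (v *m v^T) 0 0 = 1 ->
  (u *m E *m v^T) 0 0 <= K.

(** This uses [A *m A^T] for every shape, so that the arguments are made once; [nuclear_norm] is
    [nl] of A or of its transpose. *)
Let nl l m (A : 'M[R]_(l, m)) := \sum_(x <- eigenvalues (A *m A^T)) Num.sqrt x.

Let nuclear_normE l m (A : 'M[R]_(l, m)) :
  nuclear_norm A = if (l <= m)%N then nl A else nl A^T.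
Proof.
by rewrite /nuclear_norm /singular_values; case: ifP => _; rewrite big_map// /nl trmxK.
Qed.

Let mulmx_row_colE a b c (P : 'M[R]_(a, b)) (S : 'M[R]_(b, c)) i j :
  (row i P *m col j S) 0 0 = (P *m S) i j.
Proof. by rewrite !mxE; apply: eq_bigr => k _; rewrite !mxE. Qed.

Let nl_diag l m (A : 'M[R]_(l, m)) : exists Q (d : 'rV[R]_l),
  [/\ Q *m Q^T = 1%:M, A *m A^T = Q^T *m diag_mx d *m Q,
      forall i, ((row i Q *m A) *m (row i Q *m A)^T) 0 0 = d 0 i
    & nl A = \sum_i Num.sqrt (d 0 i)].
Proof.
have [|Q [d [QQ AE]]] := @symmetric_diagonalization R l (A *m A^T).
  by rewrite trmx_mul trmxK.
exists Q, d; split => // [i|].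
  rewrite trmx_mul mulmxA -(mulmxA _ A) AE !mulmxA -row_mul QQ row1.
  rewrite -rowE -row_mul tr_row mulmx_row_colE -mulmxA QQ mulmx1.
  by rewrite mxE eqxx.
by rewrite /nl AE (perm_big _ (perm_eigenvalues d QQ)) big_map big_enum.
Qed.

(** With q_i the orthonormal eigenvectors of [D *m D^T], the trace expands as the sum of <q_i E, q_i
    D>. Each term is at most K |q_i D|, and |q_i D| is a singular value of D. *)
Let nl_dual l m (E D : 'M[R]_(l, m)) K : opbnd E K -> hsdot E D <= K * nl D.
Proof.
move=> EK; have [Q [d [QQ DE dE ->]]] := nl_diag D.
have QQ' := mulmx1C QQ.
have -> : hsdot E D = \sum_i (row i Q *m E *m (row i Q *m D)^T) 0 0.
  rewrite /hsdot -(mul1mx (E *m D^T)) -QQ' -mulmxA mxtrace_mulC.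
  rewrite /mxtrace; apply: eq_bigr => i _.
  by rewrite -(row_mul i Q E) -(row_mul i Q D) tr_row mulmx_row_colE trmx_mul !mulmxA.
rewrite mulr_sumr; apply: ler_sum => i _.
have [r0|r0] := eqVneq (row i Q *m D) 0.
  by rewrite -dE r0 trmx0 !mulmx0 mxE sqrtr0 mulr0.
have d0 : 0 < d 0 i by rewrite -dE lt_def dot_ge0 dot_eq0 r0.
pose c := Num.sqrt (d 0 i).
have c0 : 0 < c by rewrite sqrtr_gt0.
have -> : row i Q *m D = c *: (c^-1 *: (row i Q *m D)).
  by rewrite scalerA divff ?scale1r// gt_eqF.
rewrite linearZ /= -scalemxAr mxE mulrC ler_pM2r//; apply: EK.
  by rewrite tr_row mulmx_row_colE QQ mxE eqxx.
rewrite linearZ /= -scalemxAl -scalemxAr scalerA mxE dE -expr2 exprVn.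
by rewrite sqr_sqrtr ?ltW// mulVf// gt_eqF.
Qed.

(** U is the partial isometry of the polar decomposition, the pseudo-inverse of (A A^T)^(1/2)
    applied to A. Then U U^T is a projection: its eigenvalues 0 and 1 give the operator bound, its
    trace the bound on |U|^2. *)
Let nl_witness l m (A : 'M[R]_(l, m)) :
  exists U, [/\ hsdot A U = nl A, opbnd U 1 & hsdot U U <= l%:R].
Proof.
have [Q [d [QQ AE dE ->]]] := nl_diag A.
have d0 i : 0 <= d 0 i by rewrite -dE dot_ge0.
have QQ' := mulmx1C QQ.
(* Where [d 0 i = 0] the inverse is 0 by convention, which makes this a pseudo-inverse. *)
pose s := \row_i (Num.sqrt (d 0 i))^-1.
pose e := \row_i ((d 0 i != 0)%:R : R).
have ds : diag_mx d *m diag_mx s = diag_mx (\row_i Num.sqrt (d 0 i)).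
  apply/matrixP => i j; rewrite mul_diag_mx !mxE.
  case: eqP => [->|]; rewrite ?mulr0n ?mulr0// !mulr1n.
  have [->|di0] := eqVneq (d 0 j) 0; first by rewrite mul0r sqrtr0.
  rewrite -{1}(sqr_sqrtr (d0 j)) expr2 mulfK// gt_eqF// sqrtr_gt0 lt_def di0.
  exact: d0.
have sds : diag_mx s *m (diag_mx d *m diag_mx s) = diag_mx e.
  rewrite ds; apply/matrixP => i j; rewrite mul_diag_mx !mxE.
  case: eqP => [->|]; rewrite ?mulr0n ?mulr0// !mulr1n.
  have [->|di0] := eqVneq (d 0 j) 0; first by rewrite sqrtr0 mulr0.
  by rewrite mulVf// gt_eqF// sqrtr_gt0 lt_def di0 d0.
pose U := Q^T *m diag_mx s *m Q *m A.
have UU : U *m U^T = Q^T *m diag_mx e *m Q.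
  rewrite /U !trmx_mul trmxK tr_diag_mx !mulmxA -(mulmxA _ A) AE !mulmxA.
  rewrite -!(mulmxA _ Q Q^T) QQ !mulmx1 -sds !mulmxA.
  by [].
have e01 i : 0 <= e 0 i <= 1 by rewrite mxE; case: (d 0 i == 0); rewrite /= ?lexx ler01.
exists U; split.
- rewrite /hsdot /U !trmx_mul trmxK tr_diag_mx !mulmxA AE.
  rewrite -(mulmxA _ Q) QQ mulmx1 mxtrace_mulC !mulmxA QQ mul1mx ds.
  by rewrite mxtrace_diag; apply: eq_bigr => i _; rewrite mxE.
- move=> u v u1 v1.
  have CS (x y : 'rV[R]_m) : 2 * (x *m y^T) 0 0 <= (x *m x^T) 0 0 + (y *m y^T) 0 0.
    rewrite !mxE mulr_sumr -big_split; apply: ler_sum => i _ /=; rewrite !mxE.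
    by have := sqr_ge0 (x 0 i - y 0 i); lra.
  have := CS (u *m U) v; rewrite v1 -mulmxA.
  suff : (u *m U *m (u *m U)^T) 0 0 <= 1 by lra.
  rewrite trmx_mul mulmxA -(mulmxA u) UU.
  have -> : u *m (Q^T *m diag_mx e *m Q) *m u^T =
     (u *m Q^T) *m diag_mx e *m (u *m Q^T)^T by rewrite trmx_mul trmxK !mulmxA.
  have : ((u *m Q^T) *m (u *m Q^T)^T) 0 0 = 1.
    by rewrite trmx_mul trmxK mulmxA -(mulmxA u) QQ' mulmx1.
  move: (u *m Q^T) => x <-; rewrite mul_mx_diag !mxE; apply: ler_sum => i _.
  rewrite !mxE mulrAC ler_piMr// -?expr2 ?sqr_ge0//.
  by have := e01 i; rewrite mxE => /andP[].
- rewrite /hsdot UU mxtrace_mulC mulmxA QQ mul1mx mxtrace_diag.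
  rewrite (@le_trans _ _ (\sum_(i < l) 1))//; last by rewrite sumr_const card_ord.
  by apply: ler_sum => i _; case/andP: (e01 i).
Qed.

Lemma hsdot_tr l m (A B : 'M[R]_(l, m)) : hsdot A^T B^T = hsdot A B.
Proof. by rewrite /hsdot trmxK -mxtrace_tr trmx_mul trmxK mxtrace_mulC. Qed.

Lemma opbnd_tr l m (E : 'M[R]_(l, m)) K : opbnd E K -> opbnd E^T K.
Proof.
move=> EK u v u1 v1; have := EK v u v1 u1.
suff -> : (u *m E^T *m v^T) 0 0 = (v *m E *m u^T)^T 0 0 by rewrite [X in _ -> X <= _]mxE.
by rewrite !trmx_mul trmxK mulmxA.
Qed.

Lemma nuclear_dual l m (E D : 'M[R]_(l, m)) K :
  opbnd E K -> hsdot E D <= K * nuclear_norm D.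
Proof.
move=> EK; rewrite nuclear_normE; case: ifP => _; first exact: nl_dual.
by rewrite -hsdot_tr; apply/nl_dual/opbnd_tr.
Qed.

(** U is a subgradient of the nuclear norm at A. The bound by [minn l m], obtained by transposing
    when l > m, is what later gives the variance its size O(k). *)
Lemma nuclear_witness l m (A : 'M[R]_(l, m)) :
  exists U, [/\ hsdot A U = nuclear_norm A, opbnd U 1
              & hsdot U U <= (minn l m)%:R].
Proof.
rewrite nuclear_normE; case: ifPn => lm.
  have [U [AU UB UU]] := nl_witness A; exists U; split => //.
  by rewrite (minn_idPl _).
have [U [AU UB UU]] := nl_witness A^T; exists U^T; split.
- by rewrite -AU -hsdot_tr trmxK.
- exact: opbnd_tr.
- by rewrite hsdot_tr (minn_idPr _)// ltnW// ltnNge.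
Qed.
End nuclear.

(** * Nuclear and Hilbert-Schmidt norms *)

Section hilbert_schmidt.
Variables (R : realType) (l m : nat).
Implicit Types (A B C : 'M[R]_(l, m)) (a : R).

Lemma hsdotE A B : hsdot A B = \sum_i \sum_j A i j * B i j.
Proof.
by apply: eq_bigr => i _; rewrite mxE; apply: eq_bigr => j _; rewrite mxE.
Qed.

Lemma hsdotC A B : hsdot A B = hsdot B A.
Proof. by rewrite /hsdot -mxtrace_tr trmx_mul trmxK. Qed.

Lemma hsdotDl A B C : hsdot (A + B) C = hsdot A C + hsdot B C.
Proof. by rewrite /hsdot mulmxDl linearD. Qed.

Lemma hsdotDr A B C : hsdot C (A + B) = hsdot C A + hsdot C B.
Proof. by rewrite !(hsdotC C) hsdotDl. Qed.

Lemma hsdotZl a A B : hsdot (a *: A) B = a * hsdot A B.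
Proof. by rewrite /hsdot -scalemxAl linearZ. Qed.

Lemma hsdotZr a A B : hsdot A (a *: B) = a * hsdot A B.
Proof. by rewrite !(hsdotC A) hsdotZl. Qed.

Lemma hsdotNl A B : hsdot (- A) B = - hsdot A B.
Proof. by rewrite -scaleN1r hsdotZl mulN1r. Qed.

Lemma hsdotNr A B : hsdot A (- B) = - hsdot A B.
Proof. by rewrite !(hsdotC A) hsdotNl. Qed.

Lemma hsdot0l A : hsdot 0 A = 0.
Proof. by rewrite -(scale0r 0) hsdotZl mul0r. Qed.

Definition hsdot_linE :=
  (hsdotDl, hsdotDr, hsdotNl, hsdotNr, hsdotZl, hsdotZr).

Lemma hsdot_ge0 A : 0 <= hsdot A A.
Proof.
by rewrite hsdotE; apply: sumr_ge0 => i _; apply: sumr_ge0 => j _; rewrite -expr2 sqr_ge0.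
Qed.

Lemma hsdot_eq0 A : hsdot A A = 0 -> A = 0.
Proof.
rewrite hsdotE => /eqP; rewrite psumr_eq0 => [/allP A0|k _]; last first.
  by apply: sumr_ge0 => k' _; rewrite -expr2 sqr_ge0.
apply/matrixP => i j; rewrite mxE; apply/eqP; rewrite -sqrf_eq0.
move: (A0 i (mem_index_enum _)); rewrite /= psumr_eq0 => [/allP Ai0|k _]; last first.
  by rewrite -expr2 sqr_ge0.
by have := Ai0 j (mem_index_enum _); rewrite /= -expr2.
Qed.

Lemma hs_norm_sqr A : hs_norm A ^+ 2 = hsdot A A.
Proof.
rewrite /hs_norm sqr_sqrtr ?hsdotE//.
by apply: sumr_ge0 => i _; apply: sumr_ge0 => j _; rewrite sqr_ge0.
Qed.

Lemma hs_norm_ge0 A : 0 <= hs_norm A. Proof. exact: sqrtr_ge0. Qed.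

Lemma hsdot_CS A B : hsdot A B <= hs_norm A * hs_norm B.
Proof.
have AB0 : 0 <= hs_norm A * hs_norm B by rewrite mulr_ge0// hs_norm_ge0.
apply: (le_trans (ler_norm _)); rewrite -(ger0_norm AB0) -ler_sqr ?nnegrE//.
rewrite !real_normK ?num_real// exprMn !hs_norm_sqr.
have [/hsdot_eq0 ->|B0] := eqVneq (hsdot B B) 0.
  by rewrite hsdotC !hsdot0l expr0n mulr0.
have := hsdot_ge0 (hsdot B B *: A - hsdot A B *: B).
rewrite !hsdot_linE (hsdotC B A).
have Bp : 0 < hsdot B B by rewrite lt_def B0 hsdot_ge0.
move=> h; rewrite -(ler_pM2l Bp); move: h.
by move: (hsdot A A) (hsdot B B) (hsdot A B) => x y z; lra.
Qed.

(** The form is the inner product of A with the matrix u^T v, whose Hilbert-Schmidt norm is 1. *)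
Lemma opbnd_hs A : opbnd A (hs_norm A).
Proof.
move=> u v u1 v1.
have trE (x : 'M[R]_1) : \tr x = x 0 0 by rewrite /mxtrace big_ord1.
have -> : (u *m A *m v^T) 0 0 = hsdot A (u^T *m v).
  by rewrite /hsdot trmx_mul trmxK mulmxA mxtrace_mulC mulmxA trE.
apply: (le_trans (hsdot_CS _ _)).
suff -> : hs_norm (u^T *m v) = 1 by rewrite mulr1.
apply/eqP; rewrite -(@eqrXn2 _ 2)// ?hs_norm_ge0// hs_norm_sqr expr1n.
rewrite /hsdot trmx_mul trmxK mulmxA -(mulmxA u^T) mxtrace_mulC mulmxA trE.
by rewrite -(mulmxA u^T) (mulmxA u) [u *m u^T]mx11_scalar u1 mul_scalar_mx scale1r v1.
Qed.

Lemma nuclear_le_of_opbnd A U : opbnd U 1 -> hsdot A U <= nuclear_norm A.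
Proof. by move=> /(nuclear_dual A); rewrite mul1r hsdotC. Qed.

Lemma nuclear_ge0 A : 0 <= nuclear_norm A.
Proof.
rewrite -(hsdot0l A); have := @nuclear_dual R l m 0 A 0.
rewrite mul0r hsdot0l => h.
have := @nuclear_dual R l m 0 A 1; rewrite mul1r hsdot0l; apply => u v _ _.
by rewrite mulmx0 mul0mx mxE ler01.
Qed.

Lemma nuclear_tri A B : nuclear_norm (A + B) <= nuclear_norm A + nuclear_norm B.
Proof.
have [U [<- U1 _]] := nuclear_witness (A + B).
by rewrite hsdotDl lerD// nuclear_le_of_opbnd.
Qed.

Lemma opbndN A K : opbnd A K -> opbnd (- A) K.
Proof.
move=> UK u v u1 v1; have := UK u (- v) u1.
rewrite linearN /= mulmxN mulNmx opprK => /(_ v1).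
by rewrite mulmxN mulmxN mulNmx.
Qed.

Lemma nuclearN A : nuclear_norm (- A) = nuclear_norm A.
Proof.
have le_nuclearN B : nuclear_norm (- B) <= nuclear_norm B.
  have [U [<- U1 _]] := nuclear_witness (- B).
  by rewrite hsdotNl -hsdotNr; apply/nuclear_le_of_opbnd/opbndN.
by apply/eqP; rewrite eq_le le_nuclearN -{1}(opprK A) le_nuclearN.
Qed.

Lemma nuclearZ a A : 0 <= a -> nuclear_norm (a *: A) = a * nuclear_norm A.
Proof.
move=> a0; apply/eqP; rewrite eq_le; apply/andP; split.
  have [U [<- U1 _]] := nuclear_witness (a *: A).
  by rewrite hsdotZl ler_wpM2l// nuclear_le_of_opbnd.
have [U [<- U1 _]] := nuclear_witness A.
by rewrite -hsdotZl nuclear_le_of_opbnd.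
Qed.

(** Duality of A with itself: |A|^2 = <A, A> <= |A| nu(A), and |A| cancels. *)
Lemma hs_le_nuclear A : hs_norm A <= nuclear_norm A.
Proof.
have := nuclear_dual A (opbnd_hs A); rewrite -hs_norm_sqr.
have := hs_norm_ge0 A; rewrite le_eqVlt => /orP[/eqP <-|A0].
  by rewrite nuclear_ge0.
by rewrite expr2 ler_pM2l.
Qed.

Lemma nuclear_le_hs A : nuclear_norm A <= Num.sqrt (minn l m)%:R * hs_norm A.
Proof.
have [U [<- _ UU]] := nuclear_witness A.
rewrite mulrC; apply: (le_trans (hsdot_CS _ _)); rewrite ler_wpM2l ?hs_norm_ge0//.
by rewrite -[leLHS]ger0_norm ?hs_norm_ge0// -sqrtr_sqr ler_sqrt// hs_norm_sqr.
Qed.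

Lemma nuclear_lip A B : `|nuclear_norm A - nuclear_norm B| <= nuclear_norm (A - B).
Proof.
have := nuclear_tri (A - B) B; have := nuclear_tri (B - A) A.
rewrite !subrK -(nuclearN (B - A)) opprB ler_norml.
move: (nuclear_norm A) (nuclear_norm B) (nuclear_norm (A - B)) => x y z ? ?.
by apply/andP; split; lra.
Qed.
End hilbert_schmidt.

(** * Rounding unit vectors to integer vectors *)

Section lattice.
Variable R : realType.

(** Encodes the integers from -(N+1) to N+1 by a finite type. The margin of 1 beyond N is for
    rounding a number of [-N, N] away from 0. *)
Definition lattice_coord n N (g : {ffun 'I_n -> 'I_N.*2.+3}) (i : 'I_n) : R :=
  (g i)%:R - N.+1%:R.

(** Rounding up when c is positive and down otherwise cannot decrease the product with c; it moves x
    by at most 1, whence the bound on the square. *)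
Lemma round_towards (N : nat) (x c : R) : `|x| <= N%:R ->
  exists a : 'I_N.*2.+3, let z := a%:R - N.+1%:R in
    x * c <= z * c /\ z ^+ 2 <= 2 * x ^+ 2 + 2.
Proof.
rewrite ler_norml => /andP[xl xu].
have y0 : 0 <= x + N.+1%:R by rewrite -natr1; lra.
have /andP[al au] := truncn_itv y0; set a := Num.truncn _ in al au.
have aN : (a < N.*2.+2)%N.
  rewrite -(ltr_nat R) (le_lt_trans al)// -[N.*2.+2%:R]natr1 -[N.*2.+1%:R]natr1.
  by rewrite -addnn natrD -natr1; lra.
have sq z : (x - z) ^+ 2 <= 1 -> z ^+ 2 <= 2 * x ^+ 2 + 2.
  by move=> xz; have := sqr_ge0 (2 * x - z); lra.
have [c0|/ltW c0] := lerP c 0.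
  exists (Ordinal (ltnW aN : (a < N.*2.+3)%N)) => /=; split.
    by rewrite ler_wnM2r// lerBlDr.
  by apply: sq; move: al au; rewrite -!natr1 => al au; nra.
exists (Ordinal (aN : (a.+1 < N.*2.+3)%N)) => /=; split.
  by rewrite ler_wpM2r// lerBrDr ltW.
by apply: sq; move: al au; rewrite -!natr1 => al au; nra.
Qed.

(** The unit vectors are scaled by sqrt n and rounded one after the other, each in the direction
    that increases the bilinear form. Unlike approximation by a net, this loses nothing in the value
    of the form; the price is a squared norm at most 2n + 2n instead of n. *)
Lemma lattice_dominates l m (W : 'M[R]_(l, m)) (u : 'rV[R]_l) (v : 'rV[R]_m) :
  let n := maxn l m in
  (u *m u^T) 0 0 = 1 -> (v *m v^T) 0 0 = 1 ->
  exists (g : {ffun 'I_l -> 'I_n.*2.+3}) (h : {ffun 'I_m -> 'I_n.*2.+3}),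
    [/\ \sum_i lattice_coord g i ^+ 2 <= 4 * n%:R, \sum_j lattice_coord h j ^+ 2 <= 4 * n%:R
      & n%:R * (u *m W *m v^T) 0 0 <= \sum_i \sum_j lattice_coord g i * W i j * lattice_coord h j].
Proof.
move=> n u1 v1.
have n0 : 0 <= n%:R :> R by [].
pose q := Num.sqrt n%:R : R.
have q2 : q * q = n%:R by rewrite -expr2 sqr_sqrtr.
have qn : q <= n%:R.
  have [nz|npos] := posnP n; first by rewrite /q nz sqrtr0.
  rewrite -q2 ler_peMr ?sqrtr_ge0// -sqrtr1 ler_sqrt// ler1n//.
have rnd k (w : 'rV[R]_k) (c : 'I_k -> R) : (k <= n)%N -> (w *m w^T) 0 0 = 1 ->
    exists g : {ffun 'I_k -> 'I_n.*2.+3}, \sum_i lattice_coord g i ^+ 2 <= 4 * n%:R /\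
      forall i, q * w 0 i * c i <= lattice_coord g i * c i.
  move=> kn w1.
  have w1' : \sum_i w 0 i ^+ 2 = 1.
    by rewrite -w1 mxE; apply: eq_bigr => i _; rewrite mxE expr2.
  have wn i : `|q * w 0 i| <= n%:R.
    rewrite normrM ger0_norm ?sqrtr_ge0// (le_trans _ qn)// ler_piMr ?sqrtr_ge0//.
    rewrite -(@ler_pXn2r _ 2)// ?nnegrE// real_normK ?num_real// expr1n -w1'.
    by rewrite (bigD1 i)//= lerDl sumr_ge0// => j _; rewrite sqr_ge0.
  have gE i := round_towards (c i) (wn i).
  pose g := [ffun i => projT1 (cid (gE i))].
  exists g; split=> [|i]; last first.
    by rewrite /lattice_coord ffunE; case: cid => a /= [].
  apply: (@le_trans _ _ (\sum_i (2 * n%:R * w 0 i ^+ 2 + 2))).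
    apply: ler_sum => i _; rewrite /lattice_coord ffunE; case: cid => a /= [_].
    by rewrite exprMn [q ^+ 2]expr2 q2 mulrA.
  rewrite big_split /= -mulr_sumr w1' sumr_const card_ord mulr1 -mulr_natr.
  have : k%:R <= n%:R :> R by rewrite ler_nat.
  lra.
have [g [g2 gu]] := rnd l u (fun i => q * (W *m v^T) i 0) (leq_maxl _ _) u1.
(* The rounding of v is directed by the already rounded g, since the form is linear in each vector
   separately. *)
have [h [h2 hv]] := rnd m v (fun j => \sum_i lattice_coord g i * W i j) (leq_maxr _ _) v1.
exists g, h; split => //.
have -> : n%:R * (u *m W *m v^T) 0 0 = \sum_i q * u 0 i * (q * (W *m v^T) i 0).
  by rewrite -mulmxA mxE mulr_sumr; apply: eq_bigr => i _; rewrite -q2; ring.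
apply: (@le_trans _ _ (\sum_i lattice_coord g i * (q * (W *m v^T) i 0))).
  by apply: ler_sum => i _.
have -> : \sum_i lattice_coord g i * (q * (W *m v^T) i 0) =
    \sum_j q * v 0 j * (\sum_i lattice_coord g i * W i j).
  under eq_bigr do rewrite mxE mulr_sumr mulr_sumr.
  rewrite exchange_big; apply: eq_bigr => j _; rewrite mulr_sumr.
  by apply: eq_bigr => i _; rewrite mxE; ring.
rewrite exchange_big; apply: ler_sum => j _.
by rewrite -mulr_suml [leRHS]mulrC.
Qed.
End lattice.

(** * Laws of Gaussian families *)

Section integral_monotone.
Local Open Scope ereal_scope.
Import HBNNSimple.

(* No measurability of [f]: the integral of a nonnegative function is a
   supremum over the simple functions below it. *)
Lemma ge0_le_integral_nonmeasurable d (T : measurableType d) (R : realType)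
    (mu : {measure set T -> \bar R}) (f g : T -> \bar R) :
  (forall x, 0 <= f x) -> (forall x, f x <= g x) ->
  \int[mu]_x f x <= \int[mu]_x g x.
Proof.
move=> f0 fg; rewrite !ge0_integralTE//; last by move=> x; exact: le_trans (fg x).
apply: ereal_sup_le => _ [h /= hf <-]; exists h => //= x.
exact: le_trans (fg x).
Qed.

Lemma law_eq d1 d2 d (T1 : measurableType d1) (T2 : measurableType d2)
    (S : measurableType d) (R : realType)
    (mu1 : {measure set T1 -> \bar R}) (mu2 : {measure set T2 -> \bar R})
    (V1 : T1 -> S) (V2 : T2 -> S) (G : set (set S)) (f : S -> \bar R) :
  measurable_fun setT V1 -> measurable_fun setT V2 ->
  @measurable _ S = <<s G >> -> setI_closed G -> G setT ->
  mu1 setT < +oo ->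
  (forall B, G B -> mu1 (V1 @^-1` B) = mu2 (V2 @^-1` B)) ->
  measurable_fun setT f -> (forall x, 0 <= f x) ->
  \int[mu1]_x f (V1 x) = \int[mu2]_x f (V2 x).
Proof.
move=> mV1 mV2 GE GI GT fin12 eq12 mf f0.
pose V1' : {mfun T1 >-> S} := HB.pack V1 (isMeasurableFun.Build _ _ _ _ _ mV1).
pose V2' : {mfun T2 >-> S} := HB.pack V2 (isMeasurableFun.Build _ _ _ _ _ mV2).
have <- : \int[pushforward mu1 V1']_x f x = \int[mu1]_x f (V1 x).
  by rewrite ge0_integral_pushforward// => x _; exact: f0.
have <- : \int[pushforward mu2 V2']_x f x = \int[mu2]_x f (V2 x).
  by rewrite ge0_integral_pushforward// => x _; exact: f0.
apply: eq_measure_integral => A mA _.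
apply: (@g_sigma_algebra_measure_unique _ _ _ G _ (fun=> setT)) => //.
- by rewrite GE; exact: sub_sigma_algebra.
- by rewrite bigcup_const//; exists 0%N.
- by rewrite -GE.
Qed.
End integral_monotone.

Section fspace.
Variables (R : realType) (I : finType).

Definition boxes : set (set (I -> R)) :=
  [set [set x | forall i, B i (x i)] | B in [set B | forall i, measurable (B i)]].

(** The product sigma-algebra, presented by boxes because these form a pi-system: laws agreeing on
    boxes agree. *)
Definition fspace := g_sigma_algebraType boxes.

Lemma boxesI : setI_closed boxes.
Proof.
move=> _ _ [A mA <-] [B mB <-]; exists (fun i => A i `&` B i).
  by move=> i; exact: measurableI.
by apply/seteqP; split => x /= => [AB|[Ax Bx] i]; split => // i; case: (AB i).
Qed.

Lemma boxesT : boxes setT.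
Proof. by exists (fun=> setT) => //; apply/seteqP; split. Qed.

Lemma measurable_fspace d (T : measurableType d) (X : T -> fspace) :
  (forall i, measurable_fun setT (fun w => X w i)) -> measurable_fun setT X.
Proof.
move=> mX; apply: (@measurability _ _ T fspace setT X boxes erefl) => _ [_ [B mB <-] <-].
rewrite setTI (_ : _ @^-1` _ = \bigcap_(i in [set: I]) ((fun w => X w i) @^-1` B i)).
  apply: fin_bigcap_measurable => // i _; rewrite -[_ @^-1` _]setTI.
  exact: mX.
by apply/seteqP; split => w /= XB i; [move=> _; exact: XB|exact: XB].
Qed.

Lemma measurable_coord i : measurable_fun setT (fun x : fspace => x i).
Proof.
move=> _ B mB; rewrite setTI; apply: sub_sigma_algebra.
exists (fun j => if j == i then B else setT); first by move=> j; case: eqP.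
apply/seteqP; split => x /= => [/(_ i)|xB j]; first by rewrite eqxx.
by case: eqP => [->|].
Qed.

(** A Lipschitz function is the infimum, over rational points z, of the cones f(z) + L |x - z|_1.
    Its strict sublevel sets are thus countable unions of sublevel sets of cones, which are
    measurable. *)
Lemma measurable_lipschitz d (T : measurableType d) (X : T -> I -> R)
    (f : (I -> R) -> R) (L : R) : 0 <= L ->
  (forall x y, `|f x - f y| <= L * \sum_i `|x i - y i|) ->
  (forall i, measurable_fun setT (fun w => X w i)) ->
  measurable_fun setT (fun w => f (X w)).
Proof.
move=> L0 fL mX.
apply: (measurability _ (RGenInftyO.measurableE R)) => _ [_ [c ->] <-].
rewrite setTI.
pose q (z : {ffun I -> rat}) (i : I) : R := ratr (z i).
pose F (z : {ffun I -> rat}) := [set w | f (q z) + L * \sum_i `|X w i - q z i| < c].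
have -> : (fun w => f (X w)) @^-1` `]-oo, c[%classic = \bigcup_z F z.
  apply/seteqP; split => w /=; rewrite in_itv /=; last first.
    by move=> [z _ /=]; apply: le_lt_trans; have := fL (X w) (q z); rewrite ler_norml; lra.
  (* Within e of X in each coordinate, the cone at a rational point exceeds f(X) by at most 2 L |I|
     e, which is less than K e = c - f(X). *)
  move=> fc; pose K := (2 * L * #|I|%:R + 1).
  have K0 : 0 < K by rewrite ltr_wpDl// !mulr_ge0.
  pose e := (c - f (X w)) / K.
  have e0 : 0 < e by rewrite divr_gt0// subr_gt0.
  have qE i : exists r : rat, `|X w i - ratr r| < e.
    have [r] := @rat_in_itvoo R (X w i - e) (X w i + e) ltac:(lra).
    by rewrite in_itv /= => /andP[? ?]; exists r; rewrite ltr_norml; apply/andP; split; lra.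
  pose z := [ffun i => projT1 (cid (qE i))].
  have zE i : `|X w i - q z i| <= e by rewrite /q ffunE; case: cid => r /= /ltW.
  exists z => //=; rewrite /F /=.
  have S : \sum_i `|X w i - q z i| <= #|I|%:R * e.
    by rewrite (le_trans (ler_sum _ (fun i _ => zE i)))// sumr_const mulr_natl.
  have := fL (X w) (q z); rewrite ler_norml => /andP[fz _].
  have eK : e * K = c - f (X w) by rewrite /e divfK// gt_eqF.
  have LS : L * \sum_i `|X w i - q z i| <= L * (#|I|%:R * e) by rewrite ler_wpM2l.
  move: fz LS eK; rewrite /K; lra.
apply: countable_bigcupT_measurable => [|z]; first exact: countableP.
have mF : measurable_fun setT (fun w => f (q z) + L * \sum_i `|X w i - q z i|).
  apply: measurable_funD => //; apply: measurable_funM => //.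
  apply: measurable_sum => i; apply: measurableT_comp => //.
  exact: measurable_funB.
rewrite -[F z]setTI.
have := mF measurableT _ (measurable_itv `]-oo, c[); congr measurable; congr (_ `&` _).
Qed.
End fspace.

Lemma emeasurable_prod d (T : measurableType d) (R : realType) (I : Type)
    (s : seq I) (h : I -> T -> \bar R) :
  (forall i, measurable_fun setT (h i)) ->
  measurable_fun setT (fun w => \prod_(i <- s) h i w)%E.
Proof.
move=> mh; elim: s => [|i s IH].
  by rewrite (_ : (fun w => _) = cst 1%E)//; apply/funext => w; rewrite big_nil.
under eq_fun do rewrite big_cons.
exact: emeasurable_funM.
Qed.

Section gaussian_family.
Variable R : realType.
Local Open Scope ereal_scope.
Local Notation gam := (@normal_prob R 0 1).

(** Independence and marginal laws in a single formula; taking B i = setT for some indices recovers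
    the subfamilies. *)
Definition iid_gaussian d (T : measurableType d) (P : probability T R) (I : finType)
    (X : I -> T -> R) :=
  (forall i, measurable_fun setT (X i)) /\
  forall B : I -> set R, (forall i, measurable (B i)) ->
    P [set w | forall i, B i (X i w)] = \prod_i gam (B i).

Lemma iid_gaussian_law d1 d2 (T1 : measurableType d1) (T2 : measurableType d2)
    (P1 : probability T1 R) (P2 : probability T2 R) (I : finType)
    (X1 : I -> T1 -> R) (X2 : I -> T2 -> R) (f : fspace R I -> \bar R) :
  iid_gaussian P1 X1 -> iid_gaussian P2 X2 ->
  measurable_fun setT f -> (forall x, 0 <= f x) ->
  \int[P1]_w f (X1 ^~ w) = \int[P2]_w f (X2 ^~ w).
Proof.
move=> [m1 X1B] [m2 X2B] mf f0.
refine (@law_eq _ _ _ _ _ (fspace R I) R P1 P2 (fun w => X1 ^~ w) (fun w => X2 ^~ w)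
  (@boxes R I) f _ _ _ _ _ _ _ _ _) => //.
- exact: measurable_fspace.
- exact: measurable_fspace.
- exact: boxesI.
- exact: boxesT.
- by rewrite (le_lt_trans (probability_le1 _ _))// ltry.
- by move=> _ [B mB <-]; rewrite [LHS]X1B// [RHS]X2B.
Qed.

(* The coordinate [i] is replaced by an independent standard Gaussian on the
   product space; coordinates outside of [i :: s] are set to 0. *)
Lemma iid_gaussian_prod d (T : measurableType d) (P : probability T R) (I : finType)
    (X : I -> T -> R) (f : I -> R -> \bar R) :
  iid_gaussian P X -> (forall i, measurable_fun setT (f i)) -> (forall i x, 0 <= f i x) ->
  \int[P]_w \prod_i f i (X i w) = \prod_i \int[gam]_x f i x.
Proof.
move=> [mX XB] mf f0.
suff H (s : seq I) : uniq s ->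
    \int[P]_w \prod_(i <- s) f i (X i w) = \prod_(i <- s) \int[gam]_x f i x.
  exact: (H _ (index_enum_uniq I)).
elim: s => [_|i s IH /= /andP[i_s us]].
  rewrite big_nil; under eq_integral do rewrite big_nil.
  rewrite integral_cst// mul1e; exact: probability_setT.
rewrite big_cons -(IH us).
pose V1 (w : T) : fspace R I := fun j => if j \in i :: s then X j w else 0%R.
pose V2 (xw : R * T) : fspace R I :=
  fun j => if j == i then xw.1 else if j \in s then X j xw.2 else 0%R.
pose F (y : fspace R I) := f i (y i) * \prod_(j <- s) f j (y j).
have mV1 : measurable_fun setT V1.
  by apply: measurable_fspace => j; rewrite /V1; case: (j \in _).
have mV2 : measurable_fun setT V2.
  apply: measurable_fspace => j; rewrite /V2; case: (j == i); first exact: measurable_fst.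
  by case: (j \in s) => //; apply: measurableT_comp => //; exact: measurable_snd.
have mF : measurable_fun setT F.
  apply: emeasurable_funM; first by apply: measurableT_comp => //; exact: measurable_coord.
  apply: emeasurable_prod => j; apply: measurableT_comp => //; exact: measurable_coord.
have F0 y : 0 <= F y by rewrite mule_ge0// prode_ge0.
transitivity (\int[P]_w F (V1 w)).
  apply: eq_integral => w _; rewrite big_cons /F /V1 inE eqxx /=; congr (_ * _).
  by rewrite !big_seq; apply: eq_bigr => j js; rewrite inE js orbT.
transitivity (\int[(gam \x P)%E]_xw F (V2 xw)).
  refine (@law_eq _ _ _ _ _ (fspace R I) R P (gam \x P)%E V1 V2
    (@boxes R I) F _ _ _ _ _ _ _ _ _) => //.
  - exact: boxesI.
  - exact: boxesT.
  - by rewrite (le_lt_trans (probability_le1 _ _))// ltry.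
  move=> _ [B mB <-].
  (* Coordinates outside [i :: s] are constantly 0 under both maps: if some such B j misses 0, both
     preimages are empty, and otherwise these coordinates impose no condition. *)
  pose B0 := [forall j, (j \in i :: s) || `[< B j 0%R >]].
  have [B0T|] := boolP B0; last first.
    rewrite negb_forall => /existsP[j]; rewrite negb_or => /andP[js /asboolPn Bj].
    have e1 : V1 @^-1` [set x | forall i, B i (x i)] = set0.
      by apply/seteqP; split => w //= /(_ j); rewrite /V1 (negbTE js).
    have e2 : V2 @^-1` [set x | forall i, B i (x i)] = set0.
      apply/seteqP; split => w //= /(_ j); rewrite /V2.
      by move: js; rewrite inE negb_or => /andP[/negbTE -> /negbTE ->].
    by transitivity (P set0); [rewrite -e1|rewrite measure0 -(measure0 (gam \x P)) -e2].
  have B0j j : j \notin i :: s -> B j 0%R.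
    by move/forallP : B0T => /(_ j) /orP[->//|/asboolP].
  pose C j := if j \in s then B j else setT.
  pose D j := if j \in i :: s then B j else setT.
  have mC j : measurable (C j) by rewrite /C; case: ifP.
  have mD j : measurable (D j) by rewrite /D; case: ifP.
  have e1 : V1 @^-1` [set x | forall i, B i (x i)] = [set w | forall j, D j (X j w)].
    apply/seteqP; split => w /= + j => /(_ j); rewrite /V1 /D; case: ifPn => //.
    by move=> js _; exact: B0j.
  have e2 : V2 @^-1` [set x | forall i, B i (x i)] = B i `*` [set w | forall j, C j (X j w)].
    apply/seteqP; split => -[x w] /=.
      move=> H; split => [|j]; first by have := H i; rewrite /V2 /= eqxx.
      have := H j; rewrite /V2 /C /=; case: (eqVneq j i) => [->|_]; last by case: ifP.
      by rewrite (negbTE i_s).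
    move=> [Bx Cx] j; rewrite /V2 /=; case: (eqVneq j i) => [->//|ji].
    have := Cx j; rewrite /C; case: ifPn => // js _; apply: B0j.
    by rewrite inE negb_or ji.
  transitivity (P [set w | forall j, D j (X j w)]); first by rewrite -e1.
  transitivity ((gam \x P) (B i `*` [set w | forall j, C j (X j w)])); last by rewrite -e2.
  rewrite product_measure1E; [|exact: mB|]; last first.
    rewrite (_ : [set w | _] = \bigcap_(j in [set: I]) (X j @^-1` C j)).
      apply: fin_bigcap_measurable => // j _; rewrite -[_ @^-1` _]setTI; exact: mX.
    by apply/seteqP; split => w /= H j; [move=> _; exact: H|exact: H].
  transitivity (gam (B i) * \prod_j gam (C j)); last first.
    by congr (_ * _); exact/esym/XB.
  rewrite (XB D mD) (bigD1 i)//= [in RHS](bigD1 i)//= /C /D inE eqxx /= (negbTE i_s).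
  rewrite probability_setT mul1e; congr (_ * _); apply: eq_bigr => j ji.
  by rewrite inE (negbTE ji).
rewrite fubini_tonelli1//=; last exact: measurableT_comp.
transitivity (\int[gam]_x (f i x * \int[P]_w \prod_(j <- s) f j (X j w))).
  apply: eq_integral => x _; rewrite /fubini_F -ge0_integralZl//.
  - apply: eq_integral => w _; rewrite /F /V2 /= eqxx; congr (_ * _).
    rewrite !big_seq; apply: eq_bigr => j js; rewrite js.
    by case: eqP js i_s => [-> ->|].
  - by apply: emeasurable_prod => j; apply: measurableT_comp.
  - by move=> w _; rewrite prode_ge0.
apply: ge0_integralZr => //; [exact: mf|]; apply: integral_ge0 => w _.
by rewrite prode_ge0.
Qed.
End gaussian_family.

(** * Rotation invariance *)

Section density.
Local Open Scope ereal_scope.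
Import HBNNSimple.
Context d (T : measurableType d) (R : realType).
Variables (mu nu : {measure set T -> \bar R}) (g : T -> R).
Hypothesis mg : measurable_fun setT g.
Hypothesis g0 : forall x, (0 <= g x)%R.
Hypothesis nuE : forall A, measurable A -> nu A = \int[mu]_(x in A) (g x)%:E.

(** Monotone convergence along simple functions, on both sides, reduces the claim to indicators,
    where it is [nuE]. *)
Lemma ge0_integral_density (f : T -> \bar R) :
  measurable_fun setT f -> (forall x, 0 <= f x) ->
  \int[nu]_x f x = \int[mu]_x (f x * (g x)%:E).
Proof.
move=> mf f0; pose h := nnsfun_approx measurableT mf.
have -> : \int[nu]_x f x = lim (\int[nu]_x (EFin \o h n) x @[n --> \oo]).
  have fE x : f x = lim ((EFin \o h n) x @[n --> \oo]).
    by apply/esym/cvg_lim => //; exact: cvg_nnsfun_approx.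
  under eq_integral => x _ do rewrite fE.
  apply: monotone_convergence => //.
  - by move=> n; apply/measurable_EFinP; exact/measurable_funP.
  - by move=> n x _ //=; rewrite lee_fin.
  - by move=> x _ a b ab; rewrite lee_fin; exact/lefP/nd_nnsfun_approx.
have -> : \int[mu]_x (f x * (g x)%:E) =
    lim (\int[mu]_x ((h n x)%:E * (g x)%:E) @[n --> \oo]).
  have fg x : f x * (g x)%:E = lim (((h n x)%:E * (g x)%:E) @[n --> \oo]).
    by apply/esym/cvg_lim => //; apply: cvgeZr => //; exact: cvg_nnsfun_approx.
  under eq_integral => x _ do rewrite fg.
  apply: monotone_convergence => [//| | |].
  - move=> n; apply/emeasurable_funM; apply/measurable_EFinP => //.
  - by move=> n x _ /=; rewrite mule_ge0 ?lee_fin.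
  - move=> x _ a b ab /=; rewrite lee_wpmul2r ?lee_fin//.
    exact/lefP/nd_nnsfun_approx.
congr (limn _); apply/funext => n /=.
transitivity (\int[nu]_x
   (\sum_(y \in range (h n)) (y * \1_(h n @^-1` [set y]) x)%:E)).
  by apply: eq_integral => t _; rewrite /= fimfunE -fsumEFin.
have indich r : measurable_fun setT (fun x => (r * \1_(h n @^-1` [set r]) x)%:E).
  by apply/measurable_EFinP; exact: measurable_funM.
rewrite ge0_integral_fsum//; last by move=> y x _; exact: nnfun_muleindic_ge0.
transitivity (\int[mu]_x (\sum_(y \in range (h n))
    (y * \1_(h n @^-1` [set y]) x)%:E * (g x)%:E)); last first.
  apply: eq_integral => x _.
  rewrite -ge0_mule_fsuml => [|y]; last exact: nnfun_muleindic_ge0.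
  by rewrite fsumEFin // -(fimfunE _ x).
rewrite ge0_integral_fsum//; last 2 first.
  - by move=> y; apply: emeasurable_funM => //; exact/measurable_EFinP.
  - by move=> m y _; rewrite mule_ge0//; [exact: nnfun_muleindic_ge0|rewrite lee_fin].
apply: eq_fsbigr => r rhn.
under eq_integral do rewrite EFinM.
rewrite integralZl_indic_nnsfun => //.
under [RHS]eq_integral do rewrite EFinM -muleA.
have r0 : (0 <= r)%R by move: rhn; rewrite inE => -[x _ <-].
rewrite ge0_integralZl//.
- rewrite integral_indic// setIT nuE//; congr (_ * _).
  rewrite integral_mkcond; apply: eq_integral => x _.
  by rewrite epatch_indic muleC.
- apply: emeasurable_funM; first exact/measurable_EFinP.
  exact/measurable_EFinP.
- by move=> x _; rewrite mule_ge0 ?lee_fin.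
Qed.
End density.

Section lebesgue_affine.
Variable R : realType.
Local Open Scope ereal_scope.
Local Notation mu := (@lebesgue_measure R).

(** The image of Lebesgue measure under the affine map, multiplied by a, has the right value on
    half-open intervals, and these determine Lebesgue measure. *)
Lemma lebesgue_affine (a b : R) (h : R -> \bar R) : (0 < a)%R ->
  measurable_fun setT h -> (forall x, 0 <= h x) ->
  \int[mu]_x h x = a%:E * \int[mu]_x h (a * x + b)%R.
Proof.
move=> a0 mh h0.
have mphi : measurable_fun (setT : set (measurableTypeR R))
    ((fun x : R => (a * x + b)%R) : _ -> measurableTypeR R).
  by apply: (@measurable_funD _ _ R) => //; exact: measurable_funM.
pose phi : {mfun measurableTypeR R >-> measurableTypeR R} :=
  HB.pack (fun x : R => (a * x + b)%R) (isMeasurableFun.Build _ _ _ _ _ mphi).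
have ann : (0 <= a)%R by exact: ltW.
pose m2 : {measure set (measurableTypeR R) -> \bar R} := mscale (NngNum ann)
  (measure_function_pushforward__canonical__measure_function_Measure mu mphi).
have mu2 A : measurable A -> mu A = m2 A.
  apply: lebesgue_measure_unique => _ [[u v]] _ <-.
  have e : (fun x : R => (a * x + b)%R) @^-1` `]u, v] =
      `]((u - b) / a)%R, ((v - b) / a)%R]%classic.
    apply/seteqP; split => x /=; rewrite !in_itv /=.
      by move=> /andP[ux xv]; rewrite ltr_pdivrMr// ler_pdivlMr//; apply/andP; split; lra.
    by rewrite ltr_pdivrMr// ler_pdivlMr// => /andP[ux xv]; apply/andP; split; lra.
  transitivity (a%:E * mu `]((u - b) / a)%R, ((v - b) / a)%R]); last by rewrite -e.
  rewrite !lebesgue_measure_itv /= !lte_fin ltr_pM2r ?invr_gt0// ltrD2r.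
  case: ifP => _; rewrite ?mule0// -!EFinB -EFinM; congr _%:E; field.
  by rewrite gt_eqF.
transitivity (\int[m2]_x h x); first by apply: eq_measure_integral => A mA _; exact: mu2.
rewrite ge0_integral_mscale//; congr (_ * _).
by rewrite ge0_integral_pushforward// => x _; exact: h0.
Qed.
End lebesgue_affine.

Section normal.
Variable R : realType.
Local Open Scope ereal_scope.
Local Notation mu := (@lebesgue_measure R).
Local Notation gam := (@normal_prob R 0 1).
Local Notation phi := (@normal_pdf R 0 1).

Lemma integral_normal_prob m s (f : R -> \bar R) :
  measurable_fun setT f -> (forall x, 0 <= f x) ->
  \int[normal_prob m s]_x f x = \int[mu]_x (f x * (normal_pdf m s x)%:E).
Proof.
apply: (@ge0_integral_density _ (measurableTypeR R) R mu (normal_prob m s)).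
- exact: measurable_normal_pdf.
- exact: normal_pdf_ge0.
- by [].
Qed.

Lemma normal_pdf_affine m s x : (0 < s)%R ->
  (s * normal_pdf m s (s * x + m) = phi x)%R.
Proof.
move=> s0; rewrite !normal_pdfE ?gt_eqF//= /normal_peak /normal_fun.
rewrite addrK subr0 expr1n mul1r mulrA; congr (_ * expR _)%R.
  rewrite -mulrnAr sqrtrM ?sqr_ge0// sqrtr_sqr gtr0_norm// invfM mulrA divff ?mul1r//.
  by rewrite gt_eqF.
by rewrite exprMn -mulr_natr -[in RHS]mulr_natr; field; rewrite gt_eqF.
Qed.

Lemma integral_normal_affine m s (f : R -> \bar R) : (0 < s)%R ->
  measurable_fun setT f -> (forall x, 0 <= f x) ->
  \int[normal_prob m s]_x f x = \int[gam]_x f (s * x + m)%R.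
Proof.
move=> s0 mf f0.
have maff : measurable_fun setT (fun x : R => (s * x + m)%R).
  by apply: measurable_funD => //; exact: measurable_funM.
have mfa : measurable_fun setT (fun x : R => f (s * x + m)%R) by exact: measurableT_comp.
have mg k : measurable_fun setT (fun x : R => (normal_pdf m k x)%:E).
  by apply/measurable_EFinP; exact: measurable_normal_pdf.
transitivity (\int[mu]_x (f (s * x + m)%R * (phi x)%:E)); last first.
  by apply/esym; apply: integral_normal_prob => // x; exact: f0.
rewrite integral_normal_prob; [|exact: mf|exact: f0].
rewrite (@lebesgue_affine R s m (fun x => f x * (normal_pdf m s x)%:E) s0); last 2 first.
- exact: emeasurable_funM.
- by move=> x; rewrite mule_ge0// lee_fin normal_pdf_ge0.
rewrite -ge0_integralZl; last 4 first.
- by [].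
- apply: emeasurable_funM; first exact: mfa.
  exact: (measurableT_comp (mg s)).
- by move=> x _; rewrite mule_ge0// lee_fin normal_pdf_ge0.
- by rewrite lee_fin ltW.
by apply: eq_integral => x _; rewrite muleCA -EFinM normal_pdf_affine.
Qed.


Let I2 (h : R * R -> \bar R) := \int[mu]_x \int[mu]_y h (x, y).

(** For a fixed first coordinate the shear is a translation of the second one. *)
Let shear_y (t : R) (h : R * R -> \bar R) :
  measurable_fun setT h -> (forall z, 0 <= h z) ->
  I2 h = I2 (fun z => h (z.1, z.2 + t * z.1)%R).
Proof.
move=> mh h0; apply: eq_integral => x _ /=.
rewrite (@lebesgue_affine R 1 (t * x)%R (fun y => h (x, y))) ?ltr01//; last first.
  by apply: measurableT_comp => //; exact: measurable_pair1.
by rewrite mul1e; apply: eq_integral => y _; rewrite mul1r.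
Qed.

Let shear_x (t : R) (h : R * R -> \bar R) :
  measurable_fun setT h -> (forall z, 0 <= h z) ->
  I2 h = I2 (fun z => h (z.1 + t * z.2, z.2)%R).
Proof.
move=> mh h0; pose h' z := h (z.2, z.1).
have msw : measurable_fun setT (fun z : R * R => (z.2, z.1)).
  by apply: measurable_fun_pair; [exact: measurable_snd|exact: measurable_fst].
have mh' : measurable_fun setT h' by exact: measurableT_comp.
transitivity (I2 h'); first by rewrite /I2 (fubini_tonelli (m1 := mu) (m2 := mu) h).
rewrite (shear_y t mh') => [|z]; last exact: h0.
rewrite /I2 /h' /=.
pose h2 z := h (z.1 + t * z.2, z.2)%R.
rewrite -/(I2 h2) /I2 (fubini_tonelli (m1 := mu) (m2 := mu) h2)//.
  apply: measurableT_comp => //; apply: measurable_fun_pair; last exact: measurable_snd.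
  by apply: measurable_funD => //; exact: measurable_funM.
by move=> z; exact: h0.
Qed.

Let gamE2 (F : R * R -> \bar R) : measurable_fun setT F -> (forall z, 0 <= F z) ->
  \int[gam]_x \int[gam]_y F (x, y) = I2 (fun z => F z * (phi z.1 * phi z.2)%:E).
Proof.
move=> mF F0.
have mphi : measurable_fun setT phi by exact: measurable_normal_pdf.
rewrite integral_normal_prob; last 2 first.
- exact: (measurable_fun_fubini_tonelli_F (m2 := gam) F).
- by move=> x; exact: integral_ge0.
apply: eq_integral => x _.
have mFx : measurable_fun setT (fun y => F (x, y)).
  by apply: measurableT_comp => //; exact: measurable_pair1.
rewrite integral_normal_prob; [|exact: mFx|by []].
rewrite muleC -ge0_integralZl.
- by apply: eq_integral => y _ /=; rewrite EFinM muleCA.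
- by [].
- by apply: emeasurable_funM => //; exact/measurable_EFinP.
- by move=> y _; rewrite mule_ge0// lee_fin normal_pdf_ge0.
- by rewrite lee_fin normal_pdf_ge0.
Qed.

(* A rotation is a product of three shears, each of which preserves the
   Lebesgue measure; the density only depends on the radius. *)
Lemma gaussian_rotation (c s : R) (F : R * R -> \bar R) :
  (0 <= c)%R -> (c ^+ 2 + s ^+ 2 = 1)%R ->
  measurable_fun setT F -> (forall z, 0 <= F z) ->
  \int[gam]_x \int[gam]_y F (c * x + s * y, c * y - s * x)%R =
  \int[gam]_x \int[gam]_y F (x, y).
Proof.
move=> c0 cs mF F0.
have mphi : measurable_fun setT phi by exact: measurable_normal_pdf.
pose rot z := (c * z.1 + s * z.2, c * z.2 - s * z.1)%R : R * R.
have mrot : measurable_fun setT rot.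
  apply: measurable_fun_pair.
    by apply: measurable_funD; apply: measurable_funM.
  by apply: measurable_funB; apply: measurable_funM.
have mFr : measurable_fun setT (F \o rot) by exact: measurableT_comp.
rewrite (gamE2 mF)// (gamE2 mFr); last by move=> z; exact: F0.
pose H z := F z * (phi z.1 * phi z.2)%:E.
have mH : measurable_fun setT H.
  apply: emeasurable_funM => //; apply/measurable_EFinP; apply: measurable_funM;
    exact: measurableT_comp.
have H0 z : 0 <= H z by rewrite mule_ge0// lee_fin mulr_ge0// normal_pdf_ge0.
transitivity (I2 (H \o rot)).
  apply: eq_integral => x _; apply: eq_integral => y _ /=; rewrite /H /=.
  congr (_ * _%:E); rewrite !normal_pdfE ?oner_eq0// /normal_fun !subr0.
  rewrite mulrACA -expRD [in RHS]mulrACA -expRD; congr (_ * expR _)%R.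
  rewrite -!mulrDl -!opprD; congr (- _ / _)%R.
  transitivity ((c ^+ 2 + s ^+ 2) * (x ^+ 2 + y ^+ 2))%R; last by ring.
  by rewrite cs mul1r.
(* The tangent of half the angle: the rotation is the composition of the shears with parameters t,
   -s, t. The assumption 0 <= c keeps 1 + c away from 0. *)
pose t := (s / (1 + c))%R.
have tc : (t * (1 + c) = s)%R by rewrite /t divfK// gt_eqF// ltr_wpDr.
have ts : (t * s = 1 - c)%R.
  apply: (@mulIf _ (1 + c)%R); first by rewrite gt_eqF// ltr_wpDr.
  rewrite mulrAC tc; move: cs; lra.
have mS1 : measurable_fun setT (fun z : R * R => (z.1 + t * z.2, z.2)%R).
  apply: measurable_fun_pair; last exact: measurable_snd.
  apply: measurable_funD; first exact: measurable_fst.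
  by apply: measurable_funM => //; exact: measurable_snd.
have mS2 : measurable_fun setT (fun z : R * R => (z.1, z.2 + (- s) * z.1)%R).
  apply: measurable_fun_pair; first exact: measurable_fst.
  apply: measurable_funD; first exact: measurable_snd.
  by apply: measurable_funM => //; exact: measurable_fst.
pose H1 (z : R * R) := H (z.1 + t * z.2, z.2)%R.
pose H2 (z : R * R) := H1 (z.1, z.2 + (- s) * z.1)%R.
pose H3 (z : R * R) := H2 (z.1 + t * z.2, z.2)%R.
have mH1 : measurable_fun setT H1 by exact: (measurableT_comp mH mS1).
have mH2 : measurable_fun setT H2 by exact: (measurableT_comp mH1 mS2).
have H10 z : 0 <= H1 z by exact: H0.
have H20 z : 0 <= H2 z by exact: H0.
have e3 : I2 H = I2 H3 :=
  etrans (shear_x t mH H0) (etrans (shear_y (- s) mH1 H10) (shear_x t mH2 H20)).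
apply: (etrans _ (esym e3)).
apply: eq_integral => x _; apply: eq_integral => y _; rewrite /H3 /H2 /H1 /=.
have cE : (c = 1 - t * s)%R by rewrite ts; ring.
have sE : (s = 2 * t - t * t * s)%R by rewrite -mulrA ts -{1}tc; ring.
congr (H (_, _)) => /=.
  transitivity ((1 - t * s) * x + (2 * t - t * t * s) * y)%R; last by ring.
  by rewrite -cE -sE.
by transitivity ((1 - t * s) * y - s * x)%R; [rewrite -cE|ring].
Qed.
End normal.

Section prod_prob.
Context d (T : measurableType d) (R : realType) (P : probability T R).
Local Open Scope ereal_scope.

Definition prod_prob : set (T * T) -> \bar R := P \x P.

HB.instance Definition _ := Measure.on prod_prob.

Let prod_prob_setT : prod_prob setT = 1.
Proof.
rewrite /prod_prob -setXTT [LHS]product_measure1E//.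
transitivity (1 * 1 : \bar R); last by rewrite mule1.
by congr (_ * _); exact: probability_setT.
Qed.

HB.instance Definition _ :=
  Measure_isProbability.Build _ _ _ prod_prob prod_prob_setT.

(** Tonelli: for a fixed first outcome the event is a box in the second copy, with sides the
    sections of the rotated rectangles D i. Its probability is a product over i, [iid_gaussian_prod]
    lets the outer integral factor as well, and each factor is a planar rotation. *)
Lemma iid_gaussian_rotate (I : finType) (X : I -> T -> R) (c s : R) :
  (0 <= c)%R -> (c ^+ 2 + s ^+ 2 = 1)%R -> iid_gaussian P X ->
  iid_gaussian prod_prob (fun (k : I + I) (w : T * T) =>
    match k with
    | inl i => c * X i w.1 + s * X i w.2
    | inr i => c * X i w.2 - s * X i w.1
    end)%R.
Proof.
move=> c0 cs gX; have [mX XB] := gX.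
have mX1 i : measurable_fun setT (fun w : T * T => X i w.1).
  by apply: measurableT_comp => //; exact: measurable_fst.
have mX2 i : measurable_fun setT (fun w : T * T => X i w.2).
  by apply: measurableT_comp => //; exact: measurable_snd.
split=> [[i|i]|B mB].
- by apply: measurable_funD; apply: measurable_funM.
- by apply: measurable_funB; apply: measurable_funM.
pose rot z := (c * z.1 + s * z.2, c * z.2 - s * z.1)%R : R * R.
have mrot : measurable_fun setT rot.
  apply: measurable_fun_pair.
    by apply: measurable_funD; apply: measurable_funM.
  by apply: measurable_funB; apply: measurable_funM.
pose D i := rot @^-1` (B (inl i) `*` B (inr i)).
have mD i : measurable (D i).
  by rewrite -[D i]setTI; apply: mrot => //; exact: measurableX.
pose gam : probability _ R := @normal_prob R 0 1.
transitivity (\int[P]_w1 P [set w2 | forall i, xsection (D i) (X i w1) (X i w2)]).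
  apply: eq_integral => w1 _ /=; congr (P _); apply/seteqP; split => w2.
    rewrite /xsection /= inE /= => h i; rewrite inE /D /rot /=; split.
      exact: (h (inl i)).
    exact: (h (inr i)).
  by rewrite /xsection /= inE /= => h [i|i]; have := h i; rewrite inE => -[].
transitivity (\int[P]_w1 \prod_i gam (xsection (D i) (X i w1))).
  apply: eq_integral => w1 _; apply: XB => i; exact: measurable_xsection.
rewrite (iid_gaussian_prod (f := fun i x => gam (xsection (D i) x)) gX)//; last first.
  by move=> i; exact: (measurable_fun_xsection gam (mD i)).
rewrite big_sumType /= -big_split /=; apply: eq_bigr => i _ /=.
transitivity (\int[gam]_x \int[gam]_y (\1_(D i) (x, y))%:E).
  apply: eq_integral => x _.
  have mDx : measurable (xsection (D i) x) by exact: measurable_xsection.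
  transitivity (\int[gam]_y (\1_(xsection (D i) x) y)%:E).
    by rewrite integral_indic// setIT.
  by apply: eq_integral => y _; rewrite !indicE /xsection mem_setE.
pose F (z : R * R) := (\1_(B (inl i) `*` B (inr i)) z)%:E : \bar R.
transitivity (\int[gam]_x \int[gam]_y F (rot (x, y))).
  apply: eq_integral => x _; apply: eq_integral => y _.
  by rewrite /F !indicE.
rewrite (gaussian_rotation (F := F))//; last 2 first.
- by apply/measurable_EFinP/measurable_indic; exact: measurableX.
- by move=> z; rewrite /F lee_fin.
transitivity (\int[gam]_x \int[gam]_y ((\1_(B (inl i)) x)%:E * (\1_(B (inr i)) y)%:E)).
  apply: eq_integral => x _; apply: eq_integral => y _.
  by rewrite /F -EFinM !indicE in_setX -natrM mulnb.
have gB k : \int[gam]_x (\1_(B k) x)%:E = gam (B k).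
  by rewrite integral_indic; [rewrite setIT|exact: measurableT|exact: mB].
have mB1 k : measurable_fun setT (fun x : R => (\1_(B k) x)%:E : \bar R).
  by apply/measurable_EFinP/measurable_indic; exact: mB.
transitivity (\int[gam]_x ((\1_(B (inl i)) x)%:E * gam (B (inr i)))).
  apply: eq_integral => x _; rewrite ge0_integralZl.
  - by rewrite gB.
  - exact: measurableT.
  - exact: mB1.
  - by move=> y _; rewrite lee_fin.
  - by rewrite lee_fin.
rewrite ge0_integralZr.
- by rewrite gB.
- exact: measurableT.
- exact: mB1.
- by move=> y _; rewrite lee_fin.
- exact: measure_ge0.
Qed.
End prod_prob.

(** * Gaussian moments *)

Section mean_le.
Context d (T : measurableType d) (R : realType) (P : probability T R).
Implicit Types (f g : T -> R) (a b c : R).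

(** Measurability and sign travel with the bound, so that bounds add and scale with no integrability
    conditions. *)
Definition mean_le f a := [/\ measurable_fun setT f, forall w, 0 <= f w
  & (\int[P]_w (f w)%:E <= a%:E)%E].

(** Only the majorant g has to be measurable; f will be the loss of an arbitrary choice of
    minimizers. *)
Lemma mean_le_expectation f g a :
  (forall w, 0 <= f w <= g w) -> mean_le g a -> ('E_P[f] <= a%:E)%E.
Proof.
move=> fg [mg g0 ga]; rewrite unlock; apply: le_trans ga.
apply: ge0_le_integral_nonmeasurable => w; rewrite lee_fin; by case/andP: (fg w).
Qed.

Lemma mean_le_mono f g a : measurable_fun setT f -> (forall w, 0 <= f w <= g w) ->
  mean_le g a -> mean_le f a.
Proof.
move=> mf fg [mg g0 ga]; split => // [w|]; first by case/andP: (fg w).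
apply: le_trans ga.
by apply: ge0_le_integral_nonmeasurable => w; rewrite lee_fin; case/andP: (fg w).
Qed.

Lemma mean_le_trans f a b : a <= b -> mean_le f a -> mean_le f b.
Proof. by move=> ab [? ? fa]; split => //; apply: le_trans fa _; rewrite lee_fin. Qed.

Lemma mean_leD f g a b : mean_le f a -> mean_le g b ->
  mean_le (fun w => f w + g w) (a + b).
Proof.
move=> [mf f0 fa] [mg g0 gb]; split => [|w|].
- exact: measurable_funD.
- by rewrite addr_ge0.
under eq_integral do rewrite EFinD.
rewrite ge0_integralD//; last 4 first.
- by move=> w _; rewrite lee_fin.
- exact/measurable_EFinP.
- by move=> w _; rewrite lee_fin.
- exact/measurable_EFinP.
by rewrite EFinD leeD.
Qed.

Lemma mean_leZ f a c : 0 <= c -> mean_le f a -> mean_le (fun w => c * f w) (c * a).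
Proof.
move=> c0 [mf f0 fa]; split => [|w|].
- exact: measurable_funM.
- by rewrite mulr_ge0.
under eq_integral do rewrite EFinM.
rewrite ge0_integralZl//; last 2 first.
- exact/measurable_EFinP.
- by move=> w _; rewrite lee_fin.
by rewrite EFinM lee_wpmul2l// lee_fin.
Qed.

Lemma mean_le_cst c : 0 <= c -> mean_le (fun=> c) c.
Proof.
move=> c0; split => //; rewrite integral_cst//.
rewrite -[leRHS]mule1; apply: lee_wpmul2l; first by rewrite lee_fin.
exact: probability_le1.
Qed.

Lemma mean_le_sum (I : Type) (s : seq I) (S : pred I) (f : I -> T -> R) (a : I -> R) :
  (forall i, S i -> mean_le (f i) (a i)) ->
  mean_le (fun w => \sum_(i <- s | S i) f i w) (\sum_(i <- s | S i) a i).
Proof.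
move=> fa; elim: s => [|i s IH].
  rewrite big_nil (_ : (fun w => _) = fun=> 0); first exact: mean_le_cst.
  by apply/funext => w; rewrite big_nil.
rewrite big_cons; under eq_fun do rewrite big_cons.
by case: ifPn => // Si; apply: mean_leD => //; exact: fa.
Qed.
End mean_le.

Section gaussian_integrals.
Variable R : realType.
Local Notation gam := (@normal_prob R 0 1).

Lemma integral_gaussian_expR (a : R) :
  (\int[gam]_x (expR (a * x))%:E = (expR (a ^+ 2 / 2))%:E)%E.
Proof.
have mf : measurable_fun setT (fun x : R => (expR (a * x))%:E).
  by apply/measurable_EFinP/measurableT_comp => //; exact: measurable_funM.
rewrite integral_normal_prob//.
transitivity (\int[@lebesgue_measure R]_x ((expR (a ^+ 2 / 2))%:E * (normal_pdf a 1 x)%:E))%E.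
  apply: eq_integral => x _; rewrite -!EFinM; congr _%:E.
  rewrite !normal_pdfE ?oner_eq0//= mulrCA [RHS]mulrCA; congr (_ * _).
  by rewrite /normal_fun -!expRD; congr expR; field.
rewrite ge0_integralZl//.
- by rewrite integral_normal_pdf mule1.
- by apply/measurable_EFinP; exact: measurable_normal_pdf.
- by move=> x _; rewrite lee_fin normal_pdf_ge0.
Qed.

(** The tilted density is, up to the factor s, the centred normal density of variance 1 / (1 -
    2t). *)
Let expR_sqr_normal_pdf (t x : R) (s := (Num.sqrt (1 - 2 * t))^-1) : t < 1 / 2 ->
  expR (t * x ^+ 2) * normal_pdf 0 1 x = s * normal_pdf 0 s x.
Proof.
move=> t2; have p0 : 0 < 1 - 2 * t by lra.
have s0 : 0 < s by rewrite invr_gt0 sqrtr_gt0.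
have s2 : s ^+ 2 = (1 - 2 * t)^-1 by rewrite exprVn sqr_sqrtr// ltW.
rewrite !normal_pdfE ?oner_eq0 ?gt_eqF//= /normal_peak /normal_fun.
rewrite subr0 [LHS]mulrCA -expRD [RHS]mulrA; congr (_ * expR _).
  rewrite -!mulrnAr expr1n mul1r [in RHS]sqrtrM ?sqr_ge0// sqrtr_sqr gtr0_norm//.
  by rewrite invfM mulrA divff ?mul1r// gt_eqF.
have -> : (s ^+ 2 *+ 2)^-1 = (1 - 2 * t) / 2 by rewrite s2 -mulr_natr invfM invrK.
have -> : ((1 : R) ^+ 2 *+ 2)^-1 = 1 / 2 by rewrite expr1n mul1r.
lra.
Qed.

Lemma integral_gaussian_expR_sqr (t : R) : t < 1 / 2 ->
  (\int[gam]_x (expR (t * x ^+ 2))%:E = ((Num.sqrt (1 - 2 * t))^-1)%:E)%E.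
Proof.
move=> t2; have p0 : 0 < 1 - 2 * t by lra.
pose s := (Num.sqrt (1 - 2 * t))^-1.
have s0 : 0 < s by rewrite invr_gt0 sqrtr_gt0.
have mf : measurable_fun setT (fun x : R => (expR (t * x ^+ 2))%:E).
  by apply/measurable_EFinP/measurableT_comp => //; exact: measurable_funM.
rewrite integral_normal_prob//.
transitivity (\int[@lebesgue_measure R]_x (s%:E * (normal_pdf 0 s x)%:E))%E.
  by apply: eq_integral => x _; rewrite -!EFinM expR_sqr_normal_pdf.
rewrite ge0_integralZl//.
- by rewrite integral_normal_pdf mule1.
- by apply/measurable_EFinP; exact: measurable_normal_pdf.
- by move=> x _; rewrite lee_fin normal_pdf_ge0.
- by rewrite lee_fin ltW.
Qed.
End gaussian_integrals.

Lemma expR_pow_le (R : realType) (n : nat) (x : R) : 0 <= x ->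
  x ^+ n <= n`!%:R * expR x.
Proof.
case: n => [|n] x0; first by rewrite expr0 mul1r -expR0 ler_expR.
have := expR_ge1Dxn n x0; have f0 : 0 < (n.+1)`!%:R :> R by rewrite ltr0n fact_gt0.
rewrite -ler_pdivrMl// mulrC; lra.
Qed.

Lemma sqr_le_expR (R : realType) (x : R) : x ^+ 2 <= 2 * (expR x + expR (- x)).
Proof.
have [x0|x0] := lerP 0 x.
  by have := expR_pow_le 2 x0; rewrite -[2`!]/2%N; have := expR_ge0 (- x); lra.
have nx0 : 0 <= - x by lra.
by have := expR_pow_le 2 nx0; rewrite -[2`!]/2%N; have := expR_ge0 x; rewrite sqrrN; lra.
Qed.

Section gaussian_vector.
Context d (T : measurableType d) (R : realType) (P : probability T R).
Variables (I : finType) (X : I -> T -> R).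
Hypothesis gX : iid_gaussian P X.
Local Notation N := (#|I|%:R : R).

Let mX i : measurable_fun setT (X i). Proof. by case: gX. Qed.

Definition sqn (w : T) := \sum_i X i w ^+ 2.

Lemma measurable_sqn : measurable_fun setT sqn.
Proof. by apply: measurable_sum => i; exact: measurable_funX. Qed.

Lemma sqn_ge0 w : 0 <= sqn w.
Proof. by apply: sumr_ge0 => i _; exact: sqr_ge0. Qed.

Lemma mean_expR_linear (a : I -> R) :
  mean_le P (fun w => expR (\sum_i a i * X i w)) (expR ((\sum_i a i ^+ 2) / 2)).
Proof.
have mL : measurable_fun setT (fun w => \sum_i a i * X i w).
  by apply: measurable_sum => i; exact: measurable_funM.
split => [|w|]; [exact: measurableT_comp|exact: expR_ge0|].
have := @iid_gaussian_prod _ _ _ P I X (fun i x => (expR (a i * x))%:E) gX.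
under eq_integral => w _.
  rewrite prodEFin -expR_sum; over.
move=> ->.
- under eq_bigr do rewrite integral_gaussian_expR.
  by rewrite prodEFin -expR_sum mulr_suml.
- by move=> i; apply/measurable_EFinP/measurableT_comp => //; exact: measurable_funM.
- by move=> i x; rewrite lee_fin expR_ge0.
Qed.

Lemma mean_expR_sqn (t : R) : t < 1 / 2 ->
  mean_le P (fun w => expR (t * sqn w)) ((Num.sqrt (1 - 2 * t))^-1 ^+ #|I|).
Proof.
move=> t2.
have mL : measurable_fun setT (fun w => t * sqn w).
  by apply: measurable_funM => //; exact: measurable_sqn.
split => [|w|]; [exact: measurableT_comp|exact: expR_ge0|].
have := @iid_gaussian_prod _ _ _ P I X (fun i x => (expR (t * x ^+ 2))%:E) gX.
under eq_integral => w _.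
  rewrite prodEFin -expR_sum -mulr_sumr; over.
move=> ->.
- under eq_bigr do rewrite integral_gaussian_expR_sqr//.
  by rewrite prodEFin prodr_const.
- by move=> i; apply/measurable_EFinP/measurableT_comp => //;
    apply: measurable_funM => //; exact: measurable_funX.
- by move=> i x; rewrite lee_fin expR_ge0.
Qed.

(** For the form normalized to unit variance, x^2 <= 2 (e^x + e^(-x)) and both exponentials have
    mean e^(1/2). The constant is not sharp, but only the proportionality to K matters. *)
Lemma mean_linear_sqr (a : I -> R) (K : R) : \sum_i a i ^+ 2 <= K ->
  mean_le P (fun w => (\sum_i a i * X i w) ^+ 2) (4 * expR (1 / 2) * K).
Proof.
move=> aK; pose A := \sum_i a i ^+ 2.
have A0 : 0 <= A by apply: sumr_ge0 => i _; exact: sqr_ge0.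
have mL : measurable_fun setT (fun w => \sum_i a i * X i w).
  by apply: measurable_sum => i; exact: measurable_funM.
apply: (@mean_le_trans _ _ _ _ _ (4 * expR (1 / 2) * A)).
  by rewrite ler_wpM2l// mulr_ge0 ?expR_ge0.
have [A00|An0] := eqVneq A 0.
  rewrite A00 mulr0; apply: mean_le_mono (mean_le_cst P (lexx 0)); first exact: measurable_funX.
  move=> w; rewrite big1 ?expr0n/= ?lexx// => i _.
  move/eqP : A00; rewrite psumr_eq0 => [/allP/(_ i (mem_index_enum _))|j _]; last exact: sqr_ge0.
  by rewrite /= sqrf_eq0 => /eqP ->; rewrite mul0r.
pose q := Num.sqrt A.
have q2 : q ^+ 2 = A by rewrite sqr_sqrtr.
have q0 : q != 0 by rewrite -sqrf_eq0 q2.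
have E (s : R) : s ^+ 2 = 1 ->
    mean_le P (fun w => expR (s * (q^-1 * \sum_i a i * X i w))) (expR (1 / 2)).
  move=> s1; have := mean_expR_linear (fun i => s * q^-1 * a i).
  have -> : \sum_i (s * q^-1 * a i) ^+ 2 = 1.
    under eq_bigr do rewrite !exprMn s1 mul1r.
    by rewrite -mulr_sumr -/A -q2 -exprMn mulVf// expr1n.
  have -> // : (fun w => expR (\sum_i s * q^-1 * a i * X i w)) =
    fun w => expR (s * (q^-1 * \sum_i a i * X i w)).
  apply/funext => w; rewrite !mulr_sumr; congr expR; apply: eq_bigr => i _.
  by rewrite !mulrA.
have H := mean_leZ (c := 2 * A) ltac:(lra) (mean_leD (E 1 _) (E (-1) _)).
apply: mean_le_mono (mean_le_trans _ (H _ _)); rewrite ?sqrrN ?expr1n//.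
- exact: measurable_funX.
- move=> w; rewrite sqr_ge0 /= mul1r mulN1r.
  have := sqr_le_expR (q^-1 * \sum_i a i * X i w).
  rewrite exprMn exprVn q2 ler_pdivrMl ?lt_def ?An0// => /le_trans; apply.
  by rewrite mulrA [A * 2]mulrC.
- by rewrite mulrAC; lra.
Qed.

Lemma mean_expR_sqn_centered (t : R) : t <= 1 / 4 ->
  mean_le P (fun w => expR (t * (sqn w - N))) (expR (4 * t ^+ 2 * N)).
Proof.
move=> t4; have t2 : t < 1 / 2 by lra.
have p0 : 0 < 1 - 2 * t by lra.
apply: (mean_le_mono _ _ (mean_le_trans _ (mean_leZ (c := expR (- (t * N))) _ (mean_expR_sqn t2)))).
- apply: measurableT_comp => //; apply: measurable_funM => //.
  by apply: measurable_funB => //; exact: measurable_sqn.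
- by move=> w; rewrite expR_ge0 -expRD ler_expR mulrBr addrC lexx.
- have -> : expR (- (t * N)) = expR (- t) ^+ #|I| by rewrite -expRM_natr mulNr.
  rewrite -exprMn expRM_natr.
  apply: lerXn2r; rewrite ?nnegrE ?mulr_ge0 ?expR_ge0 ?invr_ge0 ?sqrtr_ge0//.
  rewrite ler_pdivrMr ?sqrtr_gt0// -(@ler_pXn2r _ 2)// ?nnegrE ?mulr_ge0 ?expR_ge0 ?sqrtr_ge0//.
  rewrite exprMn (sqr_sqrtr (ltW p0)) -!expRM_natl.
  (* By 1 + x <= e^x the right side is at least (1 + 2t + 8t^2)(1 - 2t) = 1 + 4t^2 (1 - 4t), which
     is where t <= 1/4 enters. Negative t is allowed, so both tails are covered. *)
  have h : 1 <= expR (2 * t + 8 * t ^+ 2) * (1 - 2 * t).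
    apply: (@le_trans _ _ ((1 + (2 * t + 8 * t ^+ 2)) * (1 - 2 * t))).
      by have := mulr_ge0 (sqr_ge0 t) (_ : 0 <= 1 - 4 * t); lra.
    by rewrite ler_wpM2r ?expR_ge1Dx// ltW.
  have -> : expR (2 * (4 * t ^+ 2)) = expR (2 * - t) * expR (2 * t + 8 * t ^+ 2).
    by rewrite -expRD; congr expR; ring.
  by rewrite -mulrA ler_peMr ?expR_ge0.
- exact: expR_ge0.
Qed.

Lemma mean_sqn_centered_sqr : (0 < #|I|)%N ->
  mean_le P (fun w => (sqn w - N) ^+ 2) (64 * expR (1 / 4) * N).
Proof.
move=> I0; pose q := Num.sqrt N.
have N1 : 1 <= N by rewrite ler1n.
have q2 : q ^+ 2 = N by rewrite sqr_sqrtr.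
have q1 : 1 <= q by rewrite -sqrtr1 ler_sqrt.
have q0 : q != 0 by rewrite gt_eqF// (lt_le_trans ltr01).
(* With t = 1 / (4 sqrt N) the exponent 4 t^2 N is the constant 1/4, for both signs of t. *)
pose t := (4 * q)^-1.
have t0 : 0 < t by rewrite invr_gt0 mulr_gt0// (lt_le_trans ltr01).
have t4 : t <= 1 / 4.
  by rewrite /t mul1r lef_pV2 ?posrE ?mulr_gt0//; lra.
have tN : 4 * t ^+ 2 * N = 1 / 4.
  by rewrite /t -q2; field.
have tN' : 4 * (- t) ^+ 2 * N = 1 / 4 by rewrite sqrrN.
have t16 : t ^+ 2 * (16 * N) = 1 by lra.
have H := mean_leD (mean_expR_sqn_centered t4) (mean_expR_sqn_centered (t := - t) ltac:(lra)).
rewrite tN tN' in H.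
have H2 := mean_leZ (c := 32 * N) ltac:(lra) H.
apply: mean_le_mono (mean_le_trans _ H2).
- by apply: measurable_funX; apply: measurable_funB => //; exact: measurable_sqn.
- move=> w; rewrite sqr_ge0 /=; have := sqr_le_expR (t * (sqn w - N)).
  rewrite mulNr exprMn => h.
  have N16 : 0 <= 16 * N by lra.
  have := ler_wpM2r N16 h; rewrite mulrAC t16 mul1r => /le_trans; apply.
  by lra.
- lra.
Qed.

Lemma mean_sqn_pow (p : nat) : (0 < #|I|)%N ->
  mean_le P (fun w => (sqn w / N) ^+ p) (4 ^+ p * p`!%:R * expR (1 / 2)).
Proof.
move=> I0; have N1 : 1 <= N by rewrite ler1n.
have N0 : N != 0 by rewrite gt_eqF// (lt_le_trans ltr01).
pose t := (4 * N)^-1.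
have t0 : 0 < t by rewrite invr_gt0; lra.
have t4 : t <= 1 / 4 by rewrite /t mul1r lef_pV2 ?posrE; lra.
have tE : t = N^-1 / 4 by rewrite /t invfM mulrC.
have tN : t * N = 1 / 4 by rewrite tE mulrAC mulVf.
have c0 : 0 <= 4 ^+ p * p`!%:R * expR (1 / 4) :> R by rewrite !mulr_ge0 ?expR_ge0 ?exprn_ge0.
apply: mean_le_mono (mean_le_trans _ (mean_leZ c0 (mean_expR_sqn_centered t4))).
- by apply: measurable_funX; apply: measurable_funM => //; exact: measurable_sqn.
- move=> w; rewrite exprn_ge0 ?divr_ge0 ?sqn_ge0//=.
  rewrite -mulrA -expRD.
  have -> : 1 / 4 + t * (sqn w - N) = t * sqn w.
    by rewrite mulrBr tN; lra.
  have -> : sqn w / N = 4 * (t * sqn w) by rewrite tE; lra.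
  rewrite exprMn -mulrA ler_wpM2l ?exprn_ge0//.
  by apply: expR_pow_le; rewrite mulr_ge0 ?sqn_ge0// ltW.
- rewrite -mulrA ler_wpM2l ?mulr_ge0 ?exprn_ge0// -expRD ler_expR.
  have -> : 4 * t ^+ 2 * N = t by rewrite -mulrA expr2 -[t * t * N]mulrA tN; lra.
  lra.
Qed.

(** The exponential Markov inequality at t = -1 / (2e) gives e^(1/2) (1 + 1/e)^(-1/2) per
    coordinate, and 1 + 1/e >= 1/e. *)
Lemma prob_sqn_small (e : R) : 0 < e ->
  mean_le P (fun w => (sqn w <= e * N)%R%:R) (Num.sqrt (expR 1 * e) ^+ #|I|).
Proof.
move=> e0; pose t := - (2 * e)^-1.
have ei0 : 0 < e^-1 by rewrite invr_gt0.
have te : t * e = - (1 / 2) by rewrite /t; field; rewrite gt_eqF.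
have t0 : t < 0 by rewrite oppr_lt0 invr_gt0; lra.
have t2 : t < 1 / 2 by lra.
apply: (mean_le_mono _ _ (mean_le_trans _
  (mean_leZ (c := expR (- (t * e * N))) _ (mean_expR_sqn t2)))).
- apply: (@measurableT_comp _ _ _ _ _ _ (fun b : bool => b%:R : R)) => //.
  by apply: measurable_fun_ler => //; exact: measurable_sqn.
- move=> w; rewrite ler0n /= -expRD; case: (leP (sqn w) (e * N)) => h; last exact: expR_ge0.
  apply: (@le_trans _ _ (expR 0)); first by rewrite expR0.
  rewrite ler_expR; have nt0 : 0 <= - t by lra.
  have es : 0 <= e * N - sqn w by lra.
  by have := mulr_ge0 nt0 es; lra.
- rewrite -mulNr expRM_natr -exprMn lerXn2r ?nnegrE ?mulr_ge0 ?expR_ge0 ?invr_ge0 ?sqrtr_ge0//.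
  rewrite te opprK ler_pdivrMr ?sqrtr_gt0; last lra.
  rewrite -sqrtrM; last by rewrite mulr_ge0 ?expR_ge0// ltW.
  rewrite -[leLHS]ger0_norm ?expR_ge0// -sqrtr_sqr -expRM_natl ler_sqrt; last first.
    by rewrite !mulr_ge0 ?expR_ge0; lra.
  have -> : 2 * (1 / 2) = 1 :> R by lra.
  by rewrite -mulrA ler_peMr ?expR_ge0//; lra.
- exact: expR_ge0.
Qed.
End gaussian_vector.

Section geometric_majorant.
Context d (T : measurableType d) (R : realType) (P : probability T R).

(** Being below some f j at each outcome, g is below the sum of all of them, whatever the choice of
    j. *)
Lemma mean_le_geometric (f : nat -> T -> R) (g : T -> R) (c r : R) :
  0 <= c -> 0 < r < 1 -> (forall j, mean_le P (f j) (c * r ^+ j)) ->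
  measurable_fun setT g -> (forall w, 0 <= g w) ->
  (forall w, exists j, g w <= f j w) -> mean_le P g (c / (1 - r)).
Proof.
move=> c0 /andP[r0 r1] fj mg g0 gf; split => //.
apply: (@le_trans _ _ (\int[P]_w \big[+%E/0%E]_(0 <= j <oo) (f j w)%:E)%E).
  apply: ge0_le_integral_nonmeasurable => w; first by rewrite lee_fin.
  have [j gj] := gf w; apply: (@le_trans _ _ (f j w)%:E); first by rewrite lee_fin.
  apply: le_trans (nneseries_lim_ge j.+1 _); last first.
    by move=> k _ _; rewrite lee_fin; case: (fj k).
  rewrite big_nat_recr//= leeDr// sume_ge0// => k _.
  by rewrite lee_fin; case: (fj k).
rewrite integral_nneseries//; last 2 first.
- by move=> j; apply/measurable_EFinP; case: (fj j).
- by move=> j w _; rewrite lee_fin; case: (fj j).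
apply: (@le_trans _ _ (\big[+%E/0%E]_(0 <= j <oo) (c * r ^+ j)%:E)).
  apply: lee_nneseries => j _; last by case: (fj j).
  by move=> _; apply: integral_ge0 => w _; rewrite lee_fin; case: (fj j).
apply: lime_le.
  by apply: is_cvg_nneseries => j _ _; rewrite lee_fin mulr_ge0// exprn_ge0// ltW.
apply: nearW => n; rewrite sumEFin lee_fin.
have := geometric_le_lim n c0 r0; rewrite gtr0_norm// => /(_ r1).
by rewrite /series/=.
Qed.

End geometric_majorant.

(** * Inverse moments of the Gaussian norm *)

Section inverse_moment.
Context d (T : measurableType d) (R : realType) (P : probability T R).
Variables (I : finType) (X : I -> T -> R).
Hypothesis gX : iid_gaussian P X.
Hypothesis I3 : (3 <= #|I|)%N.
Local Notation N := (#|I|%:R : R).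

Lemma expR1_le4 : expR 1 <= 4 :> R.
Proof.
have h : expR (1 / 2) * (1 / 2) <= 1 :> R.
  have h : 1 / 2 <= expR (- (1 / 2)) :> R by have := expR_ge1Dx (- (1 / 2) : R); lra.
  by have := ler_wpM2l (expR_ge0 (1 / 2 : R)) h; rewrite -expRD subrr expR0.
have -> : 1 = 1 / 2 + 1 / 2 :> R by lra.
have := expR_ge0 (1 / 2 : R); rewrite expRD; nra.
Qed.

Lemma pow16_bracket (v : R) : 1 <= v ->
  exists j : nat, 16 ^+ j <= v < 16 ^+ j.+1.
Proof.
move=> v1.
have ex : exists j, v < 16 ^+ j.
  exists (Num.truncn v).+1; have v0 : 0 <= v by lra.
  have /andP[_ /lt_le_trans] := truncn_itv v0; apply.
  by rewrite -natrX ler_nat ltnW// ltn_expl.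
case: (ex_minnP ex) => -[|j]; first by rewrite expr0 => ? _; exfalso; lra.
move=> vj mj; exists j; rewrite vj andbT leNgt; apply/negP => /mj.
by rewrite ltnn.
Qed.

(* Dyadic layers: on [16^j <= N / sqn < 16^(j+1)] the integrand is below
   32^(j+1), and this event has probability O(64^-j). *)
Lemma mean_inverse_sqn :
  mean_le P (fun w => Num.sqrt (Num.sqrt (N / sqn X w)) ^+ 5) (64 * expR 1 ^+ 2).
Proof.
have e0 : 0 < expR 1 :> R by exact: expR_gt0.
have e1 : 1 <= expR 1 :> R by have := expR_ge1Dx (1 : R); lra.
have e4 := expR1_le4.
have N0 : 0 < N by rewrite ltr0n; case: #|I| I3.
(* Layer 0 carries no condition: it takes all outcomes where the quotient is below 1, including
   [sqn X w = 0], where the quotient is 0. *)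
pose f j w : R := 32 ^+ j.+1 * ((j == 0%N) || (sqn X w <= 16 ^- j * N))%:R.
have -> : 64 * expR 1 ^+ 2 = 32 * expR 1 ^+ 2 / (1 - 1 / 2) :> R by field.
have c0 : 0 <= 32 * expR 1 ^+ 2 :> R by rewrite mulr_ge0 ?exprn_ge0 ?expR_ge0.
apply: (@mean_le_geometric _ _ _ _ f) => //.
- by lra.
- case=> [|j].
    have -> : f 0%N = fun=> 32 by apply/funext => w; rewrite /f mulr1 expr1.
    rewrite expr0 mulr1.
    apply: mean_le_trans (mean_le_cst P _) => //.
    by rewrite ler_peMr// exprn_ege1.
  have p0 : 0 < 16 ^- j.+1 :> R by rewrite invr_gt0 exprn_gt0.
  have p1 : expR 1 * 16 ^- j.+1 <= 1 :> R.
    rewrite ler_pdivrMr ?exprn_gt0// mul1r (le_trans e4)// exprS.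
    have : 1 <= 16 ^+ j :> R by rewrite exprn_ege1// ler1n.
    lra.
  have h := mean_leZ (c := 32 ^+ j.+2) (exprn_ge0 _ (ler0n _ _)) (prob_sqn_small gX p0).
  apply: mean_le_trans h.
  (* The base is at most 1, so the exponent can be lowered to 3. Each further layer then costs 32
     and gains 4^3 = 64, a ratio of 1/2; exponent 2 would give 32/16 and diverge. *)
  apply: (@le_trans _ _ (32 ^+ j.+2 * Num.sqrt (expR 1 * 16 ^- j.+1) ^+ 3)).
    rewrite ler_wpM2l// ler_wiXn2l ?sqrtr_ge0//.
    by rewrite -[leRHS]sqrtr1 ler_sqrt.
  rewrite exprS -!mulrA ler_wpM2l//.
  have -> : 32 ^+ j.+1 * Num.sqrt (expR 1 * 16 ^- j.+1) ^+ 3 =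
      Num.sqrt (expR 1) ^+ 3 * (1 / 2 : R) ^+ j.+1.
    rewrite sqrtrM// (_ : 16 ^- j.+1 = (4 ^- j.+1) ^+ 2 :> R); last first.
      rewrite -exprVn -exprVn -exprM mulnC exprM; congr (_ ^+ _).
      by rewrite expr2 -invfM; congr _^-1; lra.
    rewrite sqrtr_sqr ger0_norm; last by rewrite invr_ge0 exprn_ge0.
    rewrite exprMn mulrCA; congr (_ * _).
    rewrite -exprVn -exprM mulnC exprM -exprMn; congr (_ ^+ _); by field.
  rewrite mulrA ler_wpM2r ?exprn_ge0//.
  rewrite exprS sqr_sqrtr ?expR_ge0// ler_wpM2r ?expR_ge0//.
  rewrite -[leRHS]ger0_norm// -sqrtr_sqr ler_sqrt ?exprn_ge0//.
  by rewrite expr2 ler_peMl.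
- have msqrt := @nondecreasing_measurable R setT Num.sqrt measurableT (@ler_wsqrtr R).
  apply: measurable_funX; do 2 (apply: (measurableT_comp msqrt)).
  apply: measurable_funM => //.
  under eq_fun do rewrite -powR_inv1 ?sqn_ge0//.
  exact: measurableT_comp (@measurable_powR R (-1)) (measurable_sqn gX).
- move=> w; set v := N / sqn X w.
  have s0 := sqn_ge0 X w.
  have v0 : 0 <= v by rewrite divr_ge0// ltW.
  have key j : v <= 16 ^+ j -> Num.sqrt (Num.sqrt v) ^+ 5 <= 32 ^+ j.
    move=> vj; have -> : 32 = 2 ^+ 5 :> R by rewrite !exprS expr0; lra.
    rewrite -exprM mulnC exprM lerXn2r ?nnegrE ?sqrtr_ge0 ?exprn_ge0//.
    rewrite -[leRHS]ger0_norm ?exprn_ge0// -sqrtr_sqr ler_sqrt ?sqr_ge0//.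
    rewrite -[leRHS]ger0_norm ?sqr_ge0// -sqrtr_sqr ler_sqrt ?sqr_ge0//.
    rewrite -!exprM mulnC exprM (_ : 2 ^+ (2 * 2) = 16)//.
    by rewrite !exprS expr0; lra.
  have [v1|/ltW v1] := lerP 1 v; last first.
    exists 0%N; rewrite /f mulr1 expr1; apply: le_trans (key 0%N v1) _.
    by rewrite expr0; lra.
  have [j /andP[jl ju]] := pow16_bracket v1.
  exists j; rewrite /f (_ : _ || _) ?mulr1; first by apply: key; rewrite ltW.
  have sn0 : 0 < sqn X w.
    rewrite lt_def s0 andbT; apply/negP => /eqP s00; move: v1.
    by rewrite /v s00 invr0 mulr0; lra.
  apply/orP; right; rewrite mulrC ler_pdivlMr ?exprn_gt0// mulrC -ler_pdivlMr//.
Qed.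
End inverse_moment.

(** * A moment bound for the operator norm *)

Section lattice_sum.
Variable R : realType.

Lemma expR1_ge2 : 2 <= expR 1 :> R.
Proof. by have := expR_ge1Dx (1 : R); lra. Qed.

Lemma expRN_sqr_le (a : nat) : expR (- a%:R ^+ 2) <= (1 / 2) ^+ a :> R.
Proof.
apply: (@le_trans _ _ (expR (- a%:R))).
  by rewrite ler_expR lerN2 -natrX ler_nat; case: a => // a; rewrite expnS leq_pmulr// expn_gt0.
rewrite -mulN1r expRM_natr; apply: lerXn2r; rewrite ?nnegrE ?expR_ge0//.
rewrite expRN ler_pdivlMr// mulrC ler_pdivrMr ?expR_gt0//.
by have := expR1_ge2; lra.
Qed.

(** Split at 0 and use e^(-a^2) <= 2^(-a): two geometric series of sum at most 2, and 4 <= e^2. *)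
Lemma lattice_gaussian_sum N :
  \sum_(a < N.*2.+3) expR (- (a%:R - N.+1%:R) ^+ 2) <= expR 2 :> R.
Proof.
have geo (F : nat -> R) k : (forall i, (i < k)%N -> F i <= (1 / 2) ^+ i) ->
    \sum_(0 <= i < k) F i <= 2.
  move=> Fi; apply: (@le_trans _ _ (\sum_(0 <= i < k) 1 * (1 / 2) ^+ i)).
    by apply: ler_sum_nat => i /andP[_ ik]; rewrite mul1r Fi.
  have h0 : 0 < 1 / 2 :> R by lra.
  have := geometric_le_lim k (ler01 : 0 <= 1 :> R) h0.
  rewrite gtr0_norm// => /(_ ltac:(lra)); rewrite /series/= => /le_trans; apply.
  by have -> : 1 / (1 - 1 / 2) = 2 :> R by field.
apply: (@le_trans _ _ (2 + 2)); last first.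
  have -> : 2 = 1 + 1 :> R by lra.
  by rewrite expRD; have := expR1_ge2; nra.
rewrite -(big_mkord xpredT (fun a : nat => expR (- (a%:R - N.+1%:R) ^+ 2))).
rewrite (@big_cat_nat _ _ _ N.+1)//=; last by rewrite -addnn; lia.
apply: lerD; last first.
  rewrite -{1}[N.+1]add0n big_addn; apply: geo => i _.
  by rewrite natrD addrK expRN_sqr_le.
rewrite big_nat_rev/=; apply: geo => i iN.
rewrite add0n natrB// addrAC subrr add0r sqrrN.
apply: le_trans (expRN_sqr_le _) _.
by apply: ler_wiXn2l; rewrite ?leqnSn//; lra.
Qed.

(** Markov's inequality for counting: the indicator of |g|^2 <= a is at most exp (a - |g|^2), whose
    sum factors over the coordinates. *)
Lemma lattice_count n N (a : R) :
  (\sum_(g : {ffun 'I_n -> 'I_N.*2.+3} | \sum_i lattice_coord R g i ^+ 2 <= a) 1)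
    <= expR (a + 2 * n%:R).
Proof.
apply: (@le_trans _ _ (\sum_(g : {ffun 'I_n -> 'I_N.*2.+3})
    expR (a - \sum_i lattice_coord R g i ^+ 2))).
  rewrite big_mkcond/=; apply: ler_sum => g _; case: ifPn => [ga|_]; last exact: expR_ge0.
  by rewrite -expR0 ler_expR subr_ge0.
rewrite expRD expRM_natr.
under eq_bigr do rewrite expRD -sumrN expR_sum.
rewrite -mulr_sumr ler_wpM2l ?expR_ge0//.
rewrite -(bigA_distr_bigA (fun (_ : 'I_n) (b : 'I_N.*2.+3) => expR (- (b%:R - N.+1%:R) ^+ 2))).
rewrite -[n in _ <= _ ^+ n]card_ord -prodr_const; apply: ler_prod => i _.
by rewrite lattice_gaussian_sum andbT sumr_ge0// => b _; exact: expR_ge0.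
Qed.

Variables l m : nat.
Local Notation n := (maxn l m).

Definition bilinear_form (W : 'M[R]_(l, m)) (g : {ffun 'I_l -> 'I_n.*2.+3})
    (h : {ffun 'I_m -> 'I_n.*2.+3}) : R :=
  \sum_i \sum_j lattice_coord R g i * W i j * lattice_coord R h j.

Definition lattice_sum (W : 'M[R]_(l, m)) : R :=
  \sum_(g : {ffun 'I_l -> 'I_n.*2.+3} | \sum_i lattice_coord R g i ^+ 2 <= 4 * n%:R)
  \sum_(h : {ffun 'I_m -> 'I_n.*2.+3} | \sum_i lattice_coord R h i ^+ 2 <= 4 * n%:R)
    expR (bilinear_form W g h / Num.sqrt n%:R).

Lemma lattice_sum_ge W g h : \sum_i lattice_coord R g i ^+ 2 <= 4 * n%:R ->
  \sum_i lattice_coord R h i ^+ 2 <= 4 * n%:R ->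
  expR (bilinear_form W g h / Num.sqrt n%:R) <= lattice_sum W.
Proof.
move=> g4 h4; rewrite /lattice_sum (bigD1 g)//= (bigD1 h)//= -addrA lerDl.
by rewrite addr_ge0// ?sumr_ge0// => *; rewrite ?sumr_ge0// => *; exact: expR_ge0.
Qed.

Lemma lattice_sum_ge1 W : 1 <= lattice_sum W.
Proof.
have z k : exists g : {ffun 'I_k -> 'I_n.*2.+3}, forall i, lattice_coord R g i = 0.
  exists [ffun=> inord n.+1] => i; rewrite /lattice_coord ffunE inordK ?subrr//.
  by rewrite -addnn; lia.
have [g g0] := z l; have [h h0] := z m.
have b0 : bilinear_form W g h = 0.
  by rewrite /bilinear_form big1// => i _; rewrite big1// => j _; rewrite g0 !mul0r.
have := @lattice_sum_ge W g h; rewrite b0 mul0r expR0; apply.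
  by rewrite big1 ?mulr_ge0// => i _; rewrite g0 expr0n.
by rewrite big1 ?mulr_ge0// => i _; rewrite h0 expr0n.
Qed.

(** A soft maximum: every b / sqrt n occurring in the sum is at most [ln (lattice_sum W)], and some
    b dominates n u W v^T. Unlike the maximum, the sum has a mean that is computed term by term. *)
Definition op_bound (W : 'M[R]_(l, m)) : R := ln (lattice_sum W) / Num.sqrt n%:R.

Hypothesis l0 : (0 < l)%N.

Let n0 : 0 < n%:R :> R. Proof. by rewrite ltr0n; lia. Qed.
Let q0 : 0 < Num.sqrt n%:R :> R. Proof. by rewrite sqrtr_gt0 n0. Qed.
Let q2 : Num.sqrt n%:R ^+ 2 = n%:R :> R. Proof. by rewrite sqr_sqrtr// ltW. Qed.

Lemma op_bound_ge0 W : 0 <= op_bound W.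
Proof. by apply: divr_ge0 (ltW q0); rewrite ln_ge0// lattice_sum_ge1. Qed.

Lemma opbnd_op_bound W : opbnd W (op_bound W).
Proof.
move=> u v u1 v1; have [g [h [g4 h4 gh]]] := lattice_dominates W u1 v1.
have := lattice_sum_ge W g4 h4; set b := bilinear_form _ _ _ => bS.
have bl : b / Num.sqrt n%:R <= ln (lattice_sum W).
  rewrite -[leLHS]expRK ler_ln// ?posrE ?expR_gt0//.
  by rewrite (lt_le_trans ltr01)// lattice_sum_ge1.
rewrite ler_pdivlMr// (le_trans _ bl)// ler_pdivlMr// -mulrA -expr2 q2 mulrC.
exact: gh.
Qed.

Context d (T : measurableType d) (P : probability T R).
Variable X : 'I_l * 'I_m -> T -> R.
Hypothesis gX : iid_gaussian P X.

Definition vmx (x : 'I_l * 'I_m -> R) : 'M[R]_(l, m) := \matrix_(i, j) x (i, j).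

(** The exponent is 20 = 6 + 6 + 8: there are at most e^(4n + 2n) choices for each of g and h, and
    each term has mean exp (|g|^2 |h|^2 / (2n)) <= e^(8n). *)
Lemma mean_lattice_sum :
  mean_le P (fun w => lattice_sum (vmx (X ^~ w))) (expR (20 * n%:R)).
Proof.
have term (g : {ffun 'I_l -> 'I_n.*2.+3}) (h : {ffun 'I_m -> 'I_n.*2.+3}) :
    \sum_i lattice_coord R g i ^+ 2 <= 4 * n%:R -> \sum_i lattice_coord R h i ^+ 2 <= 4 * n%:R ->
    mean_le P (fun w => expR (bilinear_form (vmx (X ^~ w)) g h / Num.sqrt n%:R))
      (expR (8 * n%:R)).
  move=> g4 h4; pose a ij : R := lattice_coord R g ij.1 * lattice_coord R h ij.2 / Num.sqrt n%:R.
  have := mean_expR_linear gX a.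
  have -> : (fun w => expR (\sum_i a i * X i w)) =
      fun w => expR (bilinear_form (vmx (X ^~ w)) g h / Num.sqrt n%:R).
    apply/funext => w; congr expR; rewrite /bilinear_form pair_big/= mulr_suml.
    by apply: eq_bigr => -[i j] _; rewrite mxE/= /a; ring.
  apply: mean_le_trans; rewrite ler_expR ler_pdivrMr//.
  have -> : \sum_i a i ^+ 2 =
      (\sum_i lattice_coord R g i ^+ 2) * (\sum_j lattice_coord R h j ^+ 2) / n%:R.
    rewrite mulr_suml; under [in RHS]eq_bigr do rewrite mulr_sumr.
    rewrite pair_big/= mulr_suml; apply: eq_bigr => -[i j] _.
    by rewrite /a/= exprMn exprVn q2 exprMn.
  rewrite ler_pdivrMr//; apply: le_trans (ler_pM _ _ g4 h4) _.
  - by apply: sumr_ge0 => *; exact: sqr_ge0.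
  - by apply: sumr_ge0 => *; exact: sqr_ge0.
  - by have := n0; nra.
have cnt k : (k <= n)%N ->
    \sum_(g : {ffun 'I_k -> 'I_n.*2.+3} | \sum_i lattice_coord R g i ^+ 2 <= 4 * n%:R) 1
      <= expR (6 * n%:R) :> R.
  move=> kn; apply: le_trans (lattice_count _ _ _) _; rewrite ler_expR.
  have : k%:R <= n%:R :> R by rewrite ler_nat.
  lra.
have h := mean_le_sum (P := P) (index_enum _) (fun g g4 =>
  mean_le_sum (index_enum _) (fun h h4 => term g h g4 h4)).
apply: mean_le_trans h.
under eq_bigr do under eq_bigr do rewrite -[expR _]mul1r.
under eq_bigr do rewrite -mulr_suml -[X in X * _]mul1r -mulrA.
rewrite -mulr_suml; have -> : 20 * n%:R = 6 * n%:R + (6 * n%:R + 8 * n%:R) :> R by ring.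
have s0 k : 0 <= \sum_(g : {ffun 'I_k -> 'I_n.*2.+3}
    | \sum_i lattice_coord R g i ^+ 2 <= 4 * n%:R) 1 :> R.
  by apply: sumr_ge0.
rewrite !expRD; apply: ler_pM; rewrite ?mulr_ge0 ?s0 ?expR_ge0 ?cnt ?leq_maxl//.
by rewrite ler_wpM2r ?expR_ge0// cnt// leq_maxr.
Qed.

(** Put psi = e^(-20n) S, of mean at most 1. Then ln S <= 20 n + 2 sqrt psi, so (ln S)^2 <= 800 n^2
    + 8 psi, and division by n gives the 808. *)
Lemma mean_op_bound_sqr :
  mean_le P (fun w => op_bound (vmx (X ^~ w)) ^+ 2) (808 * n%:R).
Proof.
have [mS S0 _] := mean_lattice_sum.
have n1 : 1 <= n%:R :> R by rewrite ler1n; lia.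
have c0 : 0 <= 8 * expR (- (20 * n%:R)) :> R by rewrite mulr_ge0 ?expR_ge0.
have h := mean_leD (mean_le_cst P (_ : 0 <= 800 * n%:R)) (mean_leZ c0 mean_lattice_sum).
apply: mean_le_mono (mean_le_trans _ (h _)) => [|w||].
- apply: measurable_funX; apply: measurable_funM => //.
  by apply: (measurableT_comp _ mS); exact: measurable_ln.
- rewrite sqr_ge0 /=; set S := lattice_sum _.
  have S1 : 1 <= S by exact: lattice_sum_ge1.
  pose psi := expR (- (20 * n%:R)) * S.
  have p0 : 0 < psi by rewrite mulr_gt0 ?expR_gt0//; lra.
  have q1 : 0 < Num.sqrt psi by rewrite sqrtr_gt0.
  have r2 : Num.sqrt psi ^+ 2 = psi by rewrite sqr_sqrtr// ltW.
  have lE : ln S <= 20 * n%:R + 2 * Num.sqrt psi.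
    have -> : S = expR (20 * n%:R) * Num.sqrt psi ^+ 2.
      by rewrite r2 /psi mulrA -expRD subrr expR0 mul1r.
    have : ln (Num.sqrt psi) <= Num.sqrt psi.
      have := @le_ln1Dx _ (Num.sqrt psi - 1) ltac:(lra).
      have -> : 1 + (Num.sqrt psi - 1) = Num.sqrt psi by lra.
      lra.
    rewrite lnM ?posrE ?expR_gt0 ?exprn_gt0// expRK lnXn// mulr2n; lra.
  have l1 : 0 <= ln S by rewrite ln_ge0.
  rewrite /op_bound -/S expr_div_n q2 ler_pdivrMr// -mulrA -/psi.
  apply: (@le_trans _ _ ((20 * n%:R + 2 * Num.sqrt psi) ^+ 2)).
    by apply: lerXn2r => //; rewrite nnegrE (le_trans l1).
  apply: (@le_trans _ _ (800 * n%:R * n%:R + 8 * Num.sqrt psi ^+ 2)).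
    by have := sqr_ge0 (20 * n%:R - 2 * Num.sqrt psi); lra.
  by rewrite r2; have := ler_peMr (ltW p0) n1; lra.
- by rewrite -mulrA -expRD addNr expR0; lra.
- by lra.
Qed.

Lemma prob_lattice_sum_large :
  mean_le P (fun w => (expR (21 * n%:R) < lattice_sum (vmx (X ^~ w)))%R%:R)
    (expR (- n%:R)).
Proof.
have [mS S0 _] := mean_lattice_sum.
apply: mean_le_mono (mean_le_trans _ (mean_leZ (c := expR (- (21 * n%:R))) _ mean_lattice_sum)).
- apply: (@measurableT_comp _ _ _ _ _ _ (fun b : bool => b%:R : R)) => //.
  exact: measurable_fun_ltr.
- move=> w; rewrite ler0n /=; case: ltP => h; last by rewrite mulr_ge0 ?expR_ge0.
  by rewrite expRN ler_pdivlMl ?expR_gt0// mulr1 ltW.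
- by rewrite -expRD ler_expR; lra.
- exact: expR_ge0.
Qed.

Lemma op_bound_le (W : 'M[R]_(l, m)) : lattice_sum W <= expR (21 * n%:R) ->
  op_bound W <= 21 * Num.sqrt n%:R.
Proof.
move=> h; rewrite ler_pdivrMr// -mulrA -expr2 q2 -[leRHS]expRK ler_ln ?posrE ?expR_gt0//.
by rewrite (lt_le_trans ltr01)// lattice_sum_ge1.
Qed.
End lattice_sum.

(** * Gaussian concentration *)

Section mean_le_transfer.
Variable R : realType.

Lemma mean_le_law d1 d2 (T1 : measurableType d1) (T2 : measurableType d2)
    (P1 : probability T1 R) (P2 : probability T2 R) (I : finType)
    (X1 : I -> T1 -> R) (X2 : I -> T2 -> R) (F : fspace R I -> R) (a : R) :
  iid_gaussian P1 X1 -> iid_gaussian P2 X2 -> measurable_fun setT F -> (forall x, 0 <= F x) ->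
  mean_le P1 (fun w => F (X1 ^~ w)) a -> mean_le P2 (fun w => F (X2 ^~ w)) a.
Proof.
move=> g1 g2 mF F0 [_ _ Fa]; split => //.
  by apply: (measurableT_comp mF); apply: measurable_fspace => i; case: g2.
rewrite -(iid_gaussian_law (f := fun x => (F x)%:E) g1 g2)//.
exact/measurable_EFinP.
Qed.

Context d (T : measurableType d) (P : probability T R).

Lemma mean_le_prod (F : T * T -> R) (g : T -> R) (a : R) :
  measurable_fun setT F -> (forall w, 0 <= F w) ->
  (forall w1, mean_le P (fun w2 => F (w1, w2)) (g w1)) -> mean_le P g a ->
  mean_le (prod_prob P) F a.
Proof.
move=> mF F0 Fg [mg g0 ga]; split => //.
rewrite (_ : integral _ _ _ = \int[(P \x P)%E]_w (F w)%:E)%E//.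
rewrite fubini_tonelli1//; last exact/measurable_EFinP.
apply: le_trans ga; apply: ge0_le_integral_nonmeasurable => w.
  by apply: integral_ge0 => w2 _; rewrite lee_fin.
by case: (Fg w).
Qed.

(** If every section had mean above b, Tonelli would make the total at least b > a. *)
Lemma mean_le_section (F : T * T -> R) (a b : R) : a < b ->
  measurable_fun setT F -> mean_le (prod_prob P) F a ->
  exists w1, mean_le P (fun w2 => F (w1, w2)) b.
Proof.
move=> ab mF [_ F0 Fa]; apply/not_existsP => H.
have mF1 w : measurable_fun setT (fun w2 => F (w, w2)).
  exact: measurableT_comp mF (measurable_pair1 _).
have Hb w : (b%:E <= \int[P]_w2 (F (w, w2))%:E)%E.
  by rewrite leNgt; apply/negP => /ltW h; apply: (H w).
have b0 : 0 <= b.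
  have : (0 <= a%:E)%E.
    by apply: le_trans Fa; apply: integral_ge0 => w _; rewrite lee_fin.
  by rewrite lee_fin => /le_trans; apply; rewrite ltW.
have : (b%:E <= a%:E)%E.
  apply: le_trans Fa.
  rewrite (_ : integral _ _ _ = \int[(P \x P)%E]_w (F w)%:E)%E//.
  rewrite fubini_tonelli1//; last exact/measurable_EFinP.
  apply: (@le_trans _ _ (\int[P]_w b%:E)%E).
    rewrite integral_cst// -[leLHS]mule1; apply: lee_wpmul2l; first by rewrite lee_fin.
    by rewrite -(@probability_setT _ _ _ P).
  by apply: ge0_le_integral_nonmeasurable => w; rewrite ?lee_fin//; exact: Hb.
by rewrite lee_fin leNgt ab.
Qed.
End mean_le_transfer.

Section half_angle.
Variable R : realType.

(* cos (pi / 2^(j+1)) and sin (pi / 2^(j+1)). *)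
Fixpoint hcos (j : nat) : R :=
  if j is j.+1 then Num.sqrt ((1 + hcos j) / 2) else 0.

Definition hsin (j : nat) : R := Num.sqrt (1 - hcos j ^+ 2).

Lemma hcos_itv j : 0 <= hcos j <= 1.
Proof.
elim: j => [|j /andP[h0 h1]] /=; first by rewrite lexx ler01.
by rewrite sqrtr_ge0 -[leRHS]sqrtr1 ler_sqrt ?ltr01//; lra.
Qed.

Lemma hcos_hsin j : hcos j ^+ 2 + hsin j ^+ 2 = 1.
Proof.
have /andP[h0 h1] := hcos_itv j; rewrite sqr_sqrtr; first by ring.
by rewrite subr_ge0 expr_le1.
Qed.

Lemma hcosS_sqr j : hcos j.+1 ^+ 2 = (1 + hcos j) / 2.
Proof. by have /andP[h0 h1] := hcos_itv j; rewrite /= sqr_sqrtr//; lra. Qed.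

Lemma hcos_double j : hcos j.+1 ^+ 2 - hsin j.+1 ^+ 2 = hcos j.
Proof. by have := hcos_hsin j.+1; rewrite hcosS_sqr; lra. Qed.

Lemma hsin_double j : 2 * hcos j.+1 * hsin j.+1 = hsin j.
Proof.
have /andP[h0 h1] := hcos_itv j; have /andP[g0 g1] := hcos_itv j.+1.
apply/eqP; rewrite -(@eqrXn2 _ 2)// ?mulr_ge0 ?sqrtr_ge0//; apply/eqP.
have := hcos_hsin j.+1; have := hcos_hsin j; rewrite !exprMn hcosS_sqr.
move=> e1 e2; have -> : hsin j.+1 ^+ 2 = (1 - hcos j) / 2 by lra.
have -> : hsin j ^+ 2 = 1 - hcos j ^+ 2 by lra.
by field.
Qed.

(* The bound [2 - 4^-j] on [4^j (1 - cos)] is chosen so that the half-angle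
   recursion preserves it. *)
Lemma hcos_rate j : 4 ^+ j * (1 - hcos j) <= 2 - 4 ^- j.
Proof.
elim: j => [|j IH]; first by rewrite !expr0 /= invr1; lra.
have /andP[h0 h1] := hcos_itv j; have /andP[g0 g1] := hcos_itv j.+1.
have cS := hcosS_sqr j.
have [e eE] : {e | e = 4 ^- j.+1 :> R} by eexists.
have p1 : 1 <= 4 ^+ j :> R by rewrite exprn_ege1// ler1n.
have e4 : 4 ^- j = 4 * e by rewrite eE exprS invfM mulrA divff ?mul1r.
have e0 : 0 < e by rewrite eE invr_gt0 exprn_gt0.
have ej : 4 ^+ j * (4 * e) = 1 by rewrite -e4 divff// gt_eqF// (lt_le_trans ltr01).
rewrite -eE exprS; move: IH; rewrite e4 => IH.
have uE : hcos j = 1 - 2 * (1 - hcos j.+1) * (2 - (1 - hcos j.+1)) by lra.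
set u := 1 - hcos j.+1 in uE *; rewrite uE in IH.
have {}IH : u * (2 - u) <= 4 * e - 8 * e ^+ 2.
  have e4' : 0 <= 2 * e by lra.
  have := ler_wpM2l e4' IH.
  have -> : 2 * e * (4 ^+ j * (1 - (1 - 2 * u * (2 - u)))) =
    4 ^+ j * (4 * e) * (u * (2 - u)) by ring.
  by rewrite ej; lra.
have ele : 4 * e <= 1 by rewrite -e4 invf_le1// (lt_le_trans ltr01).
have u1 : u <= 1 by rewrite /u; lra.
suff : u <= e * (2 - e).
  move=> h; have p0 : 0 <= 4 * 4 ^+ j :> R by lra.
  have := ler_wpM2l p0 h; have -> : 4 * 4 ^+ j * (e * (2 - e)) = 4 ^+ j * (4 * e) * (2 - e) by ring.
  by rewrite ej mul1r.
(* The map u -> u (2 - u) increases on [0, 1], and its value at e (2 - e) exceeds 4e - 8e^2 by e^2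
   (2 + 4e - e^2) > 0. *)
rewrite leNgt; apply/negP => H.
have y1 : e * (2 - e) <= 1 by nra.
have := mulr_ge0 (_ : 0 <= u - e * (2 - e)) (_ : 0 <= 2 - u - e * (2 - e)).
move=> /(_ ltac:(lra) ltac:(lra)) h.
have h2 : e * (2 - e) * (2 - e * (2 - e)) <= 4 * e - 8 * e ^+ 2 by lra.
have : 0 < e ^+ 2 * (2 + 4 * e - e ^+ 2) by rewrite mulr_gt0 ?exprn_gt0//; nra.
by lra.
Qed.
End half_angle.

Section concentration.
Context d (T : measurableType d) (R : realType) (P : probability T R).
Variables (I : finType) (X : I -> T -> R) (f : (I -> R) -> R) (k : R).
Hypothesis gX : iid_gaussian P X.
Hypothesis I0 : (0 < #|I|)%N.
Hypothesis k0 : 0 < k.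
Hypothesis subgradient : forall x, exists2 u : I -> R, \sum_i u i ^+ 2 <= k &
  forall y, f x - f y <= \sum_i u i * (x i - y i).
Local Notation N := (#|I|%:R : R).
Local Notation e := (expR (1 / 2) : R).

(** Used for measurability only; the variance bound comes from the subgradients themselves. *)
Lemma subgradient_lipschitz x y : `|f x - f y| <= Num.sqrt k * \sum_i `|x i - y i|.
Proof.
have half x' y' : f x' - f y' <= Num.sqrt k * \sum_i `|x' i - y' i|.
  have [u uk fu] := subgradient x'; apply: le_trans (fu _) _.
  rewrite mulr_sumr; apply: ler_sum => i _.
  rewrite (le_trans (ler_norm _))// normrM ler_wpM2r// -sqrtr_sqr ler_sqrt ?(ltW k0)//.
  by apply: le_trans uk; rewrite (bigD1 i)//= lerDl sumr_ge0// => *; exact: sqr_ge0.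
rewrite ler_norml half andbT -lerN2 opprB opprK (le_trans (half _ _))//.
by under eq_bigr do rewrite distrC.
Qed.

Local Notation F2 := (fspace R (I + I)%type).

Definition rot (c s : R) (z : I + I -> R) (i : I) : R := c * z (inl i) + s * z (inr i).

Definition pairX (k : I + I) (w : T * T) : R :=
  match k with inl i => X i w.1 | inr i => X i w.2 end.

Lemma iid_gaussian_pairX : iid_gaussian (prod_prob P) pairX.
Proof.
have := iid_gaussian_rotate ler01 (_ : 1 ^+ 2 + 0 ^+ 2 = 1) gX.
rewrite expr0n/= addr0 expr1n => /(_ erefl).
rewrite (_ : (fun _ => _) = pairX)//.
by apply/funext => -[i|i]; apply/funext => w; rewrite /= !mul1r mul0r ?subr0 ?addr0.
Qed.

Lemma measurable_f_rot c s : measurable_fun setT (fun z : F2 => f (rot c s z)).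
Proof.
apply: (@measurable_lipschitz R I _ F2 (fun z => rot c s z) f (Num.sqrt k)).
- exact: sqrtr_ge0.
- exact: subgradient_lipschitz.
- by move=> i; apply: measurable_funD; apply: measurable_funM => //;
    exact: measurable_coord.
Qed.

Lemma measurable_pairX (F : F2 -> R) : measurable_fun setT F ->
  measurable_fun setT (fun w => F (pairX ^~ w)).
Proof.
by move=> mF; apply: (measurableT_comp mF); apply: measurable_fspace => i; case: iid_gaussian_pairX.
Qed.

Definition gap c s c' s' (z : F2) : R := f (rot c s z) - f (rot c' s' z).
(** A subgradient at the first point bounds the gap from above only, so the positive part is
    estimated first. *)
Definition pgap c s c' s' (z : F2) : R := Num.max 0 (gap c s c' s' z) ^+ 2.

Lemma measurable_gap c s c' s' : measurable_fun setT (gap c s c' s').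
Proof. by apply: measurable_funB; exact: measurable_f_rot. Qed.

Lemma measurable_pgap c s c' s' : measurable_fun setT (pgap c s c' s').
Proof.
by apply: measurable_funX; apply: measurable_maxr => //; exact: measurable_gap.
Qed.

Let mean_sqn : mean_le P (sqn X) (4 * e * N).
Proof.
have N0 : 0 < N by rewrite ltr0n.
have := mean_leZ (ltW N0) (mean_sqn_pow gX 1 I0).
have -> : (fun w => N * (sqn X w / N) ^+ 1) = sqn X.
  by apply/funext => w; rewrite expr1 mulrCA divff ?mulr1// gt_eqF.
by apply: mean_le_trans; rewrite expr1 -[1`!]/1%N; lra.
Qed.

(** Taken at the first copy, the subgradient u is constant when the second copy is integrated, so it
    need not depend measurably on w1. The gap is at most (1 - c) <u, X> - s <u, X'>: Cauchy-Schwarz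
    bounds the square of <u, X> by k |X|^2, and <u, X'> has second moment O(k). *)
Lemma mean_pgap c s :
  mean_le (prod_prob P) (fun w => pgap 1 0 c s (pairX ^~ w))
    (8 * e * k * ((1 - c) ^+ 2 * N + s ^+ 2)).
Proof.
have c10 : 0 <= 2 * (1 - c) ^+ 2 * k by apply: mulr_ge0 (ltW k0); rewrite mulr_ge0 ?sqr_ge0.
have c20 : 0 <= 2 * s ^+ 2 * (4 * e * k).
  apply: mulr_ge0; first by rewrite mulr_ge0 ?sqr_ge0.
  by rewrite !mulr_ge0 ?expR_ge0 ?(ltW k0).
have H := mean_leD (mean_leZ c10 mean_sqn) (mean_le_cst P c20).
apply: mean_le_prod (mean_le_trans _ H).
- exact: measurable_pairX (measurable_pgap _ _ _ _).
- by move=> w; exact: sqr_ge0.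
- move=> w1; have [u uk fu] := subgradient (X ^~ w1).
  have c30 : 0 <= 2 * s ^+ 2 by rewrite mulr_ge0 ?sqr_ge0.
  have H2 := mean_leD (mean_le_cst P (_ : 0 <= 2 * (1 - c) ^+ 2 * k * sqn X w1))
    (mean_leZ c30 (mean_linear_sqr gX uk)).
  apply: mean_le_mono (mean_le_trans _ (H2 _)) => //; last first.
  + by rewrite mulr_ge0 ?sqn_ge0.
  + move=> w2; rewrite sqr_ge0/=.
    have fuE := fu (rot c s (pairX ^~ (w1, w2))).
    set L := \sum_i u i * X i w2; pose L1 := \sum_i u i * X i w1.
    have L1E : L1 ^+ 2 <= k * sqn X w1.
      have : 0 <= \sum_i (L1 / k * u i - X i w1) ^+ 2 by apply: sumr_ge0 => i _; exact: sqr_ge0.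
      have gen b : \sum_i (b * u i - X i w1) ^+ 2 =
          b ^+ 2 * (\sum_i u i ^+ 2) - 2 * b * L1 + sqn X w1.
        rewrite /sqn /L1 !mulr_sumr -sumrB -big_split/=.
        by apply: eq_bigr => i _; ring.
      rewrite gen.
      have := ler_wpM2l (sqr_ge0 (L1 / k)) uk.
      rewrite expr_div_n => h1 h2.
      have h3 : L1 ^+ 2 / k <= sqn X w1.
        have -> : L1 ^+ 2 / k = 2 * (L1 / k) * L1 - L1 ^+ 2 / k ^+ 2 * k by field; rewrite gt_eqF.
        lra.
      by rewrite ler_pdivrMr// mulrC in h3.
    have gE : gap 1 0 c s (pairX ^~ (w1, w2)) <= (1 - c) * L1 - s * L.
      rewrite /gap (_ : rot 1 0 _ = X ^~ w1); last first.
        by apply/funext => i; rewrite /rot/= mul1r mul0r addr0.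
      apply: le_trans fuE _; rewrite /L1 /L !mulr_sumr -sumrB.
      by apply: ler_sum => i _; rewrite /rot/=; lra.
    apply: (@le_trans _ _ (((1 - c) * L1 - s * L) ^+ 2)).
      rewrite /pgap; case: (lerP 0 (gap 1 0 c s (pairX ^~ (w1, w2)))) => g0.
        by rewrite lerXn2r ?nnegrE// (le_trans g0).
      by rewrite expr0n/= sqr_ge0.
    have := sqr_ge0 ((1 - c) * L1 + s * L).
    have := ler_wpM2l (_ : 0 <= 2 * (1 - c) ^+ 2) L1E.
    move=> /(_ ltac:(rewrite mulr_ge0 ?sqr_ge0//)); lra.
  + exact: measurableT_comp (measurable_pairX (measurable_pgap 1 0 c s)) (measurable_pair1 w1).
- by lra.
Qed.

Lemma mean_rot c s (F : F2 -> R) a : 0 <= c -> c ^+ 2 + s ^+ 2 = 1 ->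
  measurable_fun setT F -> (forall z, 0 <= F z) ->
  mean_le (prod_prob P) (fun w => F (pairX ^~ w)) a ->
  mean_le (prod_prob P) (fun w => F (fun k => match k with
    | inl i => rot c s (pairX ^~ w) i
    | inr i => rot (- s) c (pairX ^~ w) i
    end)) a.
Proof.
move=> c0 cs mF F0; have gr := iid_gaussian_rotate c0 cs gX.
move=> /(mean_le_law iid_gaussian_pairX gr mF F0).
congr mean_le; apply/funext => w; congr F; apply/funext => -[i|i]//.
by rewrite /rot/=; lra.
Qed.

(** For the negative part, rotate the pair forward and apply [mean_pgap] to the backward rotation:
    this exchanges the two points and changes the sign of the gap. *)
Lemma mean_gap c s : 0 <= c -> c ^+ 2 + s ^+ 2 = 1 ->
  mean_le (prod_prob P) (fun w => gap 1 0 c s (pairX ^~ w) ^+ 2)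
    (16 * e * k * ((1 - c) ^+ 2 * N + s ^+ 2)).
Proof.
move=> c0 cs; have h1 := mean_pgap c s.
have h2 := mean_rot c0 cs (measurable_pgap _ _ _ _) (fun=> sqr_ge0 _) (mean_pgap c (- s)).
apply: mean_le_mono (mean_le_trans _ (mean_leD h1 h2)); last by rewrite sqrrN; lra.
  apply: (@measurable_pairX (fun z => gap 1 0 c s z ^+ 2)).
  by apply: measurable_funX; exact: measurable_gap.
move=> w; rewrite sqr_ge0/=; set z := pairX ^~ w.
rewrite /pgap; set g := gap 1 0 c s z; set g' := gap _ _ _ _ _.
have -> : g' = - g.
  rewrite /g' /g /gap opprB; congr (f _ - f _); apply/funext => i.
    by rewrite /rot; ring.
  by rewrite /rot mul0r addr0 -cs; ring.
case: (lerP 0 g) => g0; case: (lerP 0 (- g)) => g1;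
  by rewrite ?sqrrN ?expr0n/= ?addr0 ?add0r ?lerDl ?sqr_ge0//; lra.
Qed.

(** The gap for the doubled angle is the gap for the angle plus the same gap for the rotated pair,
    which has the same law; (a + b)^2 <= 2 a^2 + 2 b^2. *)
Lemma mean_gap_double c s a : 0 <= c -> c ^+ 2 + s ^+ 2 = 1 ->
  mean_le (prod_prob P) (fun w => gap 1 0 c s (pairX ^~ w) ^+ 2) a ->
  mean_le (prod_prob P) (fun w => gap 1 0 (c ^+ 2 - s ^+ 2) (2 * c * s) (pairX ^~ w) ^+ 2)
    (4 * a).
Proof.
move=> c0 cs h.
have mg c1 s1 c2 s2 : measurable_fun setT (fun z => gap c1 s1 c2 s2 z ^+ 2).
  by apply: measurable_funX; exact: measurable_gap.
have h2 := mean_rot c0 cs (mg _ _ _ _) (fun=> sqr_ge0 _) h.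
apply: mean_le_mono (mean_le_trans _ (mean_leZ (ler0n R 2) (mean_leD h h2))); last by lra.
  exact: measurable_pairX (mg 1 0 (c ^+ 2 - s ^+ 2) (2 * c * s)).
move=> w; rewrite sqr_ge0/=; set z := pairX ^~ w.
set g1 := gap 1 0 c s z; set g2 := gap 1 0 c s _; set g := gap _ _ _ _ _.
have -> : g = g1 + g2.
  rewrite /g /g1 /g2 /gap addrA; congr (_ - f _); last by apply/funext => i; rewrite /rot; ring.
  rewrite -addrA -[LHS]addr0; congr (_ + _); apply/esym/eqP; rewrite addrC subr_eq0; apply/eqP.
  by congr f; apply/funext => i; rewrite /rot; ring.
by have := sqr_ge0 (g1 - g2); lra.
Qed.

Lemma mean_independent_gap :
  mean_le (prod_prob P) (fun w => (f (X ^~ w.1) - f (X ^~ w.2)) ^+ 2) (128 * e * k).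
Proof.
have H j i : mean_le (prod_prob P)
    (fun w => gap 1 0 (hcos R j) (hsin R j) (pairX ^~ w) ^+ 2)
    (4 ^+ i * (16 * e * k * ((1 - hcos R (j + i)) ^+ 2 * N + hsin R (j + i) ^+ 2))).
  elim: i j => [|i IH] j.
    rewrite addn0 expr0 mul1r; apply: mean_gap (hcos_hsin R j).
    by have /andP[] := hcos_itv R j.
  have := mean_gap_double _ (hcos_hsin R j.+1) (IH j.+1).
  rewrite hcos_double hsin_double addSnnS mulrA -exprS; apply.
  by have /andP[] := hcos_itv R j.+1.
(* At index 0 the angle is a right angle and the rotated copy is X' itself. As N <= 4^|I|, |I|
   halvings make the angle small enough for 4^j (1 - cos)^2 N to stay bounded. *)
have := H 0%N #|I|; rewrite add0n; set j := #|I|.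
have -> : (fun w => gap 1 0 (hcos R 0) (hsin R 0) (pairX ^~ w) ^+ 2) =
    fun w => (f (X ^~ w.1) - f (X ^~ w.2)) ^+ 2.
  apply/funext => w; congr (_ ^+ 2); rewrite /gap; congr (f _ - f _); apply/funext => i.
    by rewrite /rot/= mul1r mul0r addr0.
  by rewrite /rot/= /hsin/= expr0n/= subr0 sqrtr1 mul1r mul0r add0r.
apply: mean_le_trans.
have /andP[c0 c1] := hcos_itv R j; have cs := hcos_hsin R j; have cr := hcos_rate R j.
have p0 : 0 < 4 ^+ j :> R by rewrite exprn_gt0.
have Np : N <= 4 ^+ j by rewrite -/j -natrX ler_nat ltnW// ltn_expl.
have i0 : 0 < 4 ^- j :> R by rewrite invr_gt0.
have u0 : 0 <= 1 - hcos R j by lra.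
have ek0 : 0 <= 16 * e * k by rewrite !mulr_ge0 ?expR_ge0 ?(ltW k0).
suff : 4 ^+ j * ((1 - hcos R j) ^+ 2 * N + hsin R j ^+ 2) <= 8.
  by move=> /(ler_wpM2l ek0); lra.
have a2 : 4 ^+ j * (1 - hcos R j) <= 2 by lra.
have -> : hsin R j ^+ 2 = (1 - hcos R j) * (1 + hcos R j) by lra.
have h1 : 4 ^+ j * ((1 - hcos R j) ^+ 2 * N) <= 4.
  apply: (@le_trans _ _ ((4 ^+ j * (1 - hcos R j)) ^+ 2)).
    have := ler_wpM2l (_ : 0 <= 4 ^+ j * (1 - hcos R j) ^+ 2) Np.
    by rewrite mulr_ge0 ?sqr_ge0 ?(ltW p0)// => /(_ erefl); lra.
  by have := mulr_ge0 (ltW p0) u0; nra.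
have h2 : 4 ^+ j * ((1 - hcos R j) * (1 + hcos R j)) <= 4.
  by have := mulr_ge0 (ltW p0) u0; nra.
by lra.
Qed.

(** The centre is the value of f at one well chosen outcome of the first copy, so no mean of f has
    to be formed; the factor 2 is the slack for choosing that outcome. *)
Lemma gaussian_concentration :
  exists a, mean_le P (fun w => (f (X ^~ w) - a) ^+ 2) (256 * e * k).
Proof.
have lt : 128 * e * k < 256 * e * k.
  by have := mulr_gt0 (expR_gt0 (1 / 2 : R)) k0; lra.
have mF : measurable_fun setT (fun w : T * T => (f (X ^~ w.1) - f (X ^~ w.2)) ^+ 2).
  by case: mean_independent_gap.
have [w1 h] := mean_le_section lt mF mean_independent_gap.
exists (f (X ^~ w1)); move: h; congr mean_le; apply/funext => w /=.
by rewrite -sqrrN opprB.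
Qed.
End concentration.

(** * The minimizer *)

Section deterministic.
Variables (R : realType) (l m : nat).
Hypotheses (l0 : (0 < l)%N) (m0 : (0 < m)%N).
Variables (M W Mh : 'M[R]_(l, m)) (sg x : R).
Hypotheses (sg0 : 0 < sg) (x0 : 0 <= x).
Local Notation N := ((l * m)%:R : R).
Local Notation n := ((maxn l m)%:R : R).
Local Notation k := ((minn l m)%:R : R).
Local Notation Y := (M + sg *: W).
Hypothesis MhP : argmin (@nuclear_norm R l m)
  [set A | hs_norm (Y - A) ^+ 2 <= N * (sg * x) ^+ 2] Mh.

Lemma minn_maxn_natr : k * n = N.
Proof. by rewrite -natrM; congr _%:R; case: (leqP l m); rewrite // mulnC. Qed.

Let N0 : 0 < N. Proof. by rewrite ltr0n muln_gt0 l0. Qed.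
Let n0 : 0 < n. Proof. by rewrite ltr0n; lia. Qed.
Let k0 : 0 < k. Proof. by rewrite ltr0n; lia. Qed.
Local Notation A := (hs_norm W ^+ 2 / N).

Let hsA : hs_norm W = Num.sqrt N * Num.sqrt A.
Proof.
rewrite -sqrtrM ?(ltW N0)// mulrCA divff ?mulr1 ?gt_eqF// sqrtr_sqr ger0_norm//.
exact: hs_norm_ge0.
Qed.

Lemma nuclear_minimizer :
  nuclear_norm Mh <= nuclear_norm M
    + Num.sqrt k * sg * Num.sqrt N * Num.max 0 (Num.sqrt A - x).
Proof.
have [_ minMh] := MhP; have := hsA; have := sqrtr_ge0 A; move: (Num.sqrt A) => a age0 hsa.
have sN0 : 0 < Num.sqrt N by rewrite sqrtr_gt0.
have [h|h] := lerP (a - x) 0.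
  rewrite mulr0 addr0; apply: minMh => /=; rewrite addrC addKr.
  rewrite hs_norm_sqr !hsdot_linE -hs_norm_sqr hsa exprMn (sqr_sqrtr (ltW N0)) mulrA -expr2.
  rewrite mulrCA ler_wpM2l ?(ltW N0)// -exprMn; apply: lerXn2r.
  - by rewrite nnegrE mulr_ge0// ltW.
  - by rewrite nnegrE mulr_ge0// ltW.
  - by rewrite ler_wpM2l ?(ltW sg0)//; lra.
(* The least t for which M + t (Y - M) is feasible: its distance to Y is (1 - t) sg |W| = sg x sqrt
   N. *)
pose t := 1 - x / a.
have xa : x < a by rewrite -subr_gt0.
have a0 := le_lt_trans x0 xa.
have t0 : 0 <= t by rewrite subr_ge0 ler_pdivrMr// mul1r ltW.
have ts0 : 0 <= t * sg := mulr_ge0 t0 (ltW sg0).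
apply: (@le_trans _ _ (nuclear_norm (M + (t * sg) *: W))).
  apply: minMh => /=.
  have -> : Y - (M + (t * sg) *: W) = (sg * (x / a)) *: W.
    rewrite opprD addrACA subrr add0r -scalerBl; congr (_ *: _); rewrite /t; ring.
  rewrite hs_norm_sqr !hsdot_linE -hs_norm_sqr hsa exprMn (sqr_sqrtr (ltW N0)).
  by rewrite le_eqVlt; apply/orP; left; apply/eqP; field; rewrite gt_eqF.
apply: le_trans (nuclear_tri _ _) _; rewrite lerD2l nuclearZ//.
apply: le_trans (ler_wpM2l ts0 (nuclear_le_hs W)) _.
rewrite hsa le_eqVlt; apply/orP; left; apply/eqP; rewrite /t; field.
by rewrite gt_eqF.
Qed.

(** Expanding the feasibility condition |sg W - D|^2 <= N (sg x)^2 leaves the cross term 2 sg <W,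
    D>. Duality bounds it through nu(D) <= nu(Mh) + nu(M), and [nuclear_minimizer] bounds nu(Mh). *)
Lemma minimizer_error (K s : R) : 0 <= K -> opbnd W K ->
  nuclear_norm M / sg * Num.sqrt n <= s * N ->
  hs_norm (Mh - M) ^+ 2 / (N * sg ^+ 2) <=
    x ^+ 2 - A + 4 * (K / Num.sqrt n) * s
    + 2 * (K / Num.sqrt n) * Num.max 0 (Num.sqrt A - x).
Proof.
move=> K0 WK Ms; have [/= feas _] := MhP.
have q0 : 0 < Num.sqrt n by rewrite sqrtr_gt0.
have q2 : Num.sqrt n ^+ 2 = n by rewrite sqr_sqrtr// ltW.
have sN : Num.sqrt N = Num.sqrt k * Num.sqrt n by rewrite -sqrtrM ?minn_maxn_natr// ltW.
have k2 : Num.sqrt k ^+ 2 = k by rewrite sqr_sqrtr// ltW.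
have [D DMh] : {D | D = Mh - M} by eexists.
rewrite -DMh; have YD : Y - Mh = sg *: W - D by rewrite DMh opprB addrA [_ + M]addrC.
have DE : hs_norm D ^+ 2 <= N * (sg * x) ^+ 2 - sg ^+ 2 * hs_norm W ^+ 2
    + 2 * sg * hsdot W D.
  move: feas; rewrite YD !hs_norm_sqr !hsdot_linE (hsdotC D W); lra.
have nD : nuclear_norm D <= 2 * nuclear_norm M
    + Num.sqrt k * sg * Num.sqrt N * Num.max 0 (Num.sqrt A - x).
  rewrite DMh; apply: le_trans (nuclear_tri _ _) _; rewrite nuclearN.
  apply: le_trans (lerD nuclear_minimizer (lexx _)) _.
  by rewrite addrAC (mulr_natl _ 2) mulr2n.
set mx := Num.max _ _ in nD *.
rewrite ler_pdivrMr; last by rewrite mulr_gt0 ?exprn_gt0.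
apply: le_trans DE _.
have WD := le_trans (nuclear_dual D WK) (ler_wpM2l K0 nD).
have Ms' : nuclear_norm M <= s * N * sg / Num.sqrt n.
  by rewrite ler_pdivlMr// -ler_pdivrMr// mulrAC.
have WD2 : hsdot W D <= K * (2 * (s * N * sg / Num.sqrt n)
    + Num.sqrt k * sg * Num.sqrt N * mx).
  by apply: le_trans WD _; rewrite ler_wpM2l// lerD2r ler_wpM2l.
have := ler_wpM2l (_ : 0 <= 2 * sg) WD2; rewrite mulr_ge0 ?(ltW sg0)// => /(_ isT) WD3.
apply: le_trans (lerD (lexx _) WD3) _.
rewrite le_eqVlt; apply/orP; left; apply/eqP.
have N1 : N = Num.sqrt k ^+ 2 * Num.sqrt n ^+ 2 by rewrite k2 q2 minn_maxn_natr.
rewrite sN N1; field.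
by rewrite !gt_eqF// ?sqrtr_gt0// mulr_gt0 ?exprn_gt0 ?sqrtr_gt0.
Qed.

(** If 0 is feasible then Mh = 0; otherwise the radius is smaller than |Y|, so |Y - Mh| <= |Y|. The
    bound does not involve x, hence holds with no control of the estimated variance. *)
Lemma minimizer_error_crude :
  hs_norm (Mh - M) ^+ 2 <= 18 * (hs_norm M ^+ 2 + sg ^+ 2 * hs_norm W ^+ 2).
Proof.
have [/= feas minMh] := MhP.
have sqD (B C : 'M[R]_(l, m)) : hs_norm (B + C) ^+ 2 <= 2 * (hs_norm B ^+ 2 + hs_norm C ^+ 2).
  rewrite !hs_norm_sqr; have := hsdot_ge0 (B - C); rewrite !hsdot_linE (hsdotC C B); lra.
have sqN (B : 'M[R]_(l, m)) : hs_norm (- B) ^+ 2 = hs_norm B ^+ 2.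
  by rewrite !hs_norm_sqr !hsdot_linE opprK.
have YE : hs_norm Y ^+ 2 <= 2 * (hs_norm M ^+ 2 + sg ^+ 2 * hs_norm W ^+ 2).
  apply: le_trans (sqD _ _) _.
  by rewrite (hs_norm_sqr (sg *: W)) !hsdot_linE -hs_norm_sqr mulrA -expr2.
have MhE : hs_norm Mh ^+ 2 <= 4 * hs_norm Y ^+ 2.
  have [h|h] := lerP (hs_norm Y ^+ 2) (N * (sg * x) ^+ 2).
    have : nuclear_norm Mh <= nuclear_norm (0 : 'M[R]_(l, m)).
      by apply: minMh; rewrite /= subr0.
    have -> : nuclear_norm (0 : 'M[R]_(l, m)) = 0.
      by rewrite -(scale0r (0 : 'M[R]_(l, m))) nuclearZ// mul0r.
    move=> /(le_trans (hs_le_nuclear _)) h0.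
    have -> : hs_norm Mh = 0 by apply/eqP; rewrite eq_le h0 hs_norm_ge0.
    by rewrite expr0n/= mulr_ge0 ?sqr_ge0.
  have -> : hs_norm Mh ^+ 2 = hs_norm (Y + - (Y - Mh)) ^+ 2 by rewrite opprB addrC subrK.
  by apply: le_trans (sqD _ _) _; rewrite sqN; lra.
apply: le_trans (sqD _ _) _; rewrite sqN.
by have := sqr_ge0 (hs_norm W); have := sqr_ge0 sg; have := sqr_ge0 (hs_norm M); nra.
Qed.
End deterministic.

Section ratio.
Variables (R : realType) (l m : nat).
Variables (M W Z : 'M[R]_(l, m)) (sg : R).
Hypothesis sg0 : 0 < sg.
Local Notation Y := (M + sg *: W).
Local Notation nn := (@nuclear_norm R l m).

Lemma nuclear_shift : `|nn Y - sg * nn W| <= nn M.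
Proof. by rewrite -nuclearZ ?(ltW sg0)// (le_trans (nuclear_lip _ _))// addrK. Qed.

(** With y, w, z the nuclear norms of Y, W, Z, the error is ((y - sg w) / sg + (w - z)) / z, which
    separates the signal from the mismatch of the two noises. *)
Lemma ratio_close (b : R) : 0 < b -> b <= nn Z ->
  `|nn Y / nn Z / sg - 1| <= (nn M / sg + `|nn W - nn Z|) / b.
Proof.
move=> b0 bZ; have Z0 := lt_le_trans b0 bZ.
have split_ratio (y w z : R) : 0 < z ->
    y / z / sg - 1 = ((y - sg * w) / sg + (w - z)) / z.
  by move=> z0; field; rewrite !gt_eqF.
rewrite (split_ratio _ (nn W))//.
have num : `|(nn Y - sg * nn W) / sg + (nn W - nn Z)| <= nn M / sg + `|nn W - nn Z|.
  rewrite (le_trans (ler_normD _ _))// lerD2r normrM (gtr0_norm (x := sg^-1)) ?invr_gt0//.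
  by rewrite ler_wpM2r ?nuclear_shift// invr_ge0 ltW.
rewrite normrM (gtr0_norm (x := (nn Z)^-1)) ?invr_gt0//.
apply: ler_pM; rewrite ?invr_ge0 ?(ltW Z0)//.
by rewrite lef_pV2.
Qed.

(** The denominator is bounded below by nu(Z) >= |Z|. The case Z = 0 is included, both quotients
    being 0 by convention. *)
Lemma ratio_sqr : (nn Y / nn Z / sg) ^+ 2 <=
  2 * ((nn M / sg) ^+ 2 + (minn l m)%:R * hs_norm W ^+ 2) / hs_norm Z ^+ 2.
Proof.
have sqD (u v : R) : (u + v) ^+ 2 <= 2 * (u ^+ 2 + v ^+ 2).
  by have := sqr_ge0 (u - v); lra.
have YE : (nn Y / sg) ^+ 2 <= 2 * ((nn M / sg) ^+ 2 + (minn l m)%:R * hs_norm W ^+ 2).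
  have h1 : nn Y / sg <= nn M / sg + nn W.
    rewrite ler_pdivrMr// mulrDl mulfVK ?gt_eqF//.
    rewrite -lerBlDr; apply: le_trans nuclear_shift; rewrite [nn W * sg]mulrC.
    exact: ler_norm.
  have h2 : (nn Y / sg) ^+ 2 <= (nn M / sg + nn W) ^+ 2.
    apply: lerXn2r => //; rewrite nnegrE ?addr_ge0 ?divr_ge0 ?nuclear_ge0//; exact: ltW.
  have h3 : nn W ^+ 2 <= (minn l m)%:R * hs_norm W ^+ 2.
    have := lerXn2r 2 (_ : nn W \is Num.nneg) _ (nuclear_le_hs W).
    rewrite exprMn sqr_sqrtr//; apply; rewrite nnegrE ?nuclear_ge0//.
    by rewrite mulr_ge0 ?sqrtr_ge0 ?hs_norm_ge0.
  apply: (le_trans h2); apply: (le_trans (sqD _ _)).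
  by rewrite ler_wpM2l// lerD2l.
rewrite mulrAC exprMn exprVn.
have [z0|z0] := eqVneq (hs_norm Z) 0.
  have -> : nn Z = 0.
    by apply/eqP; rewrite eq_le nuclear_ge0 andbT (le_trans (nuclear_le_hs _))// z0 mulr0.
  by rewrite z0 expr0n/= invr0 !mulr0.
have zp : 0 < hs_norm Z by rewrite lt_def z0 hs_norm_ge0.
have zn := hs_le_nuclear Z.
apply: ler_pM => //; rewrite ?invr_ge0 ?sqr_ge0//.
rewrite lef_pV2 ?posrE ?exprn_gt0//; last exact: lt_le_trans zn.
by apply: lerXn2r => //; rewrite nnegrE ltW// (lt_le_trans zp).
Qed.

Lemma nuclear_lower (K : R) : 0 < K -> opbnd Z K -> hs_norm Z ^+ 2 / K <= nn Z.
Proof. by move=> K0 ZK; rewrite ler_pdivrMr// mulrC hs_norm_sqr nuclear_dual. Qed.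
End ratio.

Section scalar.
Variable R : realType.

Lemma sqrt_sub1_le (a : R) : 0 <= a -> `|Num.sqrt a - 1| <= `|a - 1|.
Proof.
move=> a0; have q0 := sqrtr_ge0 a; rewrite -[in leRHS](sqr_sqrtr a0).
have -> : Num.sqrt a ^+ 2 - 1 = (Num.sqrt a - 1) * (Num.sqrt a + 1) by ring.
by rewrite normrM ler_peMr// ger0_norm; lra.
Qed.

(** Here p will be sqrt N. Young's inequality 2uv <= p u^2 + q v^2 puts the weight p on eps and al,
    of mean square O(1/N), and q on kap or 1, so that all these terms have mean O(q). Products with
    s keep s as a factor through 2 kap <= kap^2 + 1. *)
Lemma good_error_bound (r x a kap s eps c p : R) (al := `|a - 1|) (q := p^-1) :
  0 <= a -> 0 <= kap -> 0 <= s -> 0 <= eps -> 0 <= c -> 0 < p ->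
  `|x - 1| <= c * (s + eps) ->
  r <= x ^+ 2 - a + 4 * kap * s + 2 * kap * Num.max 0 (Num.sqrt a - x) ->
  r <= 2 * c ^+ 2 * s ^+ 2 + 2 * c * s + c * q + q / 2 + 2 * s + c * s
    + (2 * c ^+ 2 + 2 * c * p) * eps ^+ 2
    + (2 * s + q + c * s + c * q) * kap ^+ 2
    + 3 / 2 * p * al ^+ 2.
Proof.
move=> a0 kap0 s0 eps0 c0 p0 xc rE.
have q0 : 0 < q by rewrite invr_gt0.
have pq : p * q = 1 by rewrite divff// gt_eqF.
have al0 : 0 <= al by exact: normr_ge0.
have young u v : 2 * (u * v) <= p * u ^+ 2 + q * v ^+ 2.
  have := mulr_ge0 (ltW q0) (sqr_ge0 (p * u - v)).
  have -> : q * (p * u - v) ^+ 2 = p * q * (p * u ^+ 2 - 2 * (u * v)) + q * v ^+ 2 by ring.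
  by rewrite pq; lra.
set y := `|x - 1| in xc.
have y0 : 0 <= y by exact: normr_ge0.
have mE : Num.max 0 (Num.sqrt a - x) <= al + y.
  rewrite ge_max addr_ge0//=.
  have := sqrt_sub1_le a0; have := ler_norm (Num.sqrt a - 1); have := ler_norm (- (x - 1)).
  by rewrite normrN -/y -/al; lra.
have xE : x ^+ 2 - a <= y ^+ 2 + 2 * y + al.
  have -> : y ^+ 2 = (x - 1) ^+ 2 by rewrite /y real_normK ?num_real.
  have := ler_norm (x - 1); have := ler_norm (- (a - 1)); rewrite normrN -/y -/al; lra.
have r1 : r <= y ^+ 2 + 2 * y + al + 4 * (kap * s) + 2 * (kap * al) + 2 * (kap * y).
  by have := ler_wpM2l kap0 mE; lra.
have yy : y ^+ 2 <= 2 * c ^+ 2 * (s ^+ 2 + eps ^+ 2).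
  apply: (@le_trans _ _ ((c * (s + eps)) ^+ 2)).
    by apply: lerXn2r => //; rewrite nnegrE// mulr_ge0// addr_ge0.
  by have := mulr_ge0 (sqr_ge0 c) (sqr_ge0 (s - eps)); lra.
have ky := ler_wpM2l kap0 xc.
have h1 := young eps 1; have h2 := young al 1; have h3 := young al kap.
have h4 := ler_wpM2l c0 (young eps kap); have h5 := ler_wpM2l c0 h1.
have h6 := mulr_ge0 s0 (sqr_ge0 (kap - 1)); have h7 := mulr_ge0 c0 h6.
rewrite !expr1n !mulr1 in h1 h2 h5.
by lra.
Qed.
End scalar.

(** * Error bounds *)

Section gaussian_matrix.
Variable R : realType.
Local Notation e := (expR (1 / 2) : R).

Section subgradient.
Variables l m : nat.
Local Notation nn := (@nuclear_norm R l m).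

Lemma hsdot_vmx (x : 'I_l * 'I_m -> R) (U : 'M[R]_(l, m)) :
  hsdot (vmx x) U = \sum_ij U ij.1 ij.2 * x ij.
Proof.
rewrite hsdotE pair_big/=; apply: eq_bigr => -[i j] _.
by rewrite mxE mulrC.
Qed.

Lemma nuclear_subgradient (x : 'I_l * 'I_m -> R) :
  exists2 u : 'I_l * 'I_m -> R, \sum_i u i ^+ 2 <= (minn l m)%:R &
    forall y, nn (vmx x) - nn (vmx y) <= \sum_i u i * (x i - y i).
Proof.
have [U [xU U1 UU]] := nuclear_witness (vmx x).
exists (fun ij => U ij.1 ij.2) => [|y].
  apply: le_trans UU; rewrite hsdotE pair_big/=.
  by under eq_bigr do rewrite expr2.
under eq_bigr do rewrite mulrBr.
rewrite sumrB -!hsdot_vmx xU lerD2l lerN2; exact: nuclear_le_of_opbnd.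
Qed.

Lemma sqn_vmx d (T : measurableType d) (X : 'I_l * 'I_m -> T -> R) w :
  sqn X w = hs_norm (vmx (X ^~ w)) ^+ 2.
Proof.
by rewrite hs_norm_sqr hsdot_vmx; apply: eq_bigr => -[i j] _; rewrite mxE expr2.
Qed.

Hypotheses (l0 : (0 < l)%N) (m0 : (0 < m)%N).
Local Notation N := ((l * m)%:R : R).
Local Notation n := ((maxn l m)%:R : R).
Context d (T : measurableType d) (P : probability T R).
Variables X Z : 'I_l * 'I_m -> T -> R.
Hypotheses (gX : iid_gaussian P X) (gZ : iid_gaussian P Z).

Let cardI : #|{: 'I_l * 'I_m}| = (l * m)%N.
Proof. by rewrite card_prod !card_ord. Qed.

Let n1 : 1 <= n. Proof. by rewrite ler1n; lia. Qed.
Let N1 : 1 <= N. Proof. by rewrite ler1n muln_gt0 l0. Qed.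

Let n0 : 0 < n. Proof. exact: lt_le_trans ltr01 n1. Qed.
Let N0 : 0 < N. Proof. exact: lt_le_trans ltr01 N1. Qed.

Lemma mean_nuclear_gap : mean_le P
  (fun w => (`|nn (vmx (X ^~ w)) - nn (vmx (Z ^~ w))| * Num.sqrt n / N) ^+ 2)
  (1024 * e / N).
Proof.
have k0 : 0 < (minn l m)%:R :> R by rewrite ltr0n; lia.
have I0 : (0 < #|{: 'I_l * 'I_m}|)%N by rewrite cardI muln_gt0 l0.
have [a ha] := gaussian_concentration gZ I0 k0 nuclear_subgradient.
have mn : measurable_fun setT (fun x : fspace R ('I_l * 'I_m)%type => nn (vmx x)).
  apply: (@measurable_lipschitz R _ _ (fspace R ('I_l * 'I_m)%type) id
    (fun x => nn (vmx x)) (Num.sqrt (minn l m)%:R)).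
  - exact: sqrtr_ge0.
  - exact: subgradient_lipschitz k0 nuclear_subgradient.
  - by move=> i; exact: measurable_coord.
have mF : measurable_fun setT (fun x : fspace R ('I_l * 'I_m)%type => (nn (vmx x) - a) ^+ 2).
  by apply: measurable_funX; exact: measurable_funB.
have hb := mean_le_law gZ gX mF (fun=> sqr_ge0 _) ha.
have mX (V : 'I_l * 'I_m -> T -> R) : iid_gaussian P V ->
    measurable_fun setT (fun w => nn (vmx (V ^~ w))).
  by move=> gV; apply: (measurableT_comp mn); apply: measurable_fspace => i; case: gV.
have c0 : 0 <= 2 * (n / N ^+ 2) by rewrite mulr_ge0// divr_ge0 ?sqr_ge0//; lra.
apply: mean_le_mono (mean_le_trans _ (mean_leZ c0 (mean_leD ha hb))).
- apply: measurable_funX; do 2 (apply: measurable_funM => //).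
  apply: measurableT_comp => //; apply: measurable_funB; exact: mX.
- move=> w; rewrite sqr_ge0/=; set u := nn _; set v := nn _.
  have q2 : Num.sqrt n ^+ 2 = n by rewrite sqr_sqrtr//; lra.
  rewrite !exprMn exprVn q2 real_normK ?num_real// -mulrA mulrC.
  rewrite [2 * (_ / _)]mulrC -[leRHS]mulrA ler_wpM2l ?divr_ge0 ?sqr_ge0//.
  by move: u v => u v; have := sqr_ge0 (u + v - 2 * a); lra.
- rewrite -(minn_maxn_natr R l m); rewrite le_eqVlt; apply/orP; left; apply/eqP.
  by field; rewrite !gt_eqF.
Qed.

(** Zero off the exceptional event and at least 1 on it. The threshold e^(-3) makes the bound of
    [prob_sqn_small] equal to e^(-1) per coordinate. *)
Definition degenerate w : R :=
  (expR (21 * n) < lattice_sum (vmx (Z ^~ w)))%R%:R + (sqn Z w <= expR (-3) * N)%R%:R.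

(** Both probabilities are at most e^(-n). As n^2 >= N, the inequality n^30 <= 30! e^n turns this
    into a power N^(-15). *)
Lemma mean_degenerate : mean_le P degenerate (2 * 30`!%:R / N ^+ 15).
Proof.
have h1 := prob_lattice_sum_large l0 gZ.
have h2 := prob_sqn_small gZ (expR_gt0 (-3 : R)); rewrite cardI in h2.
apply: mean_le_trans (mean_leD h1 h2).
have nN : n <= N by rewrite ler_nat; case: (leqP l m) => _; [rewrite leq_pmull|rewrite leq_pmulr].
have Nn : N <= n ^+ 2 by rewrite -natrX ler_nat -mulnn leq_mul ?leq_maxl ?leq_maxr.
have -> : Num.sqrt (expR 1 * expR (-3)) ^+ (l * m) = expR (- N).
  have -> : expR 1 * expR (-3) = expR (-1) ^+ 2 :> R.
    by rewrite expr2 -!expRD; congr expR; lra.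
  by rewrite sqrtr_sqr ger0_norm ?expR_ge0// -expRM_natr mulN1r.
have h3 : expR (- N) <= expR (- n) by rewrite ler_expR lerN2.
suff h4 : expR (- n) <= 30`!%:R / N ^+ 15.
  by rewrite -[leRHS]mulrA [leRHS]mulr_natl mulr2n lerD// (le_trans h3).
have Np : 0 < N ^+ 15 by rewrite exprn_gt0.
rewrite expRN ler_pdivlMr// mulrC ler_pdivrMr ?expR_gt0//.
apply: le_trans (expR_pow_le 30 (le_trans ler01 n1)).
have -> : n ^+ 30 = (n ^+ 2) ^+ 15 by rewrite -exprM.
by apply: lerXn2r => //; rewrite nnegrE ?exprn_ge0.
Qed.

Lemma good_nuclear w : degenerate w = 0 ->
  (21 * expR 3)^-1 * N / Num.sqrt n <= nn (vmx (Z ^~ w)).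
Proof.
rewrite /degenerate => /eqP; rewrite paddr_eq0// !pnatr_eq0 !eqb0 -leNgt -ltNge.
move=> /andP[Psi sq].
have q0 : 0 < Num.sqrt n by rewrite sqrtr_gt0 n0.
have K0 : 0 < 21 * Num.sqrt n by rewrite mulr_gt0.
have ZK : opbnd (vmx (Z ^~ w)) (21 * Num.sqrt n).
  move=> u v u1 v1; apply: le_trans (@opbnd_op_bound R l m l0 (vmx (Z ^~ w)) u v u1 v1) _.
  exact: op_bound_le.
apply: le_trans (nuclear_lower K0 ZK); rewrite -sqn_vmx invfM -expRN.
rewrite ler_pdivlMr// (le_trans _ (ltW sq))// le_eqVlt; apply/orP; left; apply/eqP.
by field; rewrite gt_eqF.
Qed.

Lemma mean_kappa : mean_le P
  (fun w => (op_bound (vmx (X ^~ w)) / Num.sqrt n) ^+ 2) 808.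
Proof.
have ni0 : 0 <= n^-1 by rewrite invr_ge0 ltW.
have := mean_leZ ni0 (mean_op_bound_sqr l0 gX).
rewrite mulrCA mulVf ?mulr1; last by rewrite gt_eqF.
congr mean_le; apply/funext => w.
by rewrite [RHS]expr_div_n (sqr_sqrtr (ltW n0)) [LHS]mulrC.
Qed.

Lemma mean_alpha : mean_le P (fun w => (sqn X w / N - 1) ^+ 2) (64 * expR (1 / 4) / N).
Proof.
have I0 : (0 < #|{: 'I_l * 'I_m}|)%N by rewrite cardI muln_gt0 l0.
have c0 : 0 <= N ^- 2 by rewrite invr_ge0 sqr_ge0.
have := mean_leZ c0 (mean_sqn_centered_sqr gX I0); rewrite cardI.
have -> : N ^- 2 * (64 * expR (1 / 4) * N) = 64 * expR (1 / 4) / N.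
  field.
  by rewrite !pnatr_eq0 -!lt0n l0 m0.
congr mean_le; apply/funext => w.
field.
by rewrite !pnatr_eq0 -!lt0n l0 m0.
Qed.
End subgradient.

Lemma gaussian_matrix_moments : exists2 K : R, 0 <= K &
  forall (l m : nat) d (T : measurableType d) (P : probability T R)
    (X Z : 'I_l * 'I_m -> T -> R), (0 < l)%N -> (0 < m)%N -> iid_gaussian P X -> iid_gaussian P Z ->
  let N := (l * m)%:R : R in
  [/\ mean_le P (fun w => (`|nuclear_norm (vmx (X ^~ w)) - nuclear_norm (vmx (Z ^~ w))|
        * Num.sqrt (maxn l m)%:R / N) ^+ 2) (K / N),
      mean_le P (fun w => (op_bound (vmx (X ^~ w)) / Num.sqrt (maxn l m)%:R) ^+ 2) K,
      mean_le P (fun w => (sqn X w / N - 1) ^+ 2) (K / N),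
      mean_le P (degenerate Z) (K / N ^+ 15) &
      (3 <= l * m)%N ->
        mean_le P (fun w => Num.sqrt (Num.sqrt (N / sqn Z w)) ^+ 5) K /\
        mean_le P (fun w => (sqn X w / N) ^+ 10) K].
Proof.
(* Abstract variables: [lra] would compute the factorials below. *)
have upper (a b c f g h : R) : 0 <= a -> 0 <= b -> 0 <= c -> 0 <= f -> 0 <= g -> 0 <= h ->
    exists K : R, [/\ 0 <= K, a <= K, b <= K, c <= K & [/\ f <= K, g <= K & h <= K]].
  move=> a0 b0 c0 f0 g0 h0; exists (a + b + c + f + g + h); split; [lra..|].
  by split; lra.
have p1 (x y : R) := @mulr_ge0 R x y.
have [K [K0 K1 K2 K3 [K4 K5 K6]]] := upper _ _ _ _ _ _
  (p1 1024 _ (ler0n _ _) (expR_ge0 (1 / 2))) (ler0n _ 808)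
  (p1 64 _ (ler0n _ _) (expR_ge0 (1 / 4))) (p1 2 _ (ler0n _ _) (ler0n _ 30`!))
  (p1 64 _ (ler0n _ _) (sqr_ge0 (expR 1)))
  (p1 _ _ (p1 _ _ (exprn_ge0 10 (ler0n _ 4)) (ler0n _ 10`!)) (expR_ge0 (1 / 2))).
exists K => // l m d T P X Z l0 m0 gX gZ N.
have N0 : 0 < N by rewrite ltr0n muln_gt0 l0.
have Ni : 0 <= N^-1 by rewrite invr_ge0 ltW.
have Ni15 : 0 <= N ^- 15 by rewrite invr_ge0 exprn_ge0// ltW.
have cardI : #|{: 'I_l * 'I_m}| = (l * m)%N by rewrite card_prod !card_ord.
split => [||||lm3].
- exact: mean_le_trans (ler_wpM2r Ni K1) (mean_nuclear_gap l0 m0 gX gZ).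
- exact: mean_le_trans K2 (mean_kappa l0 m0 gX).
- exact: mean_le_trans (ler_wpM2r Ni K3) (mean_alpha l0 m0 gX).
- exact: mean_le_trans (ler_wpM2r Ni15 K4) (mean_degenerate l0 m0 gZ).
- split.
    have := mean_inverse_sqn gZ; rewrite cardI => /(_ lm3).
    exact: mean_le_trans.
  have := mean_sqn_pow gX 10; rewrite cardI muln_gt0 l0 => /(_ m0).
  exact: mean_le_trans.
Qed.

Lemma normal_prob_affine (m s : R) (B : set R) : 0 < s -> measurable B ->
  normal_prob m s ((fun y => (y - m) / s) @^-1` B) = normal_prob 0 1 B.
Proof.
move=> s0 mB.
have mf : measurable_fun setT (fun y : R => (y - m) / s).
  by apply: measurable_funM => //; exact: measurable_funB.
have mB' : measurable ((fun y : R => (y - m) / s) @^-1` B).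
  by rewrite -[X in measurable X]setTI; exact: mf.
set B' := _ @^-1` B.
transitivity (\int[normal_prob m s]_x (\1_B' x)%:E)%E.
  by rewrite integral_indic// setIT.
transitivity (\int[normal_prob 0 1]_x (\1_B x)%:E)%E; last by rewrite integral_indic// setIT.
rewrite integral_normal_affine//; last exact/measurable_EFinP/measurable_indic.
apply: eq_integral => x _.
congr _%:E; rewrite !indicE; congr (_ : bool)%:R.
by apply: asbool_equiv_eq; rewrite /B' /preimage/= addrK mulrAC divff ?mul1r// gt_eqF.
Qed.

Lemma iid_gaussian_standardize (l m : nat) d (T : measurableType d) (P : probability T R)
    (M : 'M[R]_(l, m)) (sg : R) (Y : 'I_l -> 'I_m -> {RV P >-> R}) :
  0 < sg -> independent_entries Y ->
  (forall i j, normally_distributed (Y i j) (M i j) sg) ->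
  iid_gaussian P (fun (ij : 'I_l * 'I_m) w => (Y ij.1 ij.2 w - M ij.1 ij.2) / sg).
Proof.
move=> sg0 indY nY; split => [i|B mB].
  by apply: measurable_funM => //; exact: measurable_funB.
pose B' (ij : 'I_l * 'I_m) : set R := (fun y => (y - M ij.1 ij.2) / sg) @^-1` B ij.
have mB' ij : measurable (B' ij).
  rewrite -[X in measurable X]setTI.
  have mf : measurable_fun setT (fun y : R => (y - M ij.1 ij.2) / sg).
    by apply: measurable_funM => //; exact: measurable_funB.
  exact: mf.
have := indY [set: 'I_l * 'I_m]%SET B' mB'.
rewrite (_ : \bigcap_(i in _) _ =
    [set w | forall ij, B ij ((Y ij.1 ij.2 w - M ij.1 ij.2) / sg)]); last first.
  apply/seteqP; split => w /= => [H ij|H ij _]; last exact: H.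
  by have := H ij; rewrite /= inE => /(_ isT).
move=> ->; rewrite big_mkcond/=; apply: eq_bigr => -[i j] _; rewrite inE.
rewrite -(normal_prob_affine (M i j) sg0 (mB (i, j))) -(nY i j)//.
exact: (mB' (i, j)).
Qed.
End gaussian_matrix.

(** * Measurable majorants of the two losses *)

Section error_bounds.
Variable R : realType.

Lemma young_pow4 (a b : R) : 0 <= a -> 0 <= b -> a ^+ 4 * b <= a ^+ 5 + b ^+ 5.
Proof.
move=> a0 b0; have [ab|/ltW ba] := lerP b a.
  have h : a ^+ 4 * b <= a ^+ 5 by rewrite [a ^+ 5]exprSr ler_wpM2l ?exprn_ge0.
  by have := exprn_ge0 5 b0; lra.
have h : a ^+ 4 * b <= b ^+ 5.
  by rewrite [b ^+ 5]exprSr ler_wpM2r//; apply: lerXn2r.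
by have := exprn_ge0 5 a0; lra.
Qed.

(** With w^4 = N / |Z|^2 the fifth power of w is the inverse moment of order 5/2. Young's exponent
    conjugate to 5/4 is 5, doubled to 10 when a and z are separated. *)
Lemma young_mul_pow4 (a w z : R) : 0 <= a -> 0 <= w -> 0 <= z ->
  a * w ^+ 4 * z <= a ^+ 10 + w ^+ 5 + z ^+ 10.
Proof.
move=> a0 w0 z0; have := young_pow4 w0 (mulr_ge0 a0 z0).
have -> : a * w ^+ 4 * z = w ^+ 4 * (a * z) by ring.
move=> /le_trans; apply; rewrite exprMn.
have -> : a ^+ 10 = (a ^+ 5) ^+ 2 by rewrite -exprM.
have -> : z ^+ 10 = (z ^+ 5) ^+ 2 by rewrite -exprM.
move: (a ^+ 5) (z ^+ 5) (w ^+ 5) => u v t.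
by have := sqr_ge0 (u - v); have := sqr_ge0 u; have := sqr_ge0 v; lra.
Qed.

Lemma majorant_bound (c s q p N K n15 : R) : 0 <= c -> 0 <= s -> 0 < p -> 0 <= K ->
  p ^+ 2 = N -> q = p^-1 -> q <= 1 -> 0 <= n15 -> n15 <= q ^+ 2 -> N * n15 <= 1 ->
  [/\ 0 <= 2 * c ^+ 2 * s ^+ 2 + 2 * c * s + c * q + q / 2 + 2 * s + c * s + 9 * q,
      0 <= 2 * c ^+ 2 + 2 * c * p, 0 <= 2 * s + q + c * s + c * q,
      0 <= 18 * (s ^+ 2 * N + 1) &
  2 * c ^+ 2 * s ^+ 2 + 2 * c * s + c * q + q / 2 + 2 * s + c * s + 9 * q
  + (2 * c ^+ 2 + 2 * c * p) * (K * q ^+ 2) + (2 * s + q + c * s + c * q) * K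
  + (3 / 2 * p + 9 * p) * (K * q ^+ 2) + 18 * (s ^+ 2 * N + 1) * (K * n15)
  <= (2 * c ^+ 2 + 3 * c + 10 + K * (2 * c ^+ 2 + 3 * c + 30)) * (s + s ^+ 2 + q)].
Proof.
move=> c0 s0 p0 K0 pN qE q1 n0 nq Nn.
have q0 : 0 < q by rewrite qE invr_gt0.
have pq : p * q ^+ 2 = q by rewrite qE expr2 mulrA divff ?mul1r// gt_eqF.
have N0 : 0 <= N by rewrite -pN sqr_ge0.
have q2 : q ^+ 2 <= q by rewrite expr2 ger_pMr.
have c2 : 0 <= c ^+ 2 := sqr_ge0 c; have s2 : 0 <= s ^+ 2 := sqr_ge0 s.
have q0' := ltW q0; have Kc := mulr_ge0 K0 c0; have Kc2 := mulr_ge0 K0 c2.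
have h1 := mulr_ge0 c2 s0; have h2 := mulr_ge0 c2 s2; have h3 := mulr_ge0 c2 q0'.
have h4 := mulr_ge0 c0 s0; have h5 := mulr_ge0 c0 s2; have h6 := mulr_ge0 c0 q0'.
have h7 := mulr_ge0 K0 s0; have h8 := mulr_ge0 K0 s2; have h9 := mulr_ge0 K0 q0'.
have g1 := mulr_ge0 Kc s0; have g2 := mulr_ge0 Kc s2; have g3 := mulr_ge0 Kc q0'.
have g4 := mulr_ge0 Kc2 s0; have g5 := mulr_ge0 Kc2 s2; have g6 := mulr_ge0 Kc2 q0'.
have cp := mulr_ge0 c0 (ltW p0); have sN := mulr_ge0 s2 N0.
have k1 := ler_wpM2l Kc2 q2; have k2 := ler_wpM2l K0 (le_trans nq q2).
have k3 := ler_wpM2l h8 Nn.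
split; [lra..|].
have -> : (2 * c ^+ 2 + 2 * c * p) * (K * q ^+ 2) =
    2 * (K * c ^+ 2 * q ^+ 2) + 2 * (K * c * (p * q ^+ 2)) by ring.
have -> : (3 / 2 * p + 9 * p) * (K * q ^+ 2) = 21 / 2 * (K * (p * q ^+ 2)) by field.
have -> : 18 * (s ^+ 2 * N + 1) * (K * n15) =
    18 * (K * s ^+ 2 * (N * n15)) + 18 * (K * n15) by ring.
by rewrite pq; lra.
Qed.

Section bounds.
Variables (l m : nat) (M : 'M[R]_(l, m)) (sg s : R).
Hypotheses (l0 : (0 < l)%N) (m0 : (0 < m)%N) (sg0 : 0 < sg).
Local Notation N := ((l * m)%:R : R).
Local Notation n := ((maxn l m)%:R : R).
Local Notation nn := (@nuclear_norm R l m).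
Hypotheses (s0 : 0 <= s) (Ms : nn M / sg * Num.sqrt n <= s * N).
Context d (T : measurableType d) (P : probability T R).
Variables (X Z : 'I_l * 'I_m -> T -> R).

Let N1 : 1 <= N. Proof. by rewrite ler1n muln_gt0 l0. Qed.
Let N0 : 0 < N. Proof. exact: lt_le_trans ltr01 N1. Qed.
Let n1 : 1 <= n. Proof. by rewrite ler1n; lia. Qed.
Let n0 : 0 < n. Proof. exact: lt_le_trans ltr01 n1. Qed.
Let q0 : 0 < Num.sqrt n. Proof. by rewrite sqrtr_gt0. Qed.

(** The inverse of the constant in [good_nuclear]: 21 from the operator norm of Z, e^3 from |Z|^2 >
    e^(-3) N. *)
Definition ratio_const : R := 21 * expR 3.
Let cg0 : 0 < ratio_const. Proof. by rewrite mulr_gt0 ?expR_gt0. Qed.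

Local Notation W := (fun w => vmx (X ^~ w)).
Local Notation V := (fun w => vmx (Z ^~ w)).
Let x w := nn (M + sg *: W w) / nn (V w) / sg.
Let eps w := `|nn (W w) - nn (V w)| * Num.sqrt n / N.
Let bad w := degenerate Z w.

Let x_ge0 w : 0 <= x w.
Proof. by rewrite /x !divr_ge0 ?nuclear_ge0 ?(ltW sg0). Qed.

Let eps_ge0 w : 0 <= eps w.
Proof. by rewrite /eps divr_ge0 ?mulr_ge0 ?(ltW q0) ?(ltW N0). Qed.

Let bad_ge0 w : 0 <= bad w.
Proof. by rewrite /bad /degenerate addr_ge0. Qed.

Let bad_cases w : bad w = 0 \/ 1 <= bad w.
Proof.
rewrite /bad /degenerate; case: (_ < _); case: (_ <= _); rewrite ?addr0 ?add0r.
- by right; rewrite lerDl.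
- by right.
- by right.
- by left.
Qed.

Lemma good_ratio w : degenerate Z w = 0 -> `|x w - 1| <= ratio_const * (s + eps w).
Proof.
move=> /(good_nuclear l0 m0) bZ.
have b0 : 0 < ratio_const^-1 * N / Num.sqrt n by rewrite divr_gt0// mulr_gt0// invr_gt0.
apply: le_trans (ratio_close M (W w) sg0 b0 bZ) _.
rewrite ler_pdivrMr//.
have -> : ratio_const * (s + eps w) * (ratio_const^-1 * N / Num.sqrt n) =
    s * N / Num.sqrt n + `|nn (W w) - nn (V w)|.
  rewrite /eps; move: `|_| => t; move: (Num.sqrt n) q0 => q q0'.
  by move: N N0 ratio_const cg0 => u u0 v v0; field; rewrite !gt_eqF.
by rewrite lerD2r ler_pdivlMr.
Qed.

Let scaled_M : (nn M / sg) ^+ 2 <= s ^+ 2 * N * (minn l m)%:R.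
Proof.
have h : (nn M / sg * Num.sqrt n) ^+ 2 <= (s * N) ^+ 2.
  apply: lerXn2r => //; rewrite nnegrE; last by rewrite mulr_ge0 ?(ltW N0).
  by rewrite mulr_ge0 ?divr_ge0 ?nuclear_ge0 ?(ltW sg0) ?(ltW q0).
move: h; rewrite exprMn (sqr_sqrtr (ltW n0)) -ler_pdivlMr// => /le_trans; apply.
rewrite -(minn_maxn_natr R l m) le_eqVlt; apply/orP; left; apply/eqP.
by field; rewrite gt_eqF.
Qed.

Let kappa w := op_bound (W w) / Num.sqrt n.
Let A w := sqn X w / N.
Let p := Num.sqrt N.
Let q := p^-1.

Let p0 : 0 < p. Proof. by rewrite sqrtr_gt0. Qed.
Let p2 : p ^+ 2 = N. Proof. by rewrite sqr_sqrtr// ltW. Qed.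

(** The bound of [good_error_bound], valid off the exceptional event, enlarged by the terms in 9 and
    18 that the exceptional event requires. *)
Definition error_majorant w : R :=
  2 * ratio_const ^+ 2 * s ^+ 2 + 2 * ratio_const * s + ratio_const * q + q / 2 + 2 * s
    + ratio_const * s + 9 * q
    + (2 * ratio_const ^+ 2 + 2 * ratio_const * p) * eps w ^+ 2
    + (2 * s + q + ratio_const * s + ratio_const * q) * kappa w ^+ 2
    + (3 / 2 * p + 9 * p) * (A w - 1) ^+ 2
    + 18 * (s ^+ 2 * N + 1) * bad w.

Lemma error_le_majorant w (Mh : 'M[R]_(l, m)) :
  argmin nn [set B | hs_norm (M + sg *: W w - B) ^+ 2 <= N * (sg * x w) ^+ 2] Mh ->
  hs_norm (Mh - M) ^+ 2 / (N * sg ^+ 2) <= error_majorant w.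
Proof.
move=> MhP; rewrite /error_majorant.
have q_gt0 : 0 < q by rewrite invr_gt0.
have c0 := ltW cg0; have s2 : 0 <= s ^+ 2 := sqr_ge0 s.
have kap0 : 0 <= kappa w by rewrite divr_ge0 ?op_bound_ge0 ?(ltW q0).
have A0 : 0 <= A w by rewrite divr_ge0 ?sqn_ge0 ?(ltW N0).
have AE : hs_norm (W w) ^+ 2 / N = A w by rewrite /A sqn_vmx.
have pa0 : 0 <= p * (A w - 1) ^+ 2 by rewrite mulr_ge0 ?sqr_ge0 ?(ltW p0).
have t1 : 0 <= (2 * ratio_const ^+ 2 + 2 * ratio_const * p) * eps w ^+ 2.
  by rewrite mulr_ge0 ?sqr_ge0// addr_ge0 ?mulr_ge0 ?(ltW p0)// sqr_ge0.
have t2 : 0 <= (2 * s + q + ratio_const * s + ratio_const * q) * kappa w ^+ 2.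
  by rewrite mulr_ge0 ?sqr_ge0// !addr_ge0 ?mulr_ge0 ?(ltW q_gt0).
have t3 : 0 <= (s ^+ 2 * N + 1) * bad w.
  by rewrite mulr_ge0 ?bad_ge0// addr_ge0 ?mulr_ge0 ?(ltW N0).
have [good|bad1] := bad_cases w.
  have := minimizer_error l0 m0 sg0 (x_ge0 w) MhP (op_bound_ge0 l0 (W w))
    (opbnd_op_bound l0 (W w)) Ms.
  rewrite AE -/(kappa w) => r1.
  have := good_error_bound A0 kap0 s0 (eps_ge0 w) c0 p0 (good_ratio good) r1.
  rewrite real_normK ?num_real// -/q good mulr0.
  move=> /le_trans; apply.
  move: t1 t2 pa0 q_gt0; move: (_ * eps w ^+ 2) (_ * kappa w ^+ 2) ((A w - 1) ^+ 2) => u1 u2 u3.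
  lra.
have h := minimizer_error_crude MhP.
have kN : (minn l m)%:R <= N.
  by rewrite ler_nat; case: (leqP l m) => _; [rewrite leq_pmulr|rewrite leq_pmull].
have MN : hs_norm M ^+ 2 / sg ^+ 2 <= s ^+ 2 * N * N.
  rewrite -expr_div_n; apply: (@le_trans _ _ ((nn M / sg) ^+ 2)).
    apply: lerXn2r; rewrite ?nnegrE ?divr_ge0 ?nuclear_ge0 ?hs_norm_ge0 ?(ltW sg0)//.
    by rewrite ler_wpM2r ?hs_le_nuclear// invr_ge0 ltW.
  by apply: le_trans scaled_M _; rewrite ler_wpM2l// mulr_ge0// ltW.
(* Of 18 A w, only the 18 is charged to [bad w]; the excess A w - 1 is bounded at every outcome by
   Young's inequality, and half of 18 gives the terms 9 p and 9 q. This avoids the mean of a product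
   with [bad w]. *)
have a1 : A w <= 1 + (p * (A w - 1) ^+ 2 + q) / 2.
  have := mulr_ge0 (ltW q_gt0) (sqr_ge0 (p * (A w - 1) - 1)).
  have pq : p * q = 1 by rewrite divff// gt_eqF.
  have -> : q * (p * (A w - 1) - 1) ^+ 2 = p * q * (p * (A w - 1) ^+ 2 - 2 * (A w - 1)) + q by ring.
  by rewrite pq; move: (_ ^+ 2) => u; lra.
have r18 : hs_norm (Mh - M) ^+ 2 / (N * sg ^+ 2) <= 18 * (s ^+ 2 * N + A w).
  have sg2 : 0 < sg ^+ 2 by rewrite exprn_gt0.
  rewrite invfM mulrCA ler_pdivrMl// ler_pdivrMr//; apply: le_trans h _.
  rewrite -AE; move: MN; rewrite ler_pdivrMr//.
  move: (hs_norm M ^+ 2) (hs_norm (vmx _) ^+ 2) (sg ^+ 2) => u v y uE.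
  have -> : N * (18 * (s ^+ 2 * N + v / N)) * y = 18 * (s ^+ 2 * N * N * y + y * v).
    by move: N N0 => t t0; field; rewrite gt_eqF.
  by rewrite ler_wpM2l// lerD2r.
apply: le_trans r18 _.
have sN0 : 0 <= s ^+ 2 * N by rewrite mulr_ge0// ltW.
have b1 := ler_wpM2l (_ : 0 <= s ^+ 2 * N + 1) bad1.
have {}b1 := b1 (addr_ge0 sN0 ler01).
have a01 : 0 <= ratio_const ^+ 2 * s ^+ 2 by rewrite mulr_ge0 ?sqr_ge0.
have a02 : 0 <= ratio_const * s by rewrite mulr_ge0.
have a03 : 0 <= ratio_const * q by rewrite mulr_ge0 // ltW.
move: t1 t2 pa0 q_gt0 b1 a1 a01 a02 a03.
move: (_ * eps w ^+ 2) (_ * kappa w ^+ 2) ((A w - 1) ^+ 2) => u1 u2 u3.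
move: (A w) (bad w) (s ^+ 2 * N) q p ratio_const s0 => u4 u5 v4 q' p' c s0'.
move=> *; lra.
Qed.

Lemma mean_error_majorant (K : R) : 0 <= K ->
  mean_le P (fun w => eps w ^+ 2) (K / N) -> mean_le P (fun w => kappa w ^+ 2) K ->
  mean_le P (fun w => (A w - 1) ^+ 2) (K / N) -> mean_le P bad (K / N ^+ 15) ->
  mean_le P error_majorant
    ((2 * ratio_const ^+ 2 + 3 * ratio_const + 10
      + K * (2 * ratio_const ^+ 2 + 3 * ratio_const + 30)) * (s + s ^+ 2 + q)).
Proof.
move=> K0 m1 m2 m3 m4.
have p1 : 1 <= p by rewrite /p -[leLHS]sqrtr1 ler_sqrt// ltW.
have q1 : q <= 1 by rewrite invf_le1.
have Nq : N^-1 = q ^+ 2 by rewrite -p2 exprVn.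
have n15 : 0 <= N ^- 15 by rewrite invr_ge0 exprn_ge0// ltW.
have N15 : N ^- 15 <= q ^+ 2.
  by rewrite -Nq lef_pV2 ?posrE ?exprn_gt0// -[leLHS]expr1 ler_weXn2l.
have NN15 : N * N ^- 15 <= 1.
  by rewrite ler_pdivrMr ?exprn_gt0// mul1r -[leLHS]expr1 ler_weXn2l.
rewrite Nq in m1 m3.
have [a0 a1 a2 a4 bnd] := majorant_bound (ltW cg0) s0 p0 K0 p2 erefl q1 n15 N15 NN15.
have a3 : 0 <= 3 / 2 * p + 9 * p by rewrite addr_ge0 ?mulr_ge0 ?(ltW p0).
apply: (mean_le_trans bnd).
exact: mean_leD (mean_leD (mean_leD (mean_leD (mean_le_cst P a0)
  (mean_leZ a1 m1)) (mean_leZ a2 m2)) (mean_leZ a3 m3)) (mean_leZ a4 m4).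
Qed.

(** The powers N^5 and N^15 in front of [bad w] are harmless because its mean is O(N^(-15)). *)
Definition ratio_majorant w : R :=
  2 * ratio_const ^+ 2 * s ^+ 2 + 2 * ratio_const ^+ 2 * eps w ^+ 2 + bad w
  + 2 * s ^+ 2 * (Num.sqrt (Num.sqrt (N / sqn Z w)) ^+ 5 + N ^+ 5 * bad w)
  + 2 / N * (A w ^+ 10 + Num.sqrt (Num.sqrt (N / sqn Z w)) ^+ 5 + N ^+ 15 * bad w).

Lemma ratio_le_majorant w : (x w - 1) ^+ 2 <= ratio_majorant w.
Proof.
rewrite /ratio_majorant; set om := Num.sqrt (Num.sqrt _).
have om0 : 0 <= om by exact: sqrtr_ge0.
have v0 : 0 <= N / sqn Z w by rewrite divr_ge0 ?sqn_ge0 ?(ltW N0).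
have A0 : 0 <= A w by rewrite divr_ge0 ?sqn_ge0 ?(ltW N0).
have b0 := bad_ge0 w; have s2 : 0 <= s ^+ 2 := sqr_ge0 s.
have om5 : 0 <= om ^+ 5 by rewrite exprn_ge0.
have N5 : 0 <= N ^+ 5 by rewrite exprn_ge0// ltW.
have N15 : 0 <= N ^+ 15 by rewrite exprn_ge0// ltW.
have A10 : 0 <= A w ^+ 10 by rewrite exprn_ge0.
have Ni : 0 <= 2 / N by rewrite divr_ge0// ltW.
have om4 : om ^+ 4 = N / sqn Z w.
  by rewrite -[4%N]/(2 * 2)%N exprM !sqr_sqrtr// sqrtr_ge0.
have [good|bad1] := bad_cases w.
  have := good_ratio good; set y := `|_| => yc.
  have y2 : (x w - 1) ^+ 2 = y ^+ 2 by rewrite real_normK ?num_real.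
  rewrite y2.
  apply: (@le_trans _ _ (2 * ratio_const ^+ 2 * s ^+ 2 + 2 * ratio_const ^+ 2 * eps w ^+ 2)).
    apply: (@le_trans _ _ ((ratio_const * (s + eps w)) ^+ 2)).
      apply: lerXn2r => //; rewrite nnegrE; first exact: normr_ge0.
      by rewrite mulr_ge0 ?(ltW cg0)// addr_ge0 ?eps_ge0.
    move: (eps w) => t; have := mulr_ge0 (sqr_ge0 ratio_const) (sqr_ge0 (s - t)); lra.
  rewrite -[leRHS]addrA -[leRHS]addrA lerDl; apply: addr_ge0 b0 (addr_ge0 _ _).
    by apply: mulr_ge0; [exact: mulr_ge0|apply: addr_ge0 => //; exact: mulr_ge0].
  by apply: mulr_ge0 => //; rewrite addr_ge0 ?mulr_ge0// addr_ge0.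
have kk : (minn l m)%:R ^+ 2 <= N.
  by rewrite -natrX ler_nat -mulnn leq_mul ?geq_minl ?geq_minr.
have kN : (minn l m)%:R <= N.
  by rewrite ler_nat; case: (leqP l m) => _; [rewrite leq_pmulr|rewrite leq_pmull].
have x2 : x w ^+ 2 <= 2 * s ^+ 2 * (om ^+ 5 + N ^+ 5) + 2 / N * (A w ^+ 10 + om ^+ 5 + N ^+ 15).
  apply: le_trans (ratio_sqr _ _ _ sg0) _.
  rewrite -!sqn_vmx.
  (* Both products are then split by Young's inequality. With k the smaller dimension, k^5 <= N^5,
     and (N k)^10 <= N^15 since k^2 <= N. *)
  apply: (@le_trans _ _ (2 * s ^+ 2 * (om ^+ 4 * (minn l m)%:R)
     + 2 / N * (A w * om ^+ 4 * (N * (minn l m)%:R)))).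
    rewrite om4 /A; have zi : 0 <= (sqn Z w)^-1 by rewrite invr_ge0 sqn_ge0.
    apply: (@le_trans _ _ (2 * (s ^+ 2 * N * (minn l m)%:R + (minn l m)%:R * sqn X w)
        * (sqn Z w)^-1)).
      by rewrite ler_wpM2r// ler_wpM2l// lerD2r.
    move: (sqn Z w)^-1 (sqn X w) (minn l m)%:R => z S k.
    rewrite le_eqVlt; apply/orP; left; apply/eqP.
    by move: N N0 => t t0; field; rewrite gt_eqF.
  apply: lerD; apply: ler_wpM2l => //; first by rewrite mulr_ge0.
    apply: le_trans (young_pow4 om0 (ler0n _ _)) _; rewrite lerD2l.
    by apply: lerXn2r => //; rewrite nnegrE// ltW.
  apply: le_trans (young_mul_pow4 A0 om0 (mulr_ge0 (ltW N0) (ler0n _ _))) _.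
  rewrite lerD2l exprMn.
  have -> : N ^+ 15 = N ^+ 10 * N ^+ 5 by rewrite -exprD.
  rewrite ler_wpM2l ?exprn_ge0 ?(ltW N0)//.
  have -> : (minn l m)%:R ^+ 10 = ((minn l m)%:R ^+ 2) ^+ 5 :> R by rewrite -exprM.
  by apply: lerXn2r; rewrite ?nnegrE ?exprn_ge0 ?(ltW N0).
have x1 : (x w - 1) ^+ 2 <= 1 + x w ^+ 2 by have := x_ge0 w; lra.
apply: (le_trans x1).
apply: (@le_trans _ _ (bad w + (2 * s ^+ 2 * (om ^+ 5 + N ^+ 5 * bad w)
    + 2 / N * (A w ^+ 10 + om ^+ 5 + N ^+ 15 * bad w)))).
  apply: lerD => //; apply: (le_trans x2); apply: lerD; apply: ler_wpM2l => //.
  - exact: mulr_ge0.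
  - by rewrite lerD2l ler_peMr.
  - by rewrite lerD2l ler_peMr.
rewrite addrA lerD2r lerD2r lerDr.
by rewrite addr_ge0 ?mulr_ge0 ?sqr_ge0.
Qed.

Lemma mean_ratio_majorant (K : R) : 0 <= K ->
  mean_le P (fun w => eps w ^+ 2) (K / N) ->
  mean_le P bad (K / N ^+ 15) ->
  mean_le P (fun w => Num.sqrt (Num.sqrt (N / sqn Z w)) ^+ 5) K ->
  mean_le P (fun w => A w ^+ 10) K ->
  mean_le P ratio_majorant ((2 * ratio_const ^+ 2 * (1 + K) + 10 * K) * (s ^+ 2 + N^-1)).
Proof.
move=> K0 m1 m2 m3 m4.
have c2 : 0 <= 2 * ratio_const ^+ 2 by rewrite mulr_ge0 ?sqr_ge0.
have s2 : 0 <= s ^+ 2 := sqr_ge0 s.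
have N5 : 0 <= N ^+ 5 by rewrite exprn_ge0// ltW.
have N15 : 0 <= N ^+ 15 by rewrite exprn_ge0// ltW.
have Ni : 0 <= 2 / N by rewrite divr_ge0// ltW.
have s2' : 0 <= 2 * s ^+ 2 by rewrite mulr_ge0.
have h := mean_leD (mean_leD (mean_leD (mean_leD (mean_le_cst P (mulr_ge0 c2 s2))
  (mean_leZ c2 m1)) m2) (mean_leZ s2' (mean_leD m3 (mean_leZ N5 m2))))
  (mean_leZ Ni (mean_leD (mean_leD m4 m3) (mean_leZ N15 m2))).
apply: mean_le_trans h.
have Ni' : 0 <= N^-1 by rewrite invr_ge0 ltW.
have e1 : K / N ^+ 15 <= K / N.
  by rewrite ler_wpM2l// lef_pV2 ?posrE ?exprn_gt0// -[leLHS]expr1 ler_weXn2l.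
have e2 : N ^+ 5 * (K / N ^+ 15) <= K.
  by rewrite mulrCA ler_piMr// ler_pdivrMr ?exprn_gt0// mul1r ler_weXn2l.
have e3 : N ^+ 15 * (K / N ^+ 15) = K by rewrite mulrCA divff ?mulr1// gt_eqF// exprn_gt0.
have h1 := ler_wpM2l s2' (lerD (lexx K) e2).
have c2K := mulr_ge0 c2 K0; have KN := mulr_ge0 K0 Ni'; have cN := mulr_ge0 c2 Ni'.
have g1 := mulr_ge0 c2K s2; have g2 := mulr_ge0 K0 s2.
rewrite e3; move: e1 h1; move: (K / N ^+ 15) (N ^+ 5 * _) => u v.
lra.
Qed.
End bounds.

Lemma sqrt_dimension_le (l m : nat) (a sg : R) : (0 < l)%N -> (0 < m)%N -> 0 < sg -> 0 <= a ->
  a / sg * Num.sqrt (maxn l m)%:R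
    <= a * (Num.sqrt l%:R + Num.sqrt m%:R) / ((l * m)%:R * sg) * (l * m)%:R.
Proof.
move=> l0 m0 sg0 a0; have N0 : 0 < (l * m)%:R :> R by rewrite ltr0n muln_gt0 l0.
have -> : a * (Num.sqrt l%:R + Num.sqrt m%:R) / ((l * m)%:R * sg) * (l * m)%:R =
    a / sg * (Num.sqrt l%:R + Num.sqrt m%:R).
  by move: (l * m)%:R N0 => t t0; field; rewrite !gt_eqF.
rewrite ler_wpM2l ?divr_ge0 ?(ltW sg0)//.
by case: (leqP l m) => _; rewrite ?lerDl ?lerDr sqrtr_ge0.
Qed.
End error_bounds.

(* The second bound needs 3 <= l * m.  If l * m <= 2, the nuclear norm of Z is
   its Hilbert-Schmidt norm, whose inverse square has infinite expectation: for
   Z independent of Y the left side is then +oo. *)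
Theorem theorem3p1 (R : realType) :
  exists C : R,
  forall (l m : nat) (M : 'M[R]_(l, m)) (sigma : R)
         (d : measure_display) (T : measurableType d) (P : probability T R)
         (Y Z : 'I_l -> 'I_m -> {RV P >-> R}) (Mhat : T -> 'M[R]_(l, m)),
    (0 < l)%N -> (0 < m)%N -> 0 < sigma ->
    independent_entries Y ->
    (forall i j, normally_distributed (Y i j) (M i j) sigma) ->
    independent_entries Z ->
    (forall i j, normally_distributed (Z i j) 0 1) ->
    is_M_hat Y Z Mhat ->
    let s := nuclear_norm M * (Num.sqrt l%:R + Num.sqrt m%:R)
             / ((l * m)%:R * sigma) in
    ('E_P[fun w => (hs_norm (Mhat w - M) ^+ 2)%R] / ((l * m)%:R * sigma ^+ 2)%:E
       <= (C * s + C * s ^+ 2 + C * Num.sqrt (1 / (l * m)%:R))%:E)%E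
    /\
    ((3 <= l * m)%N ->
     ('E_P[fun w => ((sigma_hat Y Z w / sigma - 1) ^+ 2)%R]
       <= (C * s ^+ 2 + C / (l * m)%:R)%:E)%E).
Proof.
have [K K0 moments] := gaussian_matrix_moments R.
pose c := ratio_const R; have c0 : 0 <= c by rewrite mulr_ge0 ?expR_ge0.
pose C1 := 2 * c ^+ 2 + 3 * c + 10 + K * (2 * c ^+ 2 + 3 * c + 30).
pose C2 := 2 * c ^+ 2 * (1 + K) + 10 * K.
have C10 : 0 <= C1.
  by rewrite /C1 !(addr_ge0, mulr_ge0)// sqr_ge0.
have C20 : 0 <= C2 by rewrite /C2 !(addr_ge0, mulr_ge0)// sqr_ge0.
exists (C1 + C2) => l m M sg d T P Y Z Mhat l0 m0 sg0 iY nY iZ nZ MP s.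
have N0 : 0 < (l * m)%:R :> R by rewrite ltr0n muln_gt0 l0.
have gX := iid_gaussian_standardize sg0 iY nY.
have gZ : iid_gaussian P (fun (ij : 'I_l * 'I_m) w => Z ij.1 ij.2 w).
  have := @iid_gaussian_standardize R l m d T P 0 1 Z ltr01 iZ.
  rewrite (_ : (fun _ _ => _) = fun (ij : 'I_l * 'I_m) w => Z ij.1 ij.2 w); last first.
    by apply/funext => ij; apply/funext => w; rewrite mxE subr0 divr1.
  by apply => i j; rewrite mxE; exact: nZ.
set X : 'I_l * 'I_m -> T -> R := fun ij w => _ in gX.
set Z' : 'I_l * 'I_m -> T -> R := fun ij w => _ in gZ.
have YE w : rmx Y w = M + sg *: vmx (X ^~ w).
  apply/matrixP => i j; rewrite !mxE /X/= mulrCA divff ?mulr1 ?gt_eqF//.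
  by rewrite addrC subrK.
have ZE w : rmx Z w = vmx (Z' ^~ w) by apply/matrixP => i j; rewrite !mxE.
have s0 : 0 <= s.
  rewrite /s divr_ge0 ?mulr_ge0 ?nuclear_ge0 ?addr_ge0 ?sqrtr_ge0 ?(ltW sg0)//.
have Ms := sqrt_dimension_le l0 m0 sg0 (nuclear_ge0 M); rewrite -/s in Ms.
have [m1 m2 m3 m4 m5] := moments l m d T P X Z' l0 m0 gX gZ.
split.
- have h := mean_error_majorant l0 m0 s0 K0 m1 m2 m3 m4.
  have d0 : 0 < (l * m)%:R * sg ^+ 2 by rewrite mulr_gt0 ?exprn_gt0.
  rewrite inver gt_eqF// lee_pdivrMr// -EFinM.
  have h' := mean_leZ (ltW d0) h.
  apply: le_trans (mean_le_expectation _ h') _ => [w|].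
    rewrite sqr_ge0/= mulrC -ler_pdivrMr//.
    apply: (error_le_majorant l0 m0 sg0 s0 Ms).
    have := MP w; rewrite /sigma_hat YE ZE.
    by rewrite [sg * _]mulrC divfK ?gt_eqF.
  rewrite lee_fin mulrC ler_wpM2r ?(ltW d0)//.
  rewrite div1r sqrtrV ?(ltW N0)// -!mulrDr -/c -/C1.
  rewrite ler_wpM2r ?lerDl// !addr_ge0 ?sqr_ge0 ?invr_ge0 ?sqrtr_ge0//.
move=> lm3; have [m6 m7] := m5 lm3.
have h := mean_ratio_majorant s l0 m0 K0 m1 m4 m6 m7.
apply: le_trans (mean_le_expectation _ h) _ => [w|].
  rewrite sqr_ge0/= /sigma_hat YE ZE.
  exact: (ratio_le_majorant l0 m0 sg0 s0 Ms).
rewrite lee_fin -mulrDr -/c -/C2 ler_wpM2r ?lerDr// addr_ge0 ?sqr_ge0 ?invr_ge0 ?(ltW N0)//.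
Qed.
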